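(* Let $\mathcal{T}$ be an atomic topos, $B$ an object of $\mathcal{T}$ whose hypergroupoid $G$ is decidable and locally finite, and let $\mathcal{C}^*_{\mathrm{red}}(G)$ be the closure of $A_{G,\mathbb{C}}=A_G\otimes\mathbb{C}$ in the $l^2$ representation, with time evolution $\sigma_t([g])=\chi(g)^{it}[g]$, $t\in\mathbb{R}$. For each unit $e$ of $G$, let $\eta_e$ be the vector state associated with the vector of the $l^2$ representation defined by the map $e\hookrightarrow B\to l^2(B)$, so that $\eta_e([q])=1$ if $q=e$ and $\eta_e([q])=0$ otherwise, and let $\eta=\sum_{e\in E(G)}\eta_e$ (a semi-finite weight, finite on $A_{G,\mathbb{C}}$). Then the GNS representation induced by $\eta$ is the $l^2$ representation, and $\eta$ satisfies the KMS condition at temperature one.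
   Context: Toposes are Grothendieck toposes. An atom is an object $a$ with $\mathrm{Sub}(a)\simeq\Omega$ (classically: exactly two subobjects); a topos is atomic if its atoms generate it. Hypergroupoid $G$ of $B$: arrows are the atomic subobjects of $B\times B$ (decidable: this set has decidable equality, automatic classically), units are the arrows contained in the diagonal, identified with the atomic subobjects of $B$; $E(G)$ is the set of units. Each arrow $g$ has a unique source unit $e$ and target unit $e'$ with $g\subset e'\times e$; $g^*=\{(y,x)\mid x\,g\,y\}$. $gg'$ is the set of atoms contained in the composite relation $\{(x,y)\mid\exists s,\ x\,g\,s,\ s\,g'\,y\}$. For $(x,y)\in a$ (internally), $\binom{g,g'}{a}=|\{s\mid x\,g\,s\text{ and }s\,g'\,y\}|$; for $x\in e$, $|g|_l=|\{z\mid z\,g\,x\}|$; for $y\in e'$, $|g|_r=|\{z\mid y\,g\,z\}|$; none depends on the internal choices. $G$ is locally finite if all $|g|_r$ (equivalently all $|g|_l$) are finite; then all these numbers are integers and the sets $gg'$ are finite. Put $\chi(g)=|g|_l/|g|_r$. $A_G$ is the $\mathbb{Z}$-algebra with basis $[g]$, $g\in G$, and product $[g][g']=\sum_{a\in gg'}\binom{g,g'}{a}[a]$. On $A_{G,\mathbb{C}}$ the involution is antilinear with $[g]^*=\chi(g)[g^*]$. For an internal (complex) Hilbert space $\mathcal{H}$ of $\mathcal{T}$, $\tilde{\mathcal{H}}=\bigoplus_{e\in E(G)}\mathrm{Hom}_{\mathcal{T}}(e,\mathcal{H})$, with scalar product induced by the internal one on each $\mathrm{Hom}(e,\mathcal{H})$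 (values in $\mathrm{Hom}(e,\mathbb{C}_{\mathcal{T}})=\mathbb{C}$ as $e$ is an atom), is a pre-Hilbert space with a right action of $A_{G,\mathbb{C}}$ by bounded operators compatible with the involutions: for $g$ with source $e$ and target $e'$ and $v\in\mathrm{Hom}(e',\mathcal{H})$, $(v[g])(x)=\sum_{y:\ y\,g\,x}v(y)$ for $x\in e$, and $[g]$ kills the other summands. The $l^2$ representation is the completion of $\tilde{\mathcal{H}}$ for $\mathcal{H}=l^2(B)$, the internal Hilbert space of square summable functions on $B$. Since representations act on the right, the GNS representation of $\eta$ is the Hilbert space completion of $A_{G,\mathbb{C}}$ (modulo null vectors) for the scalar product $\langle a,b\rangle=\eta(ba^* )$ (scalar products linear in the second variable), with action by right multiplication; ''is the $l^2$ representation'' means unitarily equivalent to it. The KMS condition at temperature one for $\sigma$ means $\eta(a\,\sigma_i(b))=\eta(ba)$ for all $a,b\in A_{G,\mathbb{C}}$, where $\sigma_i([g])=\chi(g)^{-1}[g]$ is the analytic continuation of $\sigma_t$ at $t=i$. *)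

(* Defs.v *)
From HB Require Import structures.
From mathcomp Require Import all_boot all_order all_algebra.
From mathcomp Require Import all_classical all_reals all_analysis.
From mathcomp Require Import complex.

Set Implicit Arguments.
Unset Strict Implicit.
Unset Printing Implicit Defensive.

Import Order.TTheory GRing.Theory Num.Theory.
Local Open Scope classical_set_scope.
Local Open Scope ring_scope.

(** * Grothendieck toposes

    A Grothendieck topos is presented as the category of sheaves on a site.
    Internal statements are spelled out by Kripke-Joyal semantics: a statement
    about sections over [U] is "forced" when it holds stably under restriction,
    with existentials and disjunctions witnessed [locally], i.e. on a covering
    sieve. *)

Record category := Category {
  ob :> Type;
  mor : ob -> ob -> Type;
  idc : forall U, mor U U;
  mcomp : forall U V W, mor V U -> mor W V -> mor W U;
  comp_idl : forall U V (f : mor V U), mcomp (idc U) f = f;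
  comp_idr : forall U V (f : mor V U), mcomp f (idc V) = f;
  compA : forall U V W Z (f : mor V U) (g : mor W V) (h : mor Z W),
    mcomp f (mcomp g h) = mcomp (mcomp f g) h }.

Notation "f \c g" := (mcomp f g) (at level 50, left associativity).

Record sieve (C : category) (U : C) := Sieve {
  sieve_mem :> forall V, mor V U -> Prop;
  sieve_closed : forall V W (f : mor V U) (h : mor W V),
    sieve_mem f -> sieve_mem (f \c h) }.

Definition sieve_top (C : category) (U : C) : sieve U :=
  @Sieve C U (fun _ _ => True) (fun _ _ _ _ k => k).

Lemma sieve_pull_closed (C : category) (U V : C) (f : mor V U) (K : sieve U)
    W Z (h : mor W V) (k : mor Z W) : K W (f \c h) -> K Z (f \c (h \c k)).
Proof. by rewrite compA; exact: sieve_closed. Qed.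

Definition sieve_pull (C : category) (U V : C) (f : mor V U) (K : sieve U) :
    sieve V :=
  @Sieve C V (fun W h => K W (f \c h)) (@sieve_pull_closed C U V f K).

Record site := Site {
  site_cat :> category;
  covers : forall U : site_cat, sieve U -> Prop;
  covers_top : forall U, covers (sieve_top U);
  covers_pull : forall U V (f : mor V U) (K : sieve U),
    covers K -> covers (sieve_pull f K);
  covers_trans : forall U (K S : sieve U), covers K ->
    (forall V (f : mor V U), K V f -> covers (sieve_pull f S)) -> covers S }.

Definition locally (C : site) (U : C) (Q : forall V, mor V U -> Prop) : Prop :=
  exists K : sieve U, covers K /\ forall V (f : mor V U), K V f -> Q V f.

(** The truth value "false" at stage [U]. *)
Definition forced_false (C : site) (U : C) : Prop :=
  locally (fun V (_ : mor V U) => False).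

Record sheaf (C : site) := Sheaf {
  sec :> C -> Type;
  res : forall U V, mor V U -> sec U -> sec V;
  res_id : forall U (x : sec U), res (idc U) x = x;
  res_comp : forall U V W (f : mor V U) (h : mor W V) (x : sec U),
    res (f \c h) x = res h (res f x);
  sheaf_glue : forall U (K : sieve U), covers K ->
    forall x : (forall V (f : mor V U), K V f -> sec V),
    (forall V W (f : mor V U) (h : mor W V) (k : K V f) (k' : K W (f \c h)),
        x W (f \c h) k' = res h (x V f k)) ->
    exists! s : sec U, forall V (f : mor V U) (k : K V f), res f s = x V f k }.

Record sheaf_hom (C : site) (X Y : sheaf C) := SheafHom {
  shom :> forall U, X U -> Y U;
  shom_nat : forall U V (f : mor V U) (x : X U),
    shom (res f x) = res f (shom x) }.

Record subobject (C : site) (X : sheaf C) := Subobject {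
  sub_mem :> forall U, X U -> Prop;
  sub_stable : forall U V (f : mor V U) (x : X U),
    sub_mem x -> sub_mem (res f x);
  sub_local : forall U (x : X U),
    locally (fun V (f : mor V U) => sub_mem (res f x)) -> sub_mem x }.

Lemma subobject_ext (C : site) (X : sheaf C) (S T : subobject X) :
  (forall U (x : X U), S U x <-> T U x) -> S = T.
Proof.
case: S => s s1 s2; case: T => t t1 t2 /= st.
have e : s = t.
  by apply: functional_extensionality_dep => U; apply/funext => x;
     apply/propext.
by subst t; congr Subobject; exact: Prop_irrelevance.
Qed.

Lemma sig_ext (T : Type) (P : T -> Prop) (a b : {x : T | P x}) :
  sval a = sval b -> a = b.
Proof.
by case: a => a pa; case: b => b pb /= ab; subst b; congr exist;
   exact: Prop_irrelevance.
Qed.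

Section SubSheaf.
Variables (C : site) (X : sheaf C) (S : subobject X).

Definition sub_sec (U : C) : Type := {x : X U | S U x}.

Definition sub_res (U V : C) (f : mor V U) (x : sub_sec U) : sub_sec V :=
  exist _ (res f (sval x)) (sub_stable f (svalP x)).

Lemma sub_glue U (K : sieve U) : covers K ->
  forall x : (forall V (f : mor V U), K V f -> sub_sec V),
  (forall V W (f : mor V U) (h : mor W V) (k : K V f) (k' : K W (f \c h)),
      x W (f \c h) k' = sub_res h (x V f k)) ->
  exists! s : sub_sec U,
    forall V (f : mor V U) (k : K V f), sub_res f s = x V f k.
Proof.
move=> cK x mx.
have [|s [sx su]] := @sheaf_glue C X U K cK (fun V f k => sval (x V f k)).
  by move=> V W f h k k'; rewrite mx.
have Ss : S U s.
  by apply: sub_local; exists K; split=> // V f k; rewrite sx; exact: svalP.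
exists (exist _ s Ss); split=> [V f k|[t St] tx].
  by apply: sig_ext; rewrite /= sx.
apply: sig_ext => /=; apply: su => V f k.
by rewrite -(tx V f k).
Qed.

Definition sub_sheaf : sheaf C.
refine (@Sheaf C sub_sec sub_res _ _ sub_glue).
- by move=> U x; apply: sig_ext; rewrite /= res_id.
- by move=> U V W f h x; apply: sig_ext; rewrite /= res_comp.
Defined.

End SubSheaf.

Section ProdSheaf.
Variables (C : site) (X Y : sheaf C).

Definition prod_res (U V : C) (f : mor V U) (p : X U * Y U) : X V * Y V :=
  (res f p.1, res f p.2).

Lemma prod_glue U (K : sieve U) : covers K ->
  forall x : (forall V (f : mor V U), K V f -> (X V * Y V)%type),
  (forall V W (f : mor V U) (h : mor W V) (k : K V f) (k' : K W (f \c h)),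
      x W (f \c h) k' = prod_res h (x V f k)) ->
  exists! s : (X U * Y U)%type,
    forall V (f : mor V U) (k : K V f), prod_res f s = x V f k.
Proof.
move=> cK x mx.
have [|s [sx su]] := @sheaf_glue C X U K cK (fun V f k => (x V f k).1).
  by move=> V W f h k k'; rewrite mx.
have [|t [tx tu]] := @sheaf_glue C Y U K cK (fun V f k => (x V f k).2).
  by move=> V W f h k k'; rewrite mx.
exists (s, t); split=> [V f k|[s' t'] stx].
  by rewrite /prod_res /= sx tx; case: (x V f k).
by congr pair; [apply: su|apply: tu] => V f k; rewrite -stx.
Qed.

Definition prod_sheaf : sheaf C.
refine (@Sheaf C (fun U => (X U * Y U)%type) prod_res _ _ prod_glue).
- by move=> U [x y]; rewrite /prod_res /= !res_id.
- by move=> U V W f h [x y]; rewrite /prod_res /= !res_comp.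
Defined.

End ProdSheaf.

Definition is_atom (C : site) (X : sheaf C) : Prop :=
  exists S0 S1 : subobject X,
    S0 <> S1 /\ forall S : subobject X, S = S0 \/ S = S1.

(** The atoms form a generating (separating) family. *)
Definition atomic_topos (C : site) : Prop :=
  forall (X Y : sheaf C) (f g : sheaf_hom X Y),
    (forall (a : sheaf C) (h : sheaf_hom a X), is_atom a ->
       forall U (x : a U), f U (h U x) = g U (h U x)) ->
    forall U (x : X U), f U x = g U x.

(** [t] enumerates, without repetition, the internal subset [P] of [X] at
    stage [U]. *)
Definition internally_distinct (C : site) (X : sheaf C) (U : C) (n : nat)
    (t : 'I_n -> X U) : Prop :=
  forall i j V (f : mor V U), i != j -> res f (t i) = res f (t j) ->
    forced_false V.

Definition enumerates (C : site) (X : sheaf C) (U : C)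
    (P : forall V, mor V U -> X V -> Prop) (n : nat) (t : 'I_n -> X U) : Prop :=
  [/\ forall i V (f : mor V U), P V f (res f (t i)),
      internally_distinct t &
      forall V (f : mor V U) (s : X V), P V f s ->
        locally (fun W (h : mor W V) => exists i, res h s = res (f \c h) (t i))].

Definition internal_card (C : site) (X : sheaf C) (U : C)
    (P : forall V, mor V U -> X V -> Prop) (n : nat) : Prop :=
  locally (fun V (f : mor V U) => exists t : 'I_n -> X V,
    enumerates (fun W (h : mor W V) => P W (f \c h)) t).

(** * The hypergroupoid of [B] *)

Record arrow (C : site) (B : sheaf C) := Arrow {
  arrow_rel :> subobject (prod_sheaf B B);
  arrow_atom : is_atom (sub_sheaf arrow_rel) }.

HB.instance Definition _ (C : site) (B : sheaf C) := gen_eqMixin (arrow B).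
HB.instance Definition _ (C : site) (B : sheaf C) := gen_choiceMixin (arrow B).

Lemma is_atom_iso (C : site) (X Y : sheaf C) (f : sheaf_hom X Y)
    (g : sheaf_hom Y X) :
  (forall U (x : X U), g U (f U x) = x) -> (forall U y, f U (g U y) = y) ->
  is_atom X -> is_atom Y.
Proof.
move=> fK gK [S0 [S1 [S01 Sall]]].
have pull (X' Y' : sheaf C) (k : sheaf_hom X' Y') (S : subobject Y') :
    {T : subobject X' | forall U x, T U x <-> S U (k U x)}.
  unshelve eexists.
    exists (fun U x => S U (k U x)) => [U V h x Sx|U x Sx].
      by rewrite shom_nat; exact: sub_stable.
    apply: sub_local; case: Sx => K [cK Kx]; exists K; split=> // V h /Kx.
    by rewrite shom_nat.
  by [].
have [T0 T0E] := pull _ _ g S0; have [T1 T1E] := pull _ _ g S1.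
exists T0, T1; split=> [T01|T].
  apply: S01; apply: subobject_ext => U x.
  by rewrite -[x]fK -T0E -T1E T01.
have [S SE] := pull _ _ f T.
by case: (Sall S) => e; [left|right]; apply: subobject_ext => U y;
   rewrite ?T0E ?T1E -e SE gK.
Qed.

Section Hypergroupoid.
Variables (C : site) (B : sheaf C).
Implicit Types (g a e : arrow B).

Definition swap_rel (g : subobject (prod_sheaf B B)) :
  subobject (prod_sheaf B B).
exists (fun U p => g U (p.2, p.1)).
- move=> U V f [y x] /= gxy.
  exact: (@sub_stable _ _ g _ _ f (x, y)).
- move=> U [y x] /= [K [cK Kg]].
  by apply: sub_local; exists K; split=> // V f /Kg.
Defined.

Definition swap_hom (g : subobject (prod_sheaf B B)) :
  sheaf_hom (sub_sheaf g) (sub_sheaf (swap_rel g)).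
unshelve eexists.
- move=> U [[x y] gxy].
  exact: (exist (fun p => swap_rel g U p) (y, x) gxy).
- by move=> U V f [[x y] gxy]; exact: sig_ext.
Defined.

Definition unswap_hom (g : subobject (prod_sheaf B B)) :
  sheaf_hom (sub_sheaf (swap_rel g)) (sub_sheaf g).
unshelve eexists.
- move=> U [[x y] gxy].
  exact: (exist (fun p => g U p) (y, x) gxy).
- by move=> U V f [[x y] gxy]; exact: sig_ext.
Defined.

Lemma swap_atom g : is_atom (sub_sheaf (swap_rel g)).
Proof.
apply: (@is_atom_iso _ _ _ (swap_hom g) (unswap_hom g)) (arrow_atom g).
- by move=> U [[x y] gxy]; exact: sig_ext.
- by move=> U [[x y] gxy]; exact: sig_ext.
Qed.

Definition star g : arrow B := Arrow (swap_atom g).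

Definition units : set (arrow B) :=
  [set e | forall U (x y : B U), e U (x, y) -> x = y].

(** The subobject [{x | (x, x) \in e}] of [B], through which a unit [e] is
    identified with an atomic subobject of [B]. *)
Definition carrier (e : arrow B) : subobject B.
exists (fun U x => e U (x, x)).
- by move=> U V f x ex; exact: (@sub_stable _ _ e _ _ f (x, x)).
- by move=> U x [K [cK Kx]]; apply: sub_local; exists K.
Defined.

Definition ucar (e : arrow B) : sheaf C := sub_sheaf (carrier e).

(** [e] is the source and [e'] the target of [g], i.e. [g] is contained in
    [e' * e]. *)
Definition has_ends g e e' : Prop :=
  [/\ units e, units e' &
      forall U (x y : B U), g U (x, y) -> carrier e' U x /\ carrier e U y].

Definition composite_in g g' a : Prop :=
  forall U (x y : B U), a U (x, y) ->
    locally (fun V (f : mor V U) =>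
      exists s : B V, g V (res f x, s) /\ g' V (s, res f y)).

Definition binom_spec g g' a (n : nat) : Prop :=
  forall U (x y : B U), a U (x, y) ->
    internal_card (fun V (f : mor V U) (s : B V) =>
      g V (res f x, s) /\ g' V (s, res f y)) n.

Definition lcard_spec g (n : nat) : Prop :=
  forall e e', has_ends g e e' -> forall U (x : B U), carrier e U x ->
    internal_card (fun V (f : mor V U) (z : B V) => g V (z, res f x)) n.

Definition rcard_spec g (n : nat) : Prop :=
  forall e e', has_ends g e e' -> forall U (y : B U), carrier e' U y ->
    internal_card (fun V (f : mor V U) (z : B V) => g V (res f y, z)) n.

Definition binom g g' a : nat := xget 0%N [set n | binom_spec g g' a n].
Definition lcard g : nat := xget 0%N [set n | lcard_spec g n].
Definition rcard g : nat := xget 0%N [set n | rcard_spec g n].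

Definition decidable_hypergroupoid : Prop :=
  forall g g' : arrow B, g = g' \/ g <> g'.

Definition locally_finite : Prop := forall g, exists n, rcard_spec g n.

Definition chi (R : realType) g : R := (lcard g)%:R / (rcard g)%:R.

End Hypergroupoid.

(** * The algebra of the hypergroupoid

    Its elements are the finitely supported functions on the set of arrows. *)

Section Algebra.
Variables (C : site) (B : sheaf C).

Definition fin_supported (K : pzRingType) (a : arrow B -> K) : Prop :=
  finite_set [set g | a g != 0].

Definition bvec (K : pzRingType) (g : arrow B) : arrow B -> K :=
  fun h => (h == g)%:R.

Definition struct_const (g g' a : arrow B) : nat :=
  if `[< composite_in g g' a >] then binom g g' a else 0%N.

Definition amul (K : pzRingType) (a b : arrow B -> K) : arrow B -> K :=
  fun c => \sum_(p \in [set: arrow B * arrow B])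
    a p.1 * b p.2 * (struct_const p.1 p.2 c)%:R.

Variable R : realType.

Definition astar (a : arrow B -> R[i]) : arrow B -> R[i] :=
  fun h => \sum_(g \in [set: arrow B])
    conjc (a g) * (chi R g)%:C%C * bvec R[i] (star g) h.

(** [chi(g) ^ (i z)] for complex [z]. *)
Definition chi_ipow (g : arrow B) (z : R[i]) : R[i] :=
  let l := ln (chi R g) in
  Complex (expR (- complex.Im z * l) * cos (complex.Re z * l))
          (expR (- complex.Im z * l) * sin (complex.Re z * l)).

(** The time evolution [sigma_t] for real [t], together with its analytic
    continuation to complex times. *)
Definition sigma (z : R[i]) (a : arrow B -> R[i]) : arrow B -> R[i] :=
  fun g => chi_ipow g z * a g.

End Algebra.

(** * Internal complex numbers

    [rmap X] is the set of morphisms from [X] to the object of real numbers: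
    Dedekind cuts of rationals in the internal logic, in context [X]. The
    subobject [lower q] is [{x | q < f x}] and [upper q] is [{x | f x < q}]. *)

Record rmap (C : site) (X : sheaf C) := Rmap {
  lower : rat -> subobject X;
  upper : rat -> subobject X;
  lower_inhabited : forall U (x : X U),
    locally (fun V (f : mor V U) => exists q, lower q V (res f x));
  upper_inhabited : forall U (x : X U),
    locally (fun V (f : mor V U) => exists q, upper q V (res f x));
  lower_rounded : forall q U (x : X U), lower q U x <->
    locally (fun V (f : mor V U) => exists r, q < r /\ lower r V (res f x));
  upper_rounded : forall q U (x : X U), upper q U x <->
    locally (fun V (f : mor V U) => exists r, r < q /\ upper r V (res f x));
  cut_disjoint : forall q U (x : X U),
    lower q U x -> upper q U x -> forced_false U;
  cut_located : forall q r U (x : X U), q < r ->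
    locally (fun V (f : mor V U) =>
      lower q V (res f x) \/ upper r V (res f x)) }.

Record cmap (C : site) (X : sheaf C) := Cmap {
  re_part : rmap X;
  im_part : rmap X }.

Record box := CBox { re_lo : rat; re_hi : rat; im_lo : rat; im_hi : rat }.

Definition in_box (R : realType) (D : box) : set R[i] :=
  [set z | ratr (re_lo D) < complex.Re z < ratr (re_hi D) /\
           ratr (im_lo D) < complex.Im z < ratr (im_hi D)].

(** An internal complex number at stage [U], given by the open rational boxes
    which are forced to contain it at each later stage. *)
Definition cnum (C : site) (U : C) := forall V, mor V U -> box -> Prop.

Section InternalComplex.
Variables (R : realType) (C : site).

Definition cmap_at (X : sheaf C) (u : cmap X) (U : C) (x : X U) : cnum U :=
  fun V f D =>
    [/\ lower (re_part u) (re_lo D) V (res f x),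
        upper (re_part u) (re_hi D) V (res f x),
        lower (im_part u) (im_lo D) V (res f x) &
        upper (im_part u) (im_hi D) V (res f x)].

Definition cnum_eq (U : C) (c d : cnum U) : Prop :=
  forall V (f : mor V U) D, c V f D <-> d V f D.

(** The value of a continuous function [F] of finitely many complex variables
    on internal complex numbers. *)
Definition capply (U : C) (I : finType) (F : (I -> R[i]) -> R[i])
    (c : I -> cnum U) : cnum U :=
  fun V f D => locally (fun W (h : mor W V) =>
    exists E : I -> box, (forall i, c i W (f \c h) (E i)) /\
      forall p : I -> R[i], (forall i, in_box (E i) (p i)) ->
        in_box D (F p)).

Definition cconst (U : C) (z : R[i]) : cnum U :=
  @capply U void (fun _ => z) (fun i => match i with end).

(** The internal complex number [c] at stage [U] is forced to be at distance
    less than [eps] from [z]. *)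
Definition cnear (U : C) (c : cnum U) (z : R[i]) (eps : R) : Prop :=
  locally (fun V (f : mor V U) => exists D, c V f D /\
    forall p : R[i], in_box D p -> `|p - z| < eps%:C%C).

Definition is_lincomb (X : sheaf C) (k : R[i]) (u v w : cmap X) : Prop :=
  forall U (x : X U), cnum_eq (cmap_at w x)
    (@capply U bool (fun p => k * p true + p false)
       (fun b => if b then cmap_at u x else cmap_at v x)).

(** * Hom(e, l^2(B))

    Maps from [e] to [l^2(B)] are given by the internal families
    [u : e * B -> C] such that [sum_b |u(x, b)|^2] converges for [x] in [e].
    Internal sums are limits of sums over the finite subsets of [B]; as [e] is
    an atom, the value of such a sum, a map from [e] to the complex numbers, is
    an ordinary complex number. *)

Variable B : sheaf C.

Definition fib (e : arrow B) : sheaf C := prod_sheaf (ucar e) B.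

(** [sum_j conj(u(x, t_j)) v(x, t_j)] *)
Definition partial_inner (e : arrow B) (u v : cmap (fib e)) (U : C)
    (x : ucar e U) (n : nat) (t : 'I_n -> B U) : cnum U :=
  @capply U ('I_n * bool)%type
    (fun p => \sum_(j < n) conjc (p (j, true)) * p (j, false))
    (fun jb => @cmap_at (fib e) (if jb.2 then u else v) U (x, t jb.1)).

Definition has_inner (e : arrow B) (u v : cmap (fib e)) (z : R[i]) : Prop :=
  forall eps : R, 0 < eps -> forall U (x : ucar e U),
  locally (fun V (f : mor V U) => exists (n : nat) (s : 'I_n -> B V),
    forall W (h : mor W V) (m : nat) (t : 'I_m -> B W),
      internally_distinct t ->
      (forall i, locally (fun Z (k : mor Z W) =>
         exists j, res (h \c k) (s i) = res k (t j))) ->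
      cnear (partial_inner u v (res (f \c h) x) t) z eps).

Definition l2 (e : arrow B) (u : cmap (fib e)) : Prop :=
  exists z, has_inner u u z.

(** [w = v [g]], i.e. [w(x, b)] is the sum of [v(y, b)] over the [y] such that
    [y g x]. *)
Definition is_right_action (g e e' : arrow B) (v : cmap (fib e'))
    (w : cmap (fib e)) : Prop :=
  forall U (x : ucar e U) (b : B U),
  locally (fun V (f : mor V U) => exists (n : nat) (t : 'I_n -> ucar e' V),
    enumerates (fun W (h : mor W V) (y : ucar e' W) =>
        g W (sval y, res (f \c h) (sval x))) t /\
    cnum_eq (@cmap_at (fib e) w V (res f x, res f b))
      (@capply V 'I_n (fun p => \sum_(j < n) p j)
         (fun j => @cmap_at (fib e') v V (t j, res f b)))).

(** The composite [e -> B -> l^2(B)], sending [x] to the delta function at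
    [x]. *)
Definition is_delta (e : arrow B) (u : cmap (fib e)) : Prop :=
  forall U (x : ucar e U) (b : B U),
    (sval x = b -> cnum_eq (@cmap_at (fib e) u U (x, b)) (cconst 1)) /\
    ((forall V (f : mor V U), res f (sval x) = res f b -> forced_false V) ->
       cnum_eq (@cmap_at (fib e) u U (x, b)) (cconst 0)).

End InternalComplex.

(** * Hilbert spaces; scalar products are linear in the second variable *)

Record hilbert (R : realType) := Hilbert {
  hcar :> lmodType R[i];
  ip : hcar -> hcar -> R[i];
  ip_linear : forall (k : R[i]) x y z,
    ip x (k *: y + z) = k * ip x y + ip x z;
  ip_conj : forall x y, ip y x = conjc (ip x y);
  ip_ge0 : forall x, 0 <= ip x x;
  ip_def : forall x, ip x x = 0 -> x = 0;
  hilbert_complete : forall u : nat -> hcar,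
    (forall eps : R, 0 < eps -> exists N, forall m n, (N <= m)%N -> (N <= n)%N ->
       Num.sqrt (complex.Re (ip (u m - u n) (u m - u n))) < eps) ->
    exists l, forall eps : R, 0 < eps -> exists N, forall n, (N <= n)%N ->
       Num.sqrt (complex.Re (ip (u n - l) (u n - l))) < eps }.

Section Operators.
Variables (R : realType) (H : hilbert R).

Definition hnorm (x : H) : R := Num.sqrt (complex.Re (ip x x)).

Definition bounded_op (T : H -> H) : Prop :=
  (forall (k : R[i]) x y, T (k *: x + y) = k *: T x + T y) /\
  exists M : R, forall x, hnorm (T x) <= M * hnorm x.

Definition positive_op (T : H -> H) : Prop := forall x, 0 <= ip x (T x).

End Operators.

Definition unitary (R : realType) (H K : hilbert R) (Q : H -> K) : Prop :=
  [/\ forall (k : R[i]) x y, Q (k *: x + y) = k *: Q x + Q y,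
      forall x y, ip (Q x) (Q y) = ip x y &
      forall y, exists x, Q x = y].

(** The operator of the algebra element [a], when [[g]] acts by [rho g]. *)
Definition alg_act (R : realType) (C : site) (B : sheaf C) (H : hilbert R)
    (rho : arrow B -> H -> H) (a : arrow B -> R[i]) : H -> H :=
  fun x => \sum_(g \in [set: arrow B]) a g *: rho g x.

(** * The l^2 representation

    [H] is the completion of the direct sum, over the units [e], of the spaces
    Hom(e, l^2(B)), included in [H] by [l2_incl e]; [rho g] is the right action of
    [[g]] by a bounded operator. *)

Record l2_rep (R : realType) (C : site) (B : sheaf C) (H : hilbert R) := L2Rep {
  l2_incl : forall e : arrow B, cmap (fib e) -> H;
  iota_lin : forall e (k : R[i]) (u v w : cmap (fib e)), units e ->
    l2 R u -> l2 R v -> l2 R w -> is_lincomb k u v w ->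
    l2_incl w = k *: l2_incl u + l2_incl v;
  iota_ip : forall e (u v : cmap (fib e)) (z : R[i]), units e ->
    l2 R u -> l2 R v -> has_inner u v z -> ip (l2_incl u) (l2_incl v) = z;
  iota_orth : forall e e' (u : cmap (fib e)) (v : cmap (fib e')),
    units e -> units e' -> e <> e' -> l2 R u -> l2 R v ->
    ip (l2_incl u) (l2_incl v) = 0;
  iota_dense : forall (x : H) (eps : R), 0 < eps ->
    exists (n : nat) (e : 'I_n -> arrow B) (u : forall i, cmap (fib (e i))),
      (forall i, units (e i) /\ l2 R (u i)) /\
      hnorm (x - \sum_(i < n) l2_incl (u i)) < eps;
  rho : arrow B -> H -> H;
  rho_bounded : forall g, bounded_op (rho g);
  rho_act : forall g e e' (v : cmap (fib e')) (w : cmap (fib e)),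
    has_ends g e e' -> l2 R v -> l2 R w -> is_right_action R g v w ->
    rho g (l2_incl v) = l2_incl w;
  rho_kill : forall g e e' e'' (v : cmap (fib e'')),
    has_ends g e e' -> units e'' -> e'' <> e' -> l2 R v ->
    rho g (l2_incl v) = 0 }.

Section L2Weight.
Variables (R : realType) (C : site) (B : sheaf C) (H : hilbert R).
Variable L : l2_rep B H.

Definition delta_vec (e : arrow B) : H :=
  xget 0 [set x | exists u : cmap (fib e), is_delta R u /\ x = l2_incl L u].

(** The vector state [eta_e], on operators. *)
Definition vstate (e : arrow B) (T : H -> H) : R[i] :=
  ip (delta_vec e) (T (delta_vec e)).

(** The reduced C*-algebra. *)
Definition in_Cred (T : H -> H) : Prop :=
  bounded_op T /\
  forall eps : R, 0 < eps -> exists a : arrow B -> R[i], fin_supported a /\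
    forall x, hnorm (T x - alg_act (rho L) a x) <= eps * hnorm x.

Definition Cred_pos : set (H -> H) := [set T | in_Cred T /\ positive_op T].

(** [eta] as a weight, on the positive elements of the reduced C*-algebra. *)
Definition eta_weight (T : H -> H) : \bar R :=
  \esum_(e in @units C B) (complex.Re (vstate e T))%:E.

(** [eta] as a linear form on the algebra. *)
Definition eta_form (a : arrow B -> R[i]) : R[i] :=
  \sum_(e \in @units C B) vstate e (alg_act (rho L) a).

Definition is_weight (w : (H -> H) -> \bar R) : Prop :=
  [/\ forall T, Cred_pos T -> (0 <= w T)%E,
      forall S T, Cred_pos S -> Cred_pos T ->
        w (fun x => S x + T x) = (w S + w T)%E &
      forall (k : R) T, 0 <= k -> Cred_pos T ->
        w (fun x => k%:C%C *: T x) = (k%:E * w T)%E].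

(** The positive elements of finite weight span a norm-dense subspace. *)
Definition semifinite (w : (H -> H) -> \bar R) : Prop :=
  forall T, in_Cred T -> forall eps : R, 0 < eps ->
  exists (n : nat) (k : 'I_n -> R[i]) (S : 'I_n -> H -> H),
    (forall i, Cred_pos (S i) /\ (w (S i) < +oo)%E) /\
    forall x, hnorm (T x - \sum_(i < n) k i *: S i x) <= eps * hnorm x.

(** The sum defining [eta] is finite on the algebra. *)
Definition finite_on_algebra : Prop :=
  forall a : arrow B -> R[i], fin_supported a ->
    finite_set [set e | units e /\ vstate e (alg_act (rho L) a) != 0] /\
    (positive_op (alg_act (rho L) a) ->
       eta_weight (alg_act (rho L) a) = (complex.Re (eta_form a))%:E).

End L2Weight.

(** [Lam] exhibits [K] as the Hilbert space completion of the algebra, modulo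
    null vectors, for the scalar product [<a, b> = w (b a^* )]. *)
Definition gns_completion (R : realType) (C : site) (B : sheaf C)
    (w : (arrow B -> R[i]) -> R[i]) (K : hilbert R)
    (Lam : (arrow B -> R[i]) -> K) : Prop :=
  [/\ forall (k : R[i]) a b, fin_supported a -> fin_supported b ->
        Lam (fun g => k * a g + b g) = k *: Lam a + Lam b,
      forall a b, fin_supported a -> fin_supported b ->
        ip (Lam a) (Lam b) = w (amul b (astar a)) &
      forall (x : K) (eps : R), 0 < eps ->
        exists a, fin_supported a /\ hnorm (x - Lam a) < eps].

(** Right multiplication by [[g]] extends to the bounded operator [rmul g]. *)
Definition gns_action (R : realType) (C : site) (B : sheaf C) (K : hilbert R)
    (Lam : (arrow B -> R[i]) -> K) (rmul : arrow B -> K -> K) : Prop :=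
  forall g, bounded_op (rmul g) /\
    forall a, fin_supported a -> rmul g (Lam a) = Lam (amul a (bvec R[i] g)).

(** KMS at temperature one; ['i] is the imaginary unit. *)
Definition kms (R : realType) (C : site) (B : sheaf C)
    (w : (arrow B -> R[i]) -> R[i]) : Prop :=
  forall a b, fin_supported a -> fin_supported b ->
    w (amul a (sigma ('i)%C b)) = w (amul b a).

(* Main.v *)
(** Distinct arrows are disjoint and together they cover [B * B]. Hence, over a
    covering, any two sections of [B] are related by a definite arrow, and an
    internal cardinality becomes, at a nondegenerate stage, the number of
    members of a finite family that carry a given label.

    A map from [e * B] to the complex numbers is constant along each arrow [g]
    with source [e], so the indicator functions [vec g] form an orthogonal basis
    of the l^2 representation, with [|vec g|^2 = |g|_l], on which [[h]] acts by
    right multiplication: [vec g [h] = sum_a binom g h a * vec a]. As [vec e] is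
    the delta vector of [e], [eta] sums the coefficients at the units, and
    [eta ([g][h])] is [|g|_r] if [h = g^*] and [0] otherwise. This gives
    [eta (b a^* ) = <vec a, vec b>], whence the GNS statement, and, as
    [chi g * |g|_r = |g|_l], the KMS condition.

    For semifiniteness, each [[g]] is a combination of positive elements
    [M ([e] + [e']) + u [g] + conj u [g]^*]; these involve no product of arrows,
    so that the associativity of the algebra is never needed. *)

Require Import Defs.
From HB Require Import structures.
From mathcomp Require Import all_boot all_order all_algebra.
From mathcomp Require Import all_classical all_reals all_analysis.
From mathcomp Require Import complex.
From mathcomp Require Import ring lra.
Import Order.TTheory GRing.Theory Num.Theory.
Import numFieldNormedType.Exports.
Local Open Scope classical_set_scope.
Local Open Scope ring_scope.

Set Implicit Arguments.
Unset Strict Implicit.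
Unset Printing Implicit Defensive.

(** * Coverings and atoms *)

(** A site may have degenerate stages, covered by the empty sieve, where every local statement
    holds. As the metatheory is classical, an internal argument is run by passing to a nondegenerate
    stage ([locally_nondeg]), where local existence yields actual witnesses, and by spreading what
    is found there: a local property of pairs that holds at one nondegenerate point of an arrow
    holds on the whole arrow, because it cuts out a subobject of an atom ([arrow_transfer]). This
    turns [binom] and the values of functions into ordinary numbers. Atoms are only assumed to
    separate maps; that they cover [B * B] comes from comparing two maps to the sheaf of closed
    sieves. The space [H] is known only through the axioms of [l2_rep], so its vectors are
    identified by showing that a difference has norm zero. The map [emb], sending [[g]] to [vec g],
    serves as a concrete GNS map. That the involution of the algebra becomes the adjoint reduces to
    the counting identity [binom_adjoint]. *)

Section Locally.
Variable C : site.
Implicit Types U V W : C.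

Lemma sieve_ext U (K S : sieve U) :
  (forall V (f : mor V U), K V f <-> S V f) -> K = S.
Proof.
case: K => k kc; case: S => s sc /= ks.
have e : k = s.
  by apply: functional_extensionality_dep => V; apply/funext => f; apply/propext.
by subst s; congr Sieve; exact: Prop_irrelevance.
Qed.

Lemma covers_mono U (K S : sieve U) :
  (forall V (f : mor V U), K V f -> S V f) -> covers K -> covers S.
Proof.
move=> KS cK; apply: (covers_trans cK) => V f Kf.
suff -> : sieve_pull f S = sieve_top V by exact: covers_top.
by apply: sieve_ext => W h; split=> // _; apply: KS; apply: sieve_closed.
Qed.

Lemma locally_ret U (Q : forall V, mor V U -> Prop) :
  (forall V f, Q V f) -> locally Q.
Proof. by move=> q; exists (sieve_top U); split=> [|*]; [exact: covers_top|]. Qed.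

Lemma locally_pull U V (f : mor V U) (Q : forall V, mor V U -> Prop) :
  locally Q -> locally (fun W (h : mor W V) => Q W (f \c h)).
Proof.
case=> K [cK KQ]; exists (sieve_pull f K); split; first exact: covers_pull.
by move=> W h /KQ.
Qed.

(** [Q'] need not be stable under restriction, so the covering sieve is the largest sieve inside it:
    the maps all of whose composites satisfy [Q']. *)
Lemma locally_bind U (Q Q' : forall V, mor V U -> Prop) :
  locally Q ->
  (forall V f, Q V f -> locally (fun W (h : mor W V) => Q' W (f \c h))) ->
  locally Q'.
Proof.
case=> K [cK KQ] H.
have Sc V W (f : mor V U) (h : mor W V) : (forall Z (k : mor Z V), Q' Z (f \c k)) ->
    forall Z (k : mor Z W), Q' Z ((f \c h) \c k).
  by move=> q Z k; rewrite -Defs.compA.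
exists (@Sieve C U (fun V f => forall W h, Q' W (f \c h)) Sc); split; last first.
  by move=> V f /(_ V (idc V)); rewrite comp_idr.
apply: (covers_trans cK) => V f Kf.
have [K' [cK' K'Q]] := H V f (KQ V f Kf).
apply: covers_mono cK' => W h K'h /= Z k.
by rewrite -Defs.compA; apply: K'Q; apply: sieve_closed.
Qed.

Lemma locally_mono U (Q Q' : forall V, mor V U -> Prop) :
  (forall V f, Q V f -> Q' V f) -> locally Q -> locally Q'.
Proof. by move=> QQ [K [cK KQ]]; exists K; split=> // V f /KQ/QQ. Qed.

Lemma locally_and U (Q Q' : forall V, mor V U -> Prop) :
  locally Q -> locally Q' -> locally (fun V f => Q V f /\ Q' V f).
Proof.
case=> K [cK KQ] [K' [cK' KQ']].
have Sc V W (f : mor V U) (h : mor W V) : K V f /\ K' V f ->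
    K W (f \c h) /\ K' W (f \c h).
  by case=> *; split; exact: sieve_closed.
exists (@Sieve C U (fun V f => K V f /\ K' V f) Sc); split; last first.
  by move=> V f [/KQ ? /KQ' ?].
apply: (covers_trans cK) => V f Kf.
apply: covers_mono (covers_pull f cK') => W h /= K'h.
by split=> //; apply: sieve_closed.
Qed.

Lemma locally_forall U (I : finType) (Q : I -> forall V, mor V U -> Prop) :
  (forall i, locally (Q i)) -> locally (fun V f => forall i, Q i V f).
Proof.
move=> H.
suff: locally (fun V f => forall i, i \in enum I -> Q i V f).
  by apply: locally_mono => V f q i; apply: q; rewrite mem_enum.
elim: (enum I) => [|j s IH]; first by apply: locally_ret.
apply: locally_mono (locally_and (H j) IH) => V f [qj qs] i.
by rewrite in_cons => /orP[/eqP ->|/qs].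
Qed.

Lemma degenerate_locally U (Q : forall V, mor V U -> Prop) :
  forced_false U -> locally Q.
Proof. by apply: locally_mono. Qed.

Lemma degenerate_pull U V (f : mor V U) : forced_false U -> forced_false V.
Proof. exact: locally_pull. Qed.

Lemma degenerate_local U :
  locally (fun V (_ : mor V U) => forced_false V) -> forced_false U.
Proof. by move=> H; apply: (locally_bind H). Qed.

(** If all stages where [Q] holds were degenerate, [U] would be covered by degenerate stages, hence
    degenerate itself. *)
Lemma locally_nondeg U (Q : forall V, mor V U -> Prop) :
  ~ forced_false U -> locally Q -> exists V f, Q V f /\ ~ forced_false V.
Proof.
move=> nU lQ; apply: contrapT => nex; apply: nU; apply: degenerate_local.
apply: locally_mono lQ => V f q; apply: contrapT => nV.
by apply: nex; exists V, f.
Qed.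

Lemma locally_assuming_nondeg U (Q : forall V, mor V U -> Prop) :
  (~ forced_false U -> locally Q) -> locally Q.
Proof.
by move=> H; have [/degenerate_locally|/H] := pselect (forced_false U).
Qed.

End Locally.

(** * Subobjects and a pointwise criterion for atoms *)

Section Subobjects.
Variables (C : site) (X : sheaf C).
Implicit Types (S T : subobject X).

Lemma sub_degenerate S U (x : X U) : forced_false U -> S U x.
Proof. by move=> dU; apply: sub_local; exact: degenerate_locally. Qed.

Definition sub_top : subobject X.
Proof. by exists (fun U x => True). Defined.

Definition sub_bot : subobject X.
Proof.
exists (fun U x => forced_false U).
- by move=> U V f x; exact: degenerate_pull.
- by move=> U x; exact: degenerate_local.
Defined.

(** The subobject generated by a stable predicate, by closing it under coverings; internal
    existential quantifiers arise this way. *)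
Definition sub_locally (Q : forall U, X U -> Prop)
    (Qs : forall U V (f : mor V U) x, Q U x -> Q V (res f x)) : subobject X.
Proof.
exists (fun U x => locally (fun V (f : mor V U) => Q V (res f x))).
- move=> U V f x /(locally_pull f); apply: locally_mono => W h.
  by rewrite res_comp.
- move=> U x H; apply: (locally_bind H) => V f; apply: locally_mono => W h.
  by rewrite res_comp.
Defined.

Lemma atom_nondeg : is_atom X -> exists U (x : X U), ~ forced_false U.
Proof.
case=> S0 [S1 [S01 _]]; apply: contrapT => nex; apply: S01.
by apply: subobject_ext => U x; split=> _; apply: sub_degenerate;
   apply: contrapT => nU; apply: nex; exists U, x.
Qed.

(** The bottom and top subobjects differ because [x] is nondegenerate, so they are the only two; [S]
    contains [x], hence is not the bottom one. *)
Lemma atom_sub S : is_atom X ->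
  forall U (x : X U), ~ forced_false U -> S U x -> forall V (y : X V), S V y.
Proof.
move=> aX U x nU Sx.
have nb T : T = sub_bot -> T U x -> False by move=> ->.
case: aX => S0 [S1 [S01 Sall]].
have [] := Sall S; have [] := Sall sub_bot; have [] := Sall sub_top.
all: move=> tE bE sE.
all: try by (have := nb S; rewrite sE -bE => /(_ erefl); rewrite bE -sE => /(_ Sx)).
all: try by (have := nb sub_top; rewrite tE -bE => /(_ erefl);
  rewrite bE -tE => /(_ I)).
all: by move=> V y; rewrite sE -tE.
Qed.

Lemma is_atomP : (exists U (x : X U), ~ forced_false U) ->
  (forall S U (x : X U), ~ forced_false U -> S U x -> forall V (y : X V), S V y) ->
  is_atom X.
Proof.
case=> U [x nU] H; exists sub_bot, sub_top; split.
  by move=> e; apply: nU; have : sub_top U x by []; rewrite -e.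
move=> S; have [[V [y [nV Sy]]]|nex] :=
    pselect (exists V (y : X V), ~ forced_false V /\ S V y).
  right; apply: subobject_ext => W z; split=> // _; exact: (H S V y nV Sy).
left; apply: subobject_ext => W z; split=> [Sz|]; last exact: sub_degenerate.
by apply: contrapT => nW; apply: nex; exists W, z.
Qed.

End Subobjects.

Section Image.
Variables (C : site) (X Y : sheaf C) (h : sheaf_hom X Y).

Lemma im_stable U V (f : mor V U) (y : Y U) :
  (exists x, h U x = y) -> exists x, h V x = res f y.
Proof. by case=> x <-; exists (res f x); rewrite shom_nat. Qed.

Definition image : subobject Y := @sub_locally C Y (fun U y => exists x, h U x = y) im_stable.

Lemma image_in U (x : X U) : image U (h U x).
Proof. by apply: locally_ret => V f; exists (res f x); rewrite shom_nat. Qed.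

Definition preim (S : subobject Y) : subobject X.
Proof.
exists (fun U x => S U (h U x)) => [U V f x Sx|U x Sx].
  by rewrite shom_nat; exact: sub_stable.
by apply: sub_local; apply: locally_mono Sx => V f; rewrite shom_nat.
Defined.

Definition corestr : sheaf_hom X (sub_sheaf image).
Proof.
exists (fun U x => exist _ (h U x) (image_in x)) => U V f x.
by apply: sig_ext; rewrite /= shom_nat.
Defined.
End Image.

(** A subobject of the image with a nondegenerate point pulls back to one of [X] with a
    nondegenerate point, hence to all of [X]; every point of the image comes locally from [X]. *)
Lemma image_atom (C : site) (X Y : sheaf C) (h : sheaf_hom X Y) :
  is_atom X -> is_atom (sub_sheaf (image h)).
Proof.
move=> aX; apply: is_atomP.
  have [U [x nU]] := atom_nondeg aX.
  by exists U, (exist _ (h U x) (image_in h x)).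
move=> S U [y yi] nU Sy V [z zi].
have [W [f [[x xE] nW]]] := locally_nondeg nU yi.
have Sx : preim (corestr h) S W x.
  have e : corestr h W x = @sub_res _ _ (image h) U W f (exist _ y yi) by exact: sig_ext.
  by change (S W (corestr h W x)); rewrite e; exact: (sub_stable f Sy).
have aS := atom_sub aX nW Sx.
apply: sub_local; apply: locally_mono (zi) => W' f' [x' x'E].
have e : corestr h W' x' = @sub_res _ _ (image h) V W' f' (exist _ z zi) by exact: sig_ext.
change (S W' (@sub_res _ _ (image h) V W' f' (exist _ z zi))); rewrite -e; exact: (aS W' x').
Qed.

(** * The sheaf of closed sieves, and the covering of every sheaf by atoms *)

Section Omega.
Variable C : site.

(** Closed sieves are the truth values at stage [U], so that [omega] below is the subobject
    classifier. *)
Definition closed_sieve (U : C) (S : sieve U) :=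
  forall V (f : mor V U), locally (fun W (h : mor W V) => S W (f \c h)) -> S V f.

Definition omega_sec (U : C) := {S : sieve U | closed_sieve S}.

Lemma omega_pull_closed U V (f : mor V U) (S : sieve U) :
  closed_sieve S -> closed_sieve (sieve_pull f S).
Proof.
move=> cS W h H /=; apply: cS; apply: locally_mono H => Z k /=.
by rewrite Defs.compA.
Qed.

Definition omega_res (U V : C) (f : mor V U) (S : omega_sec U) : omega_sec V :=
  exist _ (sieve_pull f (sval S)) (@omega_pull_closed U V f _ (svalP S)).

Lemma omega_ext U (S T : omega_sec U) :
  (forall V (f : mor V U), sval S V f <-> sval T V f) -> S = T.
Proof. by move=> ST; apply: sig_ext; exact: sieve_ext. Qed.

Lemma omega_glue U (K : sieve U) : covers K ->
  forall x : (forall V (f : mor V U), K V f -> omega_sec V),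
  (forall V W (f : mor V U) (h : mor W V) (k : K V f) (k' : K W (f \c h)),
      x W (f \c h) k' = omega_res h (x V f k)) ->
  exists! s : omega_sec U,
    forall V (f : mor V U) (k : K V f), omega_res f s = x V f k.
Proof.
move=> cK x mx.
(* The glued sieve: [f] belongs to it when, locally, its composites lie in [K] and the sieve
   prescribed there contains the identity, i.e. is maximal. *)
pose Q V (f : mor V U) := locally (fun W (h : mor W V) =>
  exists k : K W (f \c h), sval (x W (f \c h) k) W (idc W)).
have xE V W (f : mor V U) (k : K V f) (h : mor W V) (k' : K W (f \c h)) :
    sval (x V f k) W h <-> sval (x W (f \c h) k') W (idc W).
  by rewrite (mx _ _ _ _ k) /= comp_idr.
have Qc V W (f : mor V U) (h : mor W V) : Q V f -> Q W (f \c h).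
  move=> /(locally_pull h); apply: locally_mono => Z k; rewrite Defs.compA => q; exact: q.
have QC : closed_sieve (Sieve Qc).
  move=> V f /= H; apply: (locally_bind H) => W h; apply: locally_mono => Z k.
  by rewrite Defs.compA.
have QE V (f : mor V U) (k : K V f) W (h : mor W V) : Q W (f \c h) <-> sval (x V f k) W h.
  split=> [q|xh].
    apply: (svalP (x V f k)); apply: locally_mono q => Z j.
    by rewrite -Defs.compA => -[k' xk']; apply/xE; exact: xk'.
  apply: locally_ret => Z j.
  have k' : K Z (f \c h \c j) by apply: sieve_closed; apply: sieve_closed.
  exists k'; move: k'; rewrite -Defs.compA => k'; apply/(xE _ _ _ k); exact: sieve_closed.
exists (exist _ (Sieve Qc) QC); split.
  by move=> V f k; apply: omega_ext => W h /=; exact: QE.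
move=> [S cS] SE; apply: omega_ext => V f /=; split.
  move=> q; apply: (cS); apply: locally_mono q => W h [k].
  by rewrite -SE /= comp_idr.
move=> Sf; have: locally (fun W (h : mor W V) => K W (f \c h)).
  by exists (sieve_pull f K); split; [exact: covers_pull|].
apply: locally_mono => W h k; exists k.
by rewrite -SE /= comp_idr; exact: sieve_closed.
Qed.

Definition omega : sheaf C.
refine (@Sheaf C omega_sec omega_res _ _ omega_glue).
- by move=> U x; apply: omega_ext => V f /=; rewrite comp_idl.
- by move=> U V W f h x; apply: omega_ext => Z k /=; rewrite Defs.compA.
Defined.

Lemma classify_closed (X : sheaf C) (S : subobject X) U (x : X U) V W (f : mor V U) (h : mor W V) :
  S V (res f x) -> S W (res (f \c h) x).
Proof. by move=> Sx; rewrite res_comp; exact: sub_stable. Qed.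

Lemma classify_local (X : sheaf C) (S : subobject X) U (x : X U) :
  closed_sieve (Sieve (@classify_closed X S U x)).
Proof.
move=> V f /= H; apply: sub_local; apply: locally_mono H => W h.
by rewrite res_comp.
Qed.

Definition classify (X : sheaf C) (S : subobject X) : sheaf_hom X omega.
Proof.
unshelve eexists.
- move=> U x; exact: (exist _ (Sieve (@classify_closed X S U x)) (@classify_local X S U x)).
- by move=> U V f x; apply: omega_ext => W h /=; rewrite res_comp.
Defined.

Definition atomic_part (X : sheaf C) : subobject X.
Proof.
apply: (@sub_locally C X (fun U x => exists S : subobject X,
   is_atom (sub_sheaf S) /\ S U x)).
by move=> U V f x [S [aS Sx]]; exists S; split=> //; exact: sub_stable.
Defined.

(** The generating hypothesis compares maps out of [X], so it is applied to the classifying maps of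
    [atomic_part X] and of the whole of [X]. They agree on everything that comes from an atom, since
    the image of an atom is an atomic subobject. *)
Lemma atoms_cover (X : sheaf C) : atomic_topos C -> forall U (x : X U),
  locally (fun V (f : mor V U) => exists S : subobject X,
   is_atom (sub_sheaf S) /\ S V (res f x)).
Proof.
move=> hT U x.
have E : classify (atomic_part X) U x = classify (sub_top X) U x.
  apply: hT => a h aa V y; apply: omega_ext => W f /=; split=> // _.
  apply: locally_ret => Z k; exists (image h); split; first exact: image_atom.
  by rewrite -!shom_nat; exact: image_in.
have : sval (classify (atomic_part X) U x) U (idc U) by rewrite E.
by rewrite /= res_id.
Qed.

End Omega.

(** * Arrows *)

Section Arrows.
Variables (C : site) (B : sheaf C).
Implicit Types (g a e : arrow B).

Lemma arrow_ext g (h : arrow B) :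
  (forall U (p : prod_sheaf B B U), g U p <-> h U p) -> g = h.
Proof.
case: g => g ga; case: h => h ha /= gh.
have e : g = h by exact: subobject_ext.
by subst h; congr Arrow; exact: Prop_irrelevance.
Qed.

Lemma arrow_nondeg g : exists U (x y : B U), ~ forced_false U /\ g U (x, y).
Proof. by have [U [[[x y] gxy] nU]] := atom_nondeg (arrow_atom g); exists U, x, y. Qed.

Definition restr g (S : subobject (prod_sheaf B B)) : subobject (sub_sheaf g).
Proof.
exists (fun U x => S U (sval x)) => [U V f x Sx|U x Sx].
  exact: (@sub_stable _ _ S _ _ f _ Sx).
by apply: sub_local; apply: locally_mono Sx.
Defined.

Lemma arrow_sub g (S : subobject (prod_sheaf B B)) U (p : prod_sheaf B B U) :
  ~ forced_false U -> g U p -> S U p ->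
  forall V (q : prod_sheaf B B V), g V q -> S V q.
Proof.
move=> nU gp Sp V q gq.
exact: (@atom_sub _ _ (restr g S) (arrow_atom g) U (exist _ p gp) nU Sp V (exist _ q gq)).
Qed.

(** The common nondegenerate point and the atomicity of each arrow give the two inclusions. Arrows
    are identified in this way throughout. *)
Lemma arrow_eq g (h : arrow B) U (p : prod_sheaf B B U) :
  ~ forced_false U -> g U p -> h U p -> g = h.
Proof.
move=> nU gp hp; apply: arrow_ext => V q.
by split; [exact: (arrow_sub nU gp hp)|exact: (arrow_sub nU hp gp)].
Qed.

(** The first coordinate ([true]) leads to the target and the second ([false]) to the source;
    repeating it lands in the diagonal of [B * B], so that the image is again an arrow, and a
    unit. *)
Definition proj_diag (b : bool) g : sheaf_hom (sub_sheaf g) (prod_sheaf B B).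
Proof.
exists (fun U p => if b then ((sval p).1, (sval p).1) else ((sval p).2, (sval p).2)).
by move=> U V f [[x y] gxy]; case: b.
Defined.

Definition endpoint (b : bool) g : arrow B :=
  Arrow (image_atom (proj_diag b g) (arrow_atom g)).

Lemma local_eq (X : sheaf C) U (x y : X U) :
  locally (fun V (f : mor V U) => res f x = res f y) -> x = y.
Proof.
move=> [K [cK xy]].
have [|s [_ su]] := @sheaf_glue C X U K cK (fun V f k => res f x).
  by move=> *; rewrite res_comp.
by rewrite -(su x) // -(su y) // => V f k; rewrite xy.
Qed.

Lemma endpoint_unit b g : units (endpoint b g).
Proof.
move=> U x y H; apply: local_eq; apply: locally_mono H => V f [[p pg]] /=.
by rewrite /prod_res; case: b => -[<- <-].
Qed.

Lemma endpoints g : has_ends g (endpoint false g) (endpoint true g).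
Proof.
split; [exact: endpoint_unit|exact: endpoint_unit|].
move=> U x y gxy; split.
  exact: (@image_in _ _ _ (proj_diag true g) U (exist _ (x, y) gxy)).
exact: (@image_in _ _ _ (proj_diag false g) U (exist _ (x, y) gxy)).
Qed.

Definition src g := endpoint false g.
Definition tgt g := endpoint true g.

Lemma src_unit g : units (src g). Proof. exact: endpoint_unit. Qed.
Lemma tgt_unit g : units (tgt g). Proof. exact: endpoint_unit. Qed.

Lemma in_tgt g U (x y : B U) : g U (x, y) -> carrier (tgt g) U x.
Proof. by case: (endpoints g) => _ _ H /H[]. Qed.

Lemma in_src g U (x y : B U) : g U (x, y) -> carrier (src g) U y.
Proof. by case: (endpoints g) => _ _ H /H[]. Qed.

Lemma src_eq e g U (x y : B U) : ~ forced_false U -> carrier e U y -> g U (x, y) -> src g = e.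
Proof. by move=> nU ey gxy; apply: (arrow_eq nU (in_src gxy) ey). Qed.

Lemma tgt_eq e g U (x y : B U) : ~ forced_false U -> carrier e U x -> g U (x, y) -> tgt g = e.
Proof. by move=> nU ex gxy; apply: (arrow_eq nU (in_tgt gxy) ex). Qed.

Lemma unit_nondeg e : units e -> exists U (x : B U), ~ forced_false U /\ carrier e U x.
Proof.
move=> ue; have [U [x [y [nU exy]]]] := arrow_nondeg e.
by exists U, x; split=> //; rewrite /= {2}(ue _ _ _ exy).
Qed.

Lemma src_unitE e : units e -> src e = e.
Proof.
move=> ue; have [U [x [nU ex]]] := unit_nondeg ue.
exact: (src_eq nU ex ex).
Qed.

Lemma tgt_unitE e : units e -> tgt e = e.
Proof.
move=> ue; have [U [x [nU ex]]] := unit_nondeg ue.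
exact: (tgt_eq nU ex ex).
Qed.

Lemma starK : involutive (@star C B).
Proof. by move=> g; apply: arrow_ext => U [x y]. Qed.

Lemma src_star g : src (star g) = tgt g.
Proof.
have [U [x [y [nU gxy]]]] := arrow_nondeg g.
exact: (@src_eq _ (star g) U y x nU (in_tgt gxy)).
Qed.

Lemma star_inj : injective (@star C B).
Proof. exact: inv_inj starK. Qed.

Lemma unit_star e : units e -> star e = e.
Proof.
move=> ue; have [U [x [nU ex]]] := unit_nondeg ue.
exact: (@arrow_eq (star e) e U (x, x) nU ex ex).
Qed.

Section Point.
Variables (h : arrow B) (U : C) (x y : B U).
Hypotheses (nU : ~ forced_false U) (hxy : h U (x, y)).
(** The pairs satisfying [Q] form a subobject of [B * B] that meets the atom [h] at a nondegenerate
    point. Hence what is computed at one point of an arrow is valid at all of them. *)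
Lemma arrow_transfer (Q : forall V, B V -> B V -> Prop) :
  (forall V W (f : mor W V) s t, Q V s t -> Q W (res f s) (res f t)) ->
  (forall V s t, locally (fun W (f : mor W V) => Q W (res f s) (res f t)) -> Q V s t) ->
  Q U x y -> forall V (s t : B V), h V (s, t) -> Q V s t.
Proof.
move=> Qs Ql Qxy V s t hst.
have Ds W W' (f : mor W' W) (p : prod_sheaf B B W) :
    Q W p.1 p.2 -> Q W' (res f p).1 (res f p).2 by exact: Qs.
have Dl W (p : prod_sheaf B B W) :
    locally (fun W' (f : mor W' W) => Q W' (res f p).1 (res f p).2) -> Q W p.1 p.2.
  by move=> H; exact: Ql.
exact: (@arrow_sub h (Subobject Ds Dl) U (x, y) nU hxy Qxy V (s, t) hst).
Qed.
End Point.

(** The target is an image, so its points lift to [g], but only locally. *)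
Lemma tgt_lift g U (x : B U) : carrier (tgt g) U x ->
  locally (fun V (f : mor V U) => exists y, g V (res f x, y)).
Proof.
by rewrite /= => H; apply: locally_mono H => V f [[[s t] gst] /= [<- _]]; exists t.
Qed.

Lemma arrow_cover : atomic_topos C -> forall U (x y : B U),
  locally (fun V (f : mor V U) => exists a : arrow B, a V (res f x, res f y)).
Proof.
move=> hT U x y.
apply: locally_mono (@atoms_cover C (prod_sheaf B B) hT U (x, y)) => V f [S [aS Sx]].
by exists (Arrow aS).
Qed.

Lemma arrow_stable a U V (f : mor V U) (x y : B U) :
  a U (x, y) -> a V (res f x, res f y).
Proof. exact: (@sub_stable _ _ a U V f (x, y)). Qed.

End Arrows.

Arguments src_unit {C B} g [U x y] _.
Arguments tgt_unit {C B} g [U x y] _.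

(** * Internal finite cardinalities *)

Section Enumerations.
Variables (C : site) (X : sheaf C).

Lemma distinct_res U V (f : mor V U) n (t : 'I_n -> X U) :
  internally_distinct t -> internally_distinct (fun i => res f (t i)).
Proof. by move=> dt i j W h ij; rewrite -!res_comp; apply: dt. Qed.

(** Pigeonhole: at a later nondegenerate stage the indices [j] can be chosen, and a repeated choice
    would identify two distinct members, forcing falsity. *)
Lemma distinct_leq U n (t : 'I_n -> X U) m (t' : 'I_m -> X U) :
  ~ forced_false U -> internally_distinct t ->
  (forall i, locally (fun V (f : mor V U) => exists j, res f (t i) = res f (t' j))) ->
  (n <= m)%N.
Proof.
move=> nU dt /locally_forall/(locally_nondeg nU)[V [f [/choice[s sE] nV]]].
have si : injective s.
  move=> i j sij; apply/eqP; apply: contraT => ij; case: nV.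
  by apply: (dt i j V f ij); rewrite !sE sij.
by have := leq_card s si; rewrite !card_ord.
Qed.

Definition pshift U V (f : mor V U) (P : forall V, mor V U -> X V -> Prop) :
  forall W, mor W V -> X W -> Prop := fun W h => P W (f \c h).

Lemma enumerates_res U V (f : mor V U) (P : forall V, mor V U -> X V -> Prop) n (t : 'I_n -> X U) :
  enumerates P t -> enumerates (pshift f P) (fun i => res f (t i)).
Proof.
case=> tP dt Pt; split; [|exact: distinct_res|].
  by move=> i W h; rewrite -res_comp; exact: tP.
move=> W h s /Pt; apply: locally_mono => Z k [j]; rewrite -Defs.compA res_comp => ->.
by exists j.
Qed.

Lemma enumerates_card U (P : forall V, mor V U -> X V -> Prop) n (t : 'I_n -> X U)
    m (t' : 'I_m -> X U) :
  ~ forced_false U -> enumerates P t -> enumerates P t' -> n = m.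
Proof.
move=> nU [tP dt Pt] [tP' dt' Pt']; apply/eqP; rewrite eqn_leq; apply/andP; split.
  apply: (distinct_leq nU dt) => i.
  have := Pt' U (idc U) (t i); rewrite -{1}(res_id (t i)) => /(_ (tP i _ _)).
  by apply: locally_mono => V f [j]; rewrite comp_idl => ->; exists j.
apply: (distinct_leq nU dt') => i.
have := Pt U (idc U) (t' i); rewrite -{1}(res_id (t' i)) => /(_ (tP' i _ _)).
by apply: locally_mono => V f [j]; rewrite comp_idl => ->; exists j.
Qed.

Lemma internal_card_inj U (P : forall V, mor V U -> X V -> Prop) n m :
  ~ forced_false U -> internal_card P n -> internal_card P m -> n = m.
Proof.
move=> nU Pn Pm.
have [V [f [[[t tP] Pm'] nV]]] := locally_nondeg nU (locally_and Pn (locally_pull (idc U) Pm)).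
move: Pm'; rewrite comp_idl => -[t' t'P].
exact: (enumerates_card nV tP t'P).
Qed.

Lemma internal_card_enum U (P : forall V, mor V U -> X V -> Prop) n (t : 'I_n -> X U) :
  enumerates P t -> internal_card P n.
Proof.
by move=> eP; apply: locally_ret => V f; exists (fun i => res f (t i)); exact: enumerates_res.
Qed.

Lemma internal_card_pull U V (f : mor V U) (P : forall V, mor V U -> X V -> Prop) n :
  internal_card P n -> internal_card (pshift f P) n.
Proof.
move=> /(locally_pull f); apply: locally_mono => W h [t tP]; exists t.
case: tP => tP dt Pt; split=> //.
- by move=> i Z k; rewrite /pshift Defs.compA; exact: tP.
- move=> Z k s; rewrite /pshift Defs.compA; exact: Pt.
Qed.

Lemma internal_card_local U (P : forall V, mor V U -> X V -> Prop) n :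
  locally (fun V (f : mor V U) => internal_card (pshift f P) n) -> internal_card P n.
Proof.
move=> H; apply: (locally_bind H) => V f; apply: locally_mono => W h [t tP]; exists t.
case: tP => tP dt Pt; split=> //.
- by move=> i Z k; rewrite -Defs.compA; exact: tP.
- move=> Z k s; rewrite -Defs.compA; exact: Pt.
Qed.

Lemma internal_card_ext U (P Q : forall V, mor V U -> X V -> Prop) n :
  (forall V f s, P V f s <-> Q V f s) -> internal_card P n -> internal_card Q n.
Proof.
move=> PQ; apply: locally_mono => V f [t [tP dt Pt]]; exists t; split=> //.
- by move=> i W h; apply/PQ.
- by move=> W h s /PQ/Pt.
Qed.

(** The family may contain more than [P]. The test [b] has to decide membership in [P] at all
    nondegenerate later stages; labels by arrows will provide such tests. *)
Lemma enumerates_filter U (P : forall V, mor V U -> X V -> Prop) n (t : 'I_n -> X U)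
    (b : pred 'I_n) :
  internally_distinct t ->
  (forall i V f, b i -> P V f (res f (t i))) ->
  (forall i V f, ~~ b i -> P V f (res f (t i)) -> forced_false V) ->
  (forall V W (f : mor V U) (h : mor W V) s, P V f s -> P W (f \c h) (res h s)) ->
  (forall V f s, P V f s ->
     locally (fun W (h : mor W V) => exists i, res h s = res (f \c h) (t i))) ->
  enumerates P (fun i : 'I_#|b| => t (enum_val i)).
Proof.
move=> dt bP nbP Ps Pt; split.
- by move=> i V f; apply: bP; exact: (enum_valP i).
- by move=> i j V f ij; apply: dt; apply: contra_neq ij; exact: enum_val_inj.
move=> V f s Psf; apply: (locally_bind (Pt V f s Psf)) => W h [i sE].
have [bi|nbi] := boolP (b i).
  apply: locally_ret => Z k; exists (enum_rank_in bi i); rewrite enum_rankK_in //.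
  by rewrite res_comp sE -res_comp Defs.compA.
apply: degenerate_locally; apply: (nbP i W (f \c h) nbi); rewrite -sE.
exact: Ps.
Qed.

End Enumerations.

(** * Structure constants *)

Section Counting.
Variables (C : site) (B : sheaf C).
Hypotheses (hT : atomic_topos C) (hfin : locally_finite B).
Implicit Types (g a e : arrow B).

Lemma has_ends_star g e e' : has_ends g e e' -> has_ends (star g) e' e.
Proof. by case=> ue ue' H; split=> // U x y /H[]. Qed.

Lemma rcardP g U (y : B U) : carrier (tgt g) U y ->
  internal_card (fun V (f : mor V U) (z : B V) => g V (res f y, z)) (rcard g).
Proof.
have sP : rcard_spec g (rcard g) by apply: (@xgetPex _ 0%N); exact: hfin.
exact: sP (endpoints g) U y.
Qed.

(** Local finiteness is stated for right fibres; the left fibres of [g] are the right fibres of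
    [star g]. *)
Lemma lcardP g U (x : B U) : carrier (src g) U x ->
  internal_card (fun V (f : mor V U) (z : B V) => g V (z, res f x)) (lcard g).
Proof.
have sP : lcard_spec g (lcard g).
  apply: (@xgetPex _ 0%N); have [n nP] := hfin (star g); exists n => e e' ee'.
  exact: (nP _ _ (has_ends_star ee')).
exact: sP (endpoints g) U x.
Qed.

Lemma lcard_star g : lcard (star g) = rcard g.
Proof.
have [U [x [nU ex]]] := unit_nondeg (tgt_unit g).
apply: (internal_card_inj nU _ (rcardP ex)).
by apply: (@lcardP (star g)); rewrite src_star.
Qed.

Lemma rcard_star g : rcard (star g) = lcard g.
Proof. by rewrite -lcard_star starK. Qed.

Lemma lcard_gt0 g : (0 < lcard g)%N.
Proof.
have [U [x [y [nU gxy]]]] := arrow_nondeg g.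
have [V [f [[t [_ _ tP]] nV]]] := locally_nondeg nU (lcardP (in_src gxy)).
have [W [h [[j _] _]]] := locally_nondeg nV (tP V (idc V) (res (f \c idc V) x)
   (arrow_stable (f \c idc V) gxy)).
exact: leq_ltn_trans (leq0n j) (ltn_ord j).
Qed.

Lemma rcard_gt0 g : (0 < rcard g)%N.
Proof. by rewrite -lcard_star lcard_gt0. Qed.

(** Finitely many coverings have a common refinement, so one stage labels all the pairs at once. *)
Lemma label_family U n (t : 'I_n -> (B U * B U)%type) :
  locally (fun V (f : mor V U) => exists l : 'I_n -> arrow B,
    forall i, l i V (res f (t i).1, res f (t i).2)).
Proof.
apply: locally_mono (locally_forall (fun i => arrow_cover hT (t i).1 (t i).2)).
by move=> V f /choice[l lP]; exists l.
Qed.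

(** The internal sets to be counted: [lfib] by [lcard], [rfib] by [rcard], and the set [mfib] of
    middle points by [binom]. *)
Definition lfib g U (y : B U) : forall V, mor V U -> B V -> Prop :=
  fun V f z => g V (z, res f y).
Definition rfib g U (x : B U) : forall V, mor V U -> B V -> Prop :=
  fun V f z => g V (res f x, z).
Definition mfib g (h : arrow B) U (x y : B U) : forall V, mor V U -> B V -> Prop :=
  fun V f s => g V (res f x, s) /\ h V (s, res f y).

Lemma lfib_stable g U (y : B U) V W (f : mor V U) (h : mor W V) s :
  lfib g y f s -> lfib g y (f \c h) (res h s).
Proof. by rewrite /lfib res_comp; exact: arrow_stable. Qed.

Lemma mfib_stable g g' U (x y : B U) V W (f : mor V U) (h : mor W V) s :
  mfib g g' x y f s -> mfib g g' x y (f \c h) (res h s).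
Proof. by rewrite /mfib !res_comp => -[]; split; exact: arrow_stable. Qed.

Lemma lcard_filter g U (x : B U) n (t : 'I_n -> B U) (l : 'I_n -> arrow B) :
  ~ forced_false U -> carrier (src g) U x -> internally_distinct t ->
  (forall i, l i U (t i, x)) ->
  (forall V f s, lfib g x f s ->
     locally (fun W (h : mor W V) => exists i, res h s = res (f \c h) (t i))) ->
  lcard g = #|[pred i | l i == g]|.
Proof.
move=> nU sx dt lt cov; apply: (internal_card_inj nU (lcardP sx)).
apply: internal_card_enum; apply: enumerates_filter cov => //.
- by move=> i V f /= /eqP <-; exact: arrow_stable.
- move=> i V f /= nl gi; apply: contrapT => nV; move/negP: nl; apply.
  by apply/eqP; apply: (arrow_eq nV (arrow_stable f (lt i)) gi).
- by move=> *; apply: lfib_stable.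
Qed.

(** Middle points lie in the left fibre of [h] over [y]; by disjointness of arrows, the members of
    that fibre related to [x] by [g] are those labelled [g]. *)
Lemma mfib_filter_left g (h : arrow B) U (x y : B U) n (t : 'I_n -> B U) (l : 'I_n -> arrow B) :
  enumerates (lfib h y) t -> (forall i, l i U (x, t i)) ->
  enumerates (mfib g h x y) (fun i : 'I_#|[pred i | l i == g]| => t (enum_val i)).
Proof.
case=> tP dt Pt lt; apply: enumerates_filter => //.
- by move=> i V f /= /eqP <-; split; [exact: arrow_stable|exact: tP].
- move=> i V f /= nl [gi _]; apply: contrapT => nV; move/negP: nl; apply.
  by apply/eqP; apply: (arrow_eq nV (arrow_stable f (lt i)) gi).
- by move=> *; apply: mfib_stable.
- by move=> V f s [_ /Pt].
Qed.

Lemma mfib_filter_right g (h : arrow B) U (x y : B U) n (t : 'I_n -> B U) (l : 'I_n -> arrow B) :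
  enumerates (rfib g x) t -> (forall i, l i U (t i, y)) ->
  enumerates (mfib g h x y) (fun i : 'I_#|[pred i | l i == h]| => t (enum_val i)).
Proof.
case=> tP dt Pt lt; apply: enumerates_filter => //.
- by move=> i V f /= /eqP <-; split; [exact: tP|exact: arrow_stable].
- move=> i V f /= nl [_ gi]; apply: contrapT => nV; move/negP: nl; apply.
  by apply/eqP; apply: (arrow_eq nV (arrow_stable f (lt i)) gi).
- by move=> *; apply: mfib_stable.
- by move=> V f s [/Pt].
Qed.

(** Middle points lie in the right fibre of [g] at [x], which is finite if [x] is in the target of
    [g]; otherwise there are none. The arrow [e] containing [(x, x)] decides between the cases: it
    equals [tgt g] as soon as [x] enters the target at some later nondegenerate stage. *)
Lemma mfib_card_ex g (h : arrow B) U (x y : B U) :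
  locally (fun V (f : mor V U) => exists n, internal_card (mfib g h (res f x) (res f y)) n).
Proof.
apply: (locally_bind (arrow_cover hT x x)) => V f [e exx].
apply: locally_assuming_nondeg => nV.
have [egx|negx] := pselect (carrier (tgt g) V (res f x)).
  apply: (locally_bind (rcardP egx)) => W k [t tP].
  apply: locally_mono (label_family (fun i => (t i, res k (res f y)))) => Z j [l /= lP].
  exists #|[pred i | l i == h]|; rewrite !(res_comp f) !res_comp.
  apply: (internal_card_enum (@mfib_filter_right g h Z _ _ _ (fun i => res j (t i)) l _ lP)).
  case: (enumerates_res j tP) => tP' dt' Pt'; split=> //.
  - by move=> i Z2 j2; have := tP' i Z2 j2; rewrite /rfib /pshift /= !res_comp.
  - move=> Z' j' s sP; apply: (Pt' Z' j' s); move: sP.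
    by rewrite /rfib /pshift /= !res_comp.
apply: locally_ret => W k; exists 0%N; apply: internal_card_local.
apply: locally_ret => Z j; apply: (@internal_card_enum _ _ _ _ _ (fun i : 'I_0 => match i with Ordinal _ p => match notF p with end end)).
split; try by case.
move=> Z' j' s [/in_tgt + _]; rewrite -!res_comp => gx.
apply: degenerate_locally; apply: contrapT => nZ'; apply: negx.
have := arrow_stable (k \c (j \c j')) exx; rewrite -!res_comp !Defs.compA => ex.
move: gx; rewrite !Defs.compA => gx.
by rewrite -(arrow_eq nZ' ex gx).
Qed.

(** The count is found at one nondegenerate point of [a] and spread over [a] by [arrow_transfer];
    thus [xget] in [binom] returns a genuine count and not its default. *)
Lemma binom_specP g (h : arrow B) a : binom_spec g h a (binom g h a).
Proof.
apply: (@xgetPex _ 0%N).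
have [U [x [y [nU axy]]]] := arrow_nondeg a.
have [V [f [[n nP] nV]]] := locally_nondeg nU (mfib_card_ex g h x y).
exists n => W s t ast.
apply: (@arrow_transfer _ _ a V _ _ nV (arrow_stable f axy)
  (fun U x y => internal_card (mfib g h x y) n) _ _ nP W s t ast).
- move=> Z Z' k u v /(internal_card_pull k); apply: internal_card_ext => Y j w.
  by rewrite /pshift /mfib !res_comp.
- move=> Z u v H; apply: internal_card_local; apply: locally_mono H => Z' k.
  by apply: internal_card_ext => Y j w; rewrite /pshift /mfib !res_comp.
Qed.

Lemma binomP g (h : arrow B) a U (x y : B U) : a U (x, y) ->
  internal_card (mfib g h x y) (binom g h a).
Proof. by move=> axy; exact: binom_specP. Qed.

Lemma binom_left g (h : arrow B) a U (x y : B U) n (t : 'I_n -> B U) (l : 'I_n -> arrow B) :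
  ~ forced_false U -> a U (x, y) ->
  enumerates (lfib h y) t -> (forall i, l i U (x, t i)) ->
  binom g h a = #|[pred i | l i == g]|.
Proof.
move=> nU axy tP lt; apply: (internal_card_inj nU (binomP g h axy)).
exact: internal_card_enum (mfib_filter_left g tP lt).
Qed.

Lemma binom_neq0 g (h : arrow B) a U (x y : B U) : a U (x, y) -> binom g h a <> 0%N ->
  locally (fun V (f : mor V U) => exists s : B V, g V (res f x, s) /\ h V (s, res f y)).
Proof.
move=> axy n0; apply: locally_mono (binomP g h axy) => V f [t [tP _ _]].
case: (binom g h a) n0 t tP => // n _ t tP; exists (t ord0).
by have := tP ord0 V (idc V); rewrite /mfib comp_idr res_id.
Qed.

(** A nonzero count yields middle points locally, which puts [a] inside the composite; where
    [composite_in] fails, [binom] is therefore 0. *)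
Lemma struct_constE g (h : arrow B) a : struct_const g h a = binom g h a.
Proof.
rewrite /struct_const; case: asboolP => // nab; apply/esym.
apply: contrapT => n0; apply: nab => U x y axy.
exact: binom_neq0 axy n0.
Qed.

Lemma binom_ends g (h : arrow B) a : binom g h a <> 0%N ->
  [/\ src g = tgt h, tgt a = tgt g & src a = src h].
Proof.
move=> n0; have [U [x [y [nU axy]]]] := arrow_nondeg a.
have [V [f [[s [gxs hsy]] nV]]] := locally_nondeg nU (binom_neq0 axy n0).
have axy' := arrow_stable f axy.
split.
- exact: (arrow_eq nV (in_src gxs) (in_tgt hsy)).
- exact: (arrow_eq nV (in_tgt axy') (in_tgt gxs)).
- exact: (arrow_eq nV (in_src axy') (in_src hsy)).
Qed.

(** At a diagonal point [(x, x)], a middle point [s] has [x g s] and [s h x], which forces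
    [h = star g]; the middle points then form the right fibre of [g] at [x]. *)
Lemma binom_unit g (h : arrow B) e : units e ->
  binom g h e = if (h == star g) && (e == tgt g) then rcard g else 0%N.
Proof.
move=> ue; have [U [x [nU ex]]] := unit_nondeg ue.
case: ifP => [/andP[/eqP -> /eqP eE]|].
  apply: (internal_card_inj nU (binomP g (star g) ex)).
  move: (ex); rewrite eE => /rcardP; apply: internal_card_ext => V f s.
  by rewrite /mfib /=; split=> // -[].
apply: contraFeq => /eqP n0.
have [V [f [[s [gxs hsx]] nV]]] := locally_nondeg nU (binom_neq0 ex n0).
apply/andP; split; apply/eqP.
  exact: (@arrow_eq _ _ h (star g) V (s, res f x) nV hsx gxs).
by have [_ + _] := binom_ends n0; rewrite tgt_unitE.
Qed.

(** Starting from one point [x] of the target of [g] and following [g], then [h], only finitely many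
    endpoints are reached. An arrow [a] with nonzero count contains, locally, the pair of [x] and
    one of these endpoints, so it is one of finitely many labels. *)
Lemma binom_finite g (h : arrow B) : finite_set [set a | binom g h a <> 0%N].
Proof.
have [gh|ngh] := pselect (src g = tgt h); last first.
  suff -> : [set a | binom g h a <> 0%N] = set0 by exact: finite_set0.
  by apply/seteqP; split=> // a /= /binom_ends[].
have [U0 [x0 [nU0 ex0]]] := unit_nondeg (tgt_unit g).
have [U [f [[t tP] nU]]] := locally_nondeg nU0 (rcardP ex0).
have ex := sub_stable f ex0; set x := res f x0 in ex.
have {}tP : enumerates (rfib g x) t.
  case: tP => tP dt Pt; split=> //.
  - by move=> i V k; have := tP i V k; rewrite /rfib res_comp.
  - by move=> V k s; rewrite /rfib -res_comp => /Pt.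
case: tP => tP dt Pt.
have ti i : carrier (tgt h) U (t i).
  rewrite -gh; have := tP i U (idc U); rewrite /rfib !res_id => gx.
  exact: in_src gx.
have [V [k [/choice[t' tP'] nV]]] := locally_nondeg nU (locally_forall (fun i => rcardP (ti i))).
(* The endpoints: [q (i, m)] is the [m]-th member of the right fibre of [h] at [t i]. *)
pose q := (fun p : 'I_(rcard g) * 'I_(rcard h) => t' p.1 p.2).
have := locally_forall (fun p => arrow_cover hT (res k x) (q p)).
move=> /(locally_nondeg nV)[W [j [/choice[l lP] nW]]].
apply: (@sub_finite_set _ _ (l @` setT)); last exact: finite_image.
move=> a /= n0; have [_ ag _] := binom_ends n0.
have exa : carrier (tgt a) W (res j (res k x)).
  by rewrite ag -!res_comp; exact: (sub_stable (f \c k \c j) ex0) || (rewrite res_comp; exact: (sub_stable (k \c j) ex)).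
have [W1 [f1 [[y axy] nW1]]] := locally_nondeg nW (tgt_lift exa).
have [W2 [f2 [[s [gxs hsy]] nW2]]] := locally_nondeg nW1 (binom_neq0 axy n0).
have := Pt W2 (k \c j \c f1 \c f2) s; rewrite /rfib !res_comp => /(_ gxs).
move=> /(locally_nondeg nW2)[W3 [f3 [[i si] nW3]]].
have := tP' i; case=> _ _ Pt'.
have := Pt' W3 (j \c f1 \c f2 \c f3) (res f3 (res f2 y)).
rewrite -Defs.compA -Defs.compA -Defs.compA in si.
have hty : h W3 (res (k \c (j \c f1 \c f2 \c f3)) (t i), res f3 (res f2 y)).
  have := arrow_stable f3 hsy; rewrite si.
  by rewrite !Defs.compA.
move=> /(_ hty)/(locally_nondeg nW3)[W4 [f4 [[m mE] nW4]]].
exists (i, m) => //.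
apply: (arrow_eq nW4 (arrow_stable (f1 \c f2 \c f3 \c f4) (lP (i, m)))).
have := arrow_stable (f2 \c f3 \c f4) axy.
by rewrite !res_comp mE /q /= !res_comp.
Qed.

(** Fix [y] in the common source of [g] and [h], and count the pairs [(b, s)] with [b h y], [s g y]
    and [b k s]: each of the [lcard h] points [b] has [binom k g h] partners, and each of the
    [lcard g] points [s] has [binom (star k) h g]. If the sources differ, both counts vanish. *)
Lemma binom_double_count g (h k : arrow B) :
  (lcard h * binom k g h = lcard g * binom (star k) h g)%N.
Proof.
have [hg|nhg] := pselect (src h = src g); last first.
  have -> : binom k g h = 0%N by apply: contrapT => /binom_ends[_ _].
  have -> : binom (star k) h g = 0%N by apply: contrapT => /binom_ends[_ _] /esym.
  by rewrite !muln0.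
have [U [x [nU ex]]] := unit_nondeg (src_unit h).
have exg : carrier (src g) U x by rewrite -hg.
have := locally_and (lcardP ex) (lcardP exg).
move=> /(locally_nondeg nU)[V [f [[[t tP] [s sP]] nV]]].
pose y := res f x.
have shiftP g' n (r : 'I_n -> B V) : enumerates
      (fun W (h : mor W V) z => g' W (z, res (f \c h) x)) r -> enumerates (lfib g' y) r.
  case=> rP dr Pr; split=> //.
  - by move=> i W j; have := rP i W j; rewrite /lfib res_comp.
  - by move=> W j z; rewrite /lfib -res_comp => /Pr.
have := locally_forall (fun p : 'I_(lcard h) * 'I_(lcard g) => arrow_cover hT (t p.1) (s p.2)).
move=> /(locally_nondeg nV)[W [j [/choice[l lP] nW]]].
have resP g' n (r : 'I_n -> B V) : enumerates (lfib g' y) r ->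
    enumerates (lfib g' (res j y)) (fun i => res j (r i)).
  move=> /(enumerates_res j)[rP dr Pr]; split=> //.
  - by move=> i Z p; have := rP i Z p; rewrite /lfib /pshift /= res_comp.
  - move=> Z p z H; apply: (Pr Z p z); move: H.
    by rewrite /lfib /pshift /= res_comp.
have {}tP := resP _ _ _ (shiftP _ _ _ tP); have {}sP := resP _ _ _ (shiftP _ _ _ sP).
(* One stage labels all pairs, so the two counts are the row and column sums of a single 0-1
   matrix. *)
transitivity (\sum_(i < lcard h) \sum_(m < lcard g) (l (i, m) == k))%N.
  rewrite -[in LHS](card_ord (lcard h)) -sum_nat_const; apply: eq_bigr => i _.
  have hx : h W (res j (t i), res j y).
    by case: tP => /(_ i W (idc W)); rewrite /lfib !res_id.
  rewrite (@binom_left k g h W _ _ _ _ (fun m => l (i, m)) nW hx sP) => [|m]; last exact: (lP (i, m)).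
  by rewrite -sum1_card big_mkcond; apply: eq_bigr => m _; rewrite inE; case: eqP.
rewrite exchange_big /=.
rewrite -[in RHS](card_ord (lcard g)) -sum_nat_const; apply: eq_bigr => m _.
have gx : g W (res j (s m), res j y).
  by case: sP => /(_ m W (idc W)); rewrite /lfib !res_id.
rewrite (@binom_left (star k) h g W _ _ _ _ (fun i => star (l (i, m))) nW gx tP) => [|i]; last exact: (lP (i, m)).
rewrite -sum1_card [RHS]big_mkcond; apply: eq_bigr => i _; rewrite inE.
by rewrite (inj_eq (@star_inj _ B)); case: eqP.
Qed.

(* Both sides equal [|g|_l |g|_r binom (k^* ) h g]: for each of them, count the
   pairs formed by two vertices of the triangle [b k y], [y g x], [b h x], the
   third vertex being fixed. *)
Lemma binom_adjoint g (h k : arrow B) :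
  (binom k g h * lcard h * rcard g = binom h (star g) k * lcard k * lcard g)%N.
Proof.
rewrite [(binom k g h * _)%N]mulnC (binom_double_count g h k).
rewrite [(binom h (star g) k * _)%N]mulnC (binom_double_count (star g) k h) lcard_star.
suff -> : binom (star k) h g = binom (star h) k (star g) by rewrite [LHS]mulnAC [RHS]mulnAC (mulnC (lcard g)).
have [U [x [y [nU gxy]]]] := arrow_nondeg g.
have := @binomP (star h) k (star g) U y x gxy.
move=> H; apply: (internal_card_inj nU (binomP (star k) h gxy)).
apply: internal_card_ext H => V f s.
by rewrite /mfib /=; split=> -[].
Qed.

End Counting.

(** * Internal complex numbers and l^2 *)

Lemma rat_between (R : realType) (x y : R) : x < y -> exists q : rat, x < ratr q < y.
Proof. by move=> /rat_in_itvoo[q]; rewrite in_itv /=; exists q. Qed.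

Section ComplexNumbers.
Variable R : realType.

(** Neighbourhoods of a finite tuple for the uniform distance on real and imaginary parts, packaged
    as a filter so that limit lemmas on sums and products apply. *)
Definition near_tuple (I : finType) (z : I -> R[i]) : set_system (I -> R[i]) :=
  [set P | exists2 d : R, 0 < d & forall p : I -> R[i],
    (forall i, `|complex.Re (z i) - complex.Re (p i)| < d /\
               `|complex.Im (z i) - complex.Im (p i)| < d) -> P p].

Global Instance near_tuple_filter (I : finType) (z : I -> R[i]) :
  ProperFilter (near_tuple z).
Proof.
split.
  by move=> [d d0 /(_ z)]; apply=> i; rewrite !subrr normr0.
split.
- by exists 1.
- move=> P Q [d d0 dP] [e e0 eQ]; exists (Num.min d e); first by rewrite lt_min d0.
  by move=> p H; split; [apply: dP|apply: eQ] => i; have := H i;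
     rewrite !lt_min => -[/andP[? ?] /andP[? ?]].
- by move=> P Q PQ [d d0 dP]; exists d => // p /dP/PQ.
Qed.

Definition box_continuous (I : finType) (F : (I -> R[i]) -> R[i]) :=
  forall z : I -> R[i], complex.Re (F p) @[p --> near_tuple z] --> complex.Re (F z) /\
            complex.Im (F p) @[p --> near_tuple z] --> complex.Im (F z).

Lemma rat_box (z : R[i]) (d : R) : 0 < d -> exists D : box, in_box D z /\
  forall p : R[i], in_box D p -> `|complex.Re z - complex.Re p| < d /\
    `|complex.Im z - complex.Im p| < d.
Proof.
move=> d0.
have [a /andP[a1 a2]] := @rat_between R (complex.Re z - d) (complex.Re z) ltac:(by rewrite ltrBlDr ltrDl).
have [b /andP[b1 b2]] := @rat_between R (complex.Re z) (complex.Re z + d) ltac:(by rewrite ltrDl).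
have [a' /andP[a1' a2']] := @rat_between R (complex.Im z - d) (complex.Im z) ltac:(by rewrite ltrBlDr ltrDl).
have [b' /andP[b1' b2']] := @rat_between R (complex.Im z) (complex.Im z + d) ltac:(by rewrite ltrDl).
exists (CBox a b a' b'); split; first by split; apply/andP.
move=> p [/andP[/= p1 p2] /andP[/= p3 p4]].
by split; rewrite ltr_norml; apply/andP; split; lra.
Qed.

(** Bridge from filters to [capply], which asks for rational boxes; [rat_box] fits them inside the
    uniform radius [d]. *)
Lemma box_continuousP (I : finType) (F : (I -> R[i]) -> R[i]) : box_continuous F ->
  forall z D, in_box D (F z) -> exists E : I -> box, (forall i, in_box (E i) (z i)) /\
    forall p : I -> R[i], (forall i, in_box (E i) (p i)) -> in_box D (F p).
Proof.
move=> cF z D [/andP[D1 D2] /andP[D3 D4]]; have [cr ci] := cF z.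
have [d d0 dP] : near_tuple z [set p | in_box D (F p)].
  near=> p; split; apply/andP; split; near: p.
  - exact: cvgr_gt cr _ D1.
  - exact: cvgr_lt cr _ D2.
  - exact: cvgr_gt ci _ D3.
  - exact: cvgr_lt ci _ D4.
have [E EP] := choice (fun i => rat_box (z i) d0).
exists E; split=> [i|p pE]; first by case: (EP i).
by apply: dP => i; case: (EP i) => _; apply.
Unshelve. all: by end_near. Qed.

Lemma box_continuous_proj (I : finType) (i : I) : box_continuous (fun p : I -> R[i] => p i).
Proof.
move=> z; split; apply/cvgrPdist_lt => e e0; exists e => // p /(_ i); case=> //.
Qed.

Lemma box_continuous_cst (I : finType) (k : R[i]) : box_continuous (fun p : I -> R[i] => k).
Proof. by move=> z; split; exact: cvg_cst. Qed.

Lemma complexReD (x y : R[i]) : complex.Re (x + y) = complex.Re x + complex.Re y.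
Proof. by case: x y => [? ?] [? ?]. Qed.
Lemma complexImD (x y : R[i]) : complex.Im (x + y) = complex.Im x + complex.Im y.
Proof. by case: x y => [? ?] [? ?]. Qed.
Lemma complexReM (x y : R[i]) : complex.Re (x * y) =
  complex.Re x * complex.Re y - complex.Im x * complex.Im y.
Proof. by case: x y => [? ?] [? ?]. Qed.
Lemma complexImM (x y : R[i]) : complex.Im (x * y) =
  complex.Re x * complex.Im y + complex.Im x * complex.Re y.
Proof. by case: x y => [? ?] [? ?]. Qed.

Lemma box_continuousD (I : finType) (F G : (I -> R[i]) -> R[i]) :
  box_continuous F -> box_continuous G -> box_continuous (fun p => F p + G p).
Proof.
move=> cF cG z; have [Fr Fi] := cF z; have [Gr Gi] := cG z; split.
  under eq_cvg do rewrite complexReD.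
  by rewrite complexReD; exact: cvgD.
under eq_cvg do rewrite complexImD.
by rewrite complexImD; exact: cvgD.
Qed.

Lemma box_continuousM (I : finType) (F G : (I -> R[i]) -> R[i]) :
  box_continuous F -> box_continuous G -> box_continuous (fun p => F p * G p).
Proof.
move=> cF cG z; have [Fr Fi] := cF z; have [Gr Gi] := cG z; split.
  under eq_cvg do rewrite complexReM.
  by rewrite complexReM; apply: cvgB; exact: cvgM.
under eq_cvg do rewrite complexImM.
by rewrite complexImM; apply: cvgD; exact: cvgM.
Qed.

Lemma box_continuous_conj (I : finType) (F : (I -> R[i]) -> R[i]) :
  box_continuous F -> box_continuous (fun p => conjc (F p)).
Proof.
move=> cF z; have [Fr Fi] := cF z.
have rE (x : R[i]) : complex.Re (conjc x) = complex.Re x by case: x.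
have iE (x : R[i]) : complex.Im (conjc x) = - complex.Im x by case: x.
split.
  by under eq_cvg do rewrite rE; rewrite rE.
under eq_cvg do rewrite iE.
by rewrite iE; exact: cvgN.
Qed.

Lemma box_continuous_sum (I J : finType) (F : J -> (I -> R[i]) -> R[i]) :
  (forall j, box_continuous (F j)) -> box_continuous (fun p => \sum_j F j p).
Proof.
move=> cF; suff H (s : seq J) : box_continuous (fun p => \sum_(j <- s) F j p) by exact: H.
elim: s => [|j s IH].
  have -> : (fun p => \sum_(j <- [::]) F j p) = (fun p => 0).
    by apply/funext => p; rewrite big_nil.
  exact: box_continuous_cst.
have -> : (fun p => \sum_(j <- j :: s) F j p) = (fun p => F j p + \sum_(j <- s) F j p).
  by apply/funext => p; rewrite big_cons.
exact: box_continuousD.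
Qed.

Lemma box_disc (z : R[i]) (eps : R) : 0 < eps -> exists D, in_box D z /\
  forall p : R[i], in_box D p -> `|p - z| < eps%:C%C.
Proof.
move=> e0; have [D [Dz DP]] := rat_box z (divr_gt0 e0 (ltr0n R 2)).
exists D; split=> // p /DP[r i].
have -> : p - z = (complex.Re p - complex.Re z)%:C%C + 'i%C * (complex.Im p - complex.Im z)%:C%C.
  by case: p z {Dz DP r i} => [a b] [c d] /=; rewrite [LHS]complexE.
apply: le_lt_trans (ler_normD _ _) _.
have -> : `|'i%C * (complex.Im p - complex.Im z)%:C%C| = `|(complex.Im p - complex.Im z)%:C%C|.
  by rewrite normrM [`|'i%C|]normc_def /= expr0n /= add0r expr1n sqrtr1 mul1r.
rewrite !normc_def /= !expr0n /= !addr0 !sqrtr_sqr.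
rewrite -rmorphD ltcR.
by rewrite distrC [X in _ + X]distrC; lra.
Qed.

Variable C : site.

(** At a degenerate stage all boxes are accepted by the numbers in play, whence the first disjunct;
    elsewhere [c] is the constant [z]. *)
Definition num_at (U : C) (c : cnum U) (z : R[i]) : Prop :=
  forall V (f : mor V U) D, c V f D <-> forced_false V \/ in_box D z.

(** At a nondegenerate stage the boxes [E i] contain the [z i], so [D] contains [F z]. Continuity
    serves the converse, to find the boxes. *)
Lemma num_at_capply (U : C) (I : finType) (F : (I -> R[i]) -> R[i])
    (c : I -> cnum U) (z : I -> R[i]) :
  box_continuous F -> (forall i, num_at (c i) (z i)) -> num_at (capply F c) (F z).
Proof.
move=> cF cz V f D; split.
  move=> H; apply: contrapT => /not_orP[nV nD].
  have [W [h [[E [cE EF]] nW]]] := locally_nondeg nV H.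
  by apply: nD; apply: EF => i; have /cz[] := cE i.
case=> [dV|Dz]; first exact: degenerate_locally.
have [E [Ez EF]] := box_continuousP cF Dz.
by apply: locally_ret => W h; exists E; split=> // i; apply/cz; right.
Qed.

Lemma num_at_cconst (U : C) z : num_at (@cconst R C U z) z.
Proof.
apply: (@num_at_capply U void (fun _ => z) _ (fun i => match i with end)).
  exact: box_continuous_cst.
by case.
Qed.

Lemma num_at_eq (U : C) (c d : cnum U) z : num_at c z -> num_at d z -> cnum_eq c d.
Proof. by move=> cz dz V f D; rewrite cz dz. Qed.

Lemma num_at_cconstP (U : C) (c : cnum U) z : num_at c z <-> cnum_eq c (@cconst R C U z).
Proof.
split=> [cz|cz]; first exact: num_at_eq cz (@num_at_cconst U z).
by move=> V f D; rewrite cz; exact: num_at_cconst.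
Qed.

Lemma cmap_at_res (X : sheaf C) (u : cmap X) (U V W : C) (f : mor V U) (h : mor W V) (x : X U) D :
  cmap_at u x (f \c h) D = cmap_at u (res f x) h D.
Proof. by rewrite /cmap_at !res_comp. Qed.

Lemma cmap_at_stable (X : sheaf C) (u : cmap X) (U V W : C) (f : mor V U) (h : mor W V) (x : X U) D :
  cmap_at u x f D -> cmap_at u x (f \c h) D.
Proof. by rewrite /cmap_at !res_comp => -[]; split; exact: sub_stable. Qed.

Lemma cmap_at_local (X : sheaf C) (u : cmap X) (U V : C) (f : mor V U) (x : X U) D :
  locally (fun W (h : mor W V) => cmap_at u x (f \c h) D) -> cmap_at u x f D.
Proof.
move=> H; split; apply: sub_local; apply: locally_mono H => W h;
  by rewrite /cmap_at !res_comp => -[].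
Qed.

Lemma num_at_cmap_local (X : sheaf C) (u : cmap X) (U : C) (x : X U) z :
  locally (fun V (f : mor V U) => num_at (cmap_at u (res f x)) z) ->
  num_at (cmap_at u x) z.
Proof.
move=> H V f D; have {}H := locally_pull f H; split=> [cD|].
  have [|nV] := pselect (forced_false V); first by left.
  have [W [h [nu nW]]] := locally_nondeg nV H; right.
  have := cmap_at_stable h cD; rewrite -[f \c h]comp_idr cmap_at_res.
  by move=> /nu[].
move=> Dz; apply: cmap_at_local; apply: locally_mono H => W h nu.
rewrite -[f \c h]comp_idr cmap_at_res; apply/nu.
by case: Dz; [left; exact: (degenerate_pull h)|right].
Qed.

Lemma cnear_num (U : C) (c : cnum U) z (eps : R) : 0 < eps -> num_at c z -> cnear c z eps.
Proof.
move=> e0 cz; have [D [Dz DP]] := box_disc z e0.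
by apply: locally_ret => V f; exists D; split=> //; apply/cz; right.
Qed.

Lemma cnear_dist (U : C) (c : cnum U) z w (eps : R) : ~ forced_false U ->
  num_at c w -> cnear c z eps -> `|w - z| < eps%:C%C.
Proof.
move=> nU cw /(locally_nondeg nU)[V [f [[D [/cw[//|Dw] DP]] nV]]].
exact: DP.
Qed.

End ComplexNumbers.

(** * Maps to the complex numbers as functions on arrows *)

Section Families.
Variables (R : realType) (C : site) (B : sheaf C).
Hypotheses (hT : atomic_topos C) (hfin : locally_finite B).
Implicit Types (g a e : arrow B).

(* On [fib e], a map to the complex numbers is constant along each arrow [a]
   with source [e], i.e. on the points [(x, b)] such that [b a x]. *)
Definition values e (u : cmap (fib e)) (c : arrow B -> R[i]) : Prop :=
  forall U (x : ucar e U) (b : B U) a, a U (b, sval x) ->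
    num_at (@cmap_at C (fib e) u U (x, b)) (c a).

Definition cut_values e (r : rmap (fib e)) (c : arrow B -> R) : Prop :=
  forall U (p : fib e U) a, a U (p.2, sval p.1) -> forall q,
    (lower r q U p <-> forced_false U \/ ratr q < c a) /\
    (upper r q U p <-> forced_false U \/ c a < ratr q).

Lemma cut_values_cmap e (r i : rmap (fib e)) (c d : arrow B -> R) :
  cut_values r c -> cut_values i d ->
  values (Cmap r i) (fun a => (c a +i* d a)%C).
Proof.
move=> rc rd U x b a ab V f D.
have ab' : a V ((@res _ (fib e) _ _ f (x, b)).2, sval (@res _ (fib e) _ _ f (x, b)).1).
  exact: arrow_stable.
split=> [[]|].
  case: (rc V _ a ab' (re_lo D)) => -> _.
  case: (rc V _ a ab' (re_hi D)) => _ ->.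
  case: (rd V _ a ab' (im_lo D)) => -> _.
  case: (rd V _ a ab' (im_hi D)) => _ ->.
  case=> [|h1]; first by left.
  case=> [|h2]; first by left.
  case=> [|h3]; first by left.
  case=> [|h4]; first by left.
  by right; split; apply/andP.
move=> H; split.
- apply/(rc V _ a ab' (re_lo D)).1; by case: H => [|[/andP[] + _ _]]; [left|right].
- apply/(rc V _ a ab' (re_hi D)).2; by case: H => [|[/andP[] _ + _]]; [left|right].
- apply/(rd V _ a ab' (im_lo D)).1; by case: H => [|[_ /andP[] + _]]; [left|right].
- apply/(rd V _ a ab' (im_hi D)).2; by case: H => [|[_ /andP[] _ +]]; [left|right].
Qed.

Section Step.
Variables (e : arrow B).

Lemma fib_label U (x : fib e U) (Q : forall V, mor V U -> Prop) :
  (forall V (f : mor V U) (a : arrow B), a V ((res f x).2, sval (res f x).1) ->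
     ~ forced_false V -> locally (fun W (h : mor W V) => Q W (f \c h))) ->
  locally Q.
Proof.
move=> H; apply: (locally_bind (arrow_cover hT x.2 (sval x.1))) => V f [a ax].
by apply: locally_assuming_nondeg => nV; exact: H ax nV.
Qed.

Variable (c : arrow B -> R).

Definition step_sub (P : R -> Prop) : subobject (fib e).
Proof.
apply: (@sub_locally C (fib e) (fun U p => exists a, a U (p.2, sval p.1) /\ P (c a))).
move=> U V f [x b] [a [/= ab Pa]]; exists a; split=> //=.
exact: arrow_stable.
Defined.

Lemma step_subP P U (p : fib e U) a : a U (p.2, sval p.1) ->
  step_sub P U p <-> forced_false U \/ P (c a).
Proof.
case: p => x b /= ab; split=> [H|[dU|Pa]].
- apply: contrapT => /not_orP[nU nP].
  have [V [f [[a' [/= ab' Pa']] nV]]] := locally_nondeg nU H.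
  by apply: nP; rewrite (arrow_eq nV (arrow_stable f ab) ab').
- exact: (@sub_degenerate C (fib e) (step_sub P) U (x, b) dU).
- by apply: locally_ret => V f; exists a; split=> //; exact: arrow_stable.
Qed.

Lemma step_sub_mono (P Q : R -> Prop) U (p : fib e U) :
  (forall y, P y -> Q y) -> step_sub P U p -> step_sub Q U p.
Proof. by move=> PQ; apply: locally_mono => V f [a [ap /PQ]]; exists a. Qed.

Lemma fib_stable U V (f : mor V U) (p : fib e U) a :
  a U (p.2, sval p.1) -> a V ((res f p).2, sval (res f p).1).
Proof. by case: p => x b; exact: arrow_stable. Qed.

Lemma step_sub_inhabited (P : rat -> R -> Prop) : (forall y, exists q, P q y) ->
  forall U (x : fib e U),
    locally (fun V (f : mor V U) => exists q, step_sub (P q) V (res f x)).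
Proof.
move=> PI U x; apply: (fib_label (x := x)) => V f a ax nV.
have [q qa] := PI (c a); apply: locally_ret => W h; exists q.
rewrite res_comp; apply/(step_subP _ (fib_stable h ax)); by right.
Qed.

Lemma step_sub_rounded (P : rat -> R -> Prop) (lt : rat -> rat -> Prop) :
  (forall q y, P q y <-> exists r, lt q r /\ P r y) ->
  forall q U (x : fib e U), step_sub (P q) U x <->
    locally (fun V (f : mor V U) => exists r, lt q r /\ step_sub (P r) V (res f x)).
Proof.
move=> PR q U x; split=> H.
  apply: locally_mono H => V f [a [ax /PR[r [qr Pr]]]]; exists r; split=> //.
  by apply/(step_subP _ ax); right.
apply: sub_local; apply: locally_mono H => V f [r [qr]].
by apply: step_sub_mono => y Pr; apply/PR; exists r.
Qed.

(** The cut with constant value [c a] along each arrow [a]. It is located because points carry a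
    label locally, and disjoint because the label is unique. *)
Definition step_rmap : rmap (fib e).
Proof.
apply: (@Rmap C (fib e) (fun q => step_sub (fun y => ratr q < y))
                        (fun q => step_sub (fun y => y < ratr q))).
- apply: step_sub_inhabited => y.
  have /rat_between[q /andP[_ qy]] : y - 1 < y by rewrite ltrBlDr ltrDl.
  by exists q.
- apply: step_sub_inhabited => y.
  have /rat_between[q /andP[qy _]] : y < y + 1 by rewrite ltrDl.
  by exists q.
- apply: (@step_sub_rounded (fun q y => ratr q < y) (fun q r => q < r)) => q y; split.
    by move=> /rat_between[r /andP[qr ry]]; exists r; rewrite -(ltr_rat R).
  by case=> r [qr]; apply: lt_trans; rewrite ltr_rat.
- apply: (@step_sub_rounded (fun q y => y < ratr q) (fun q r => r < q)) => q y; split.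
    by move=> /rat_between[r /andP[qr ry]]; exists r; rewrite -(ltr_rat R).
  by case=> r [qr ry]; apply: (lt_trans ry); rewrite ltr_rat.
- move=> q U x Hl Hu; have H := locally_and Hl Hu.
  apply: degenerate_local; apply: locally_mono H => V f [[a [ax qa]] [a' [ax' qa']]].
  apply: contrapT => nV; have aa' := arrow_eq nV ax ax'; subst a'.
  by have := lt_trans qa qa'; rewrite ltxx.
- move=> q r U x qr; apply: (fib_label (x := x)) => V f a ax nV.
  apply: locally_ret => W h.
  have ax' := fib_stable h ax; rewrite -res_comp in ax'.
  have [qa|aq] := ltP (ratr q) (c a); [left|right]; apply/(step_subP _ ax'); right => //.
  by apply: le_lt_trans aq _; rewrite ltr_rat.
Defined.

Lemma step_rmapP : cut_values step_rmap c.
Proof. by move=> U p a ap q; split; exact: (step_subP _ ap). Qed.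

End Step.

Definition step e (c : arrow B -> R[i]) : cmap (fib e) :=
  Cmap (step_rmap e (fun a => complex.Re (c a))) (step_rmap e (fun a => complex.Im (c a))).

Lemma stepP e c : values (step e c) c.
Proof.
have := cut_values_cmap (@step_rmapP e (fun a => complex.Re (c a)))
  (@step_rmapP e (fun a => complex.Im (c a))).
by rewrite /values => H U x b a ab; have := H U x b a ab; case: (c a).
Qed.

(** Along an arrow, membership in [lower q] or [upper q] is all or nothing. At a fixed nondegenerate
    point [p0] the internal cut is thus an ordinary cut of rationals, and its supremum is the value.
    If [a] has no nondegenerate point over [e], any value will do and 0 is taken. *)
Lemma rmap_values e (r : rmap (fib e)) : exists c, cut_values r c.
Proof.
suff H a : exists y : R, forall U (p : fib e U), a U (p.2, sval p.1) -> forall q,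
    (lower r q U p <-> forced_false U \/ ratr q < y) /\
    (upper r q U p <-> forced_false U \/ y < ratr q).
  by have [c cP] := choice H; exists c => U p a; exact: cP.
have [[U0 [p0 [ap0 nU0]]]|nex] :=
    pselect (exists U (p : fib e U), a U (p.2, sval p.1) /\ ~ forced_false U); last first.
  exists 0 => U p ap q; have dU : forced_false U.
    by apply: contrapT => nU; apply: nex; exists U, p.
  by split; (split=> [_|_]; [by left|exact: sub_degenerate]).
(* [arrow_transfer] speaks of pairs of sections of [B], while a point of [fib e] also carries a
   proof that its base lies in [e]; this proof is quantified inside the transferred property. *)
have transfer (S : subobject (fib e)) U (p : fib e U) V (p' : fib e V) :
    ~ forced_false U -> a U (p.2, sval p.1) -> a V (p'.2, sval p'.1) -> S U p -> S V p'.
  move=> nU; case: p p' => [[x ex] b] [[x' ex'] b'] /= ab ab' Sp.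
  have [|||ex'' S'] := @arrow_transfer _ _ a U b x nU ab
    (fun W t s => exists es : carrier e W s, S W (exist _ s es, t)) _ _ _ V b' x' ab'.
  - move=> W W' f t s [es Ss]; exists (@sub_stable C B (carrier e) W W' f s es).
    have := @sub_stable C (fib e) S W W' f (exist _ s es, t) Ss.
    by rewrite /= /prod_res /=; congr (S W' (_, _)); exact: sig_ext.
  - move=> W t s H.
    have es : carrier e W s by apply: sub_local; apply: locally_mono H => W' f [].
    exists es; apply: sub_local; apply: locally_mono H => W' f [es' Ss].
    by rewrite /= /prod_res /=; congr (S W' (_, _)): Ss; apply: sig_ext.
  - by exists ex.
  - by move: S'; congr (S V (_, _)); apply: sig_ext.
pose L q := lower r q U0 p0; pose P q := upper r q U0 p0.
have disj q : L q -> P q -> False by move=> Lq /(cut_disjoint Lq).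
(* Existence that is only local at [p0] descends to [p0]: the later point lies in the same arrow,
   and [transfer] leads back. *)
have at_p0 (S : rat -> subobject (fib e)) (lt : rat -> Prop) :
    locally (fun V (f : mor V U0) => exists q, lt q /\ S q V (res f p0)) ->
    exists q, lt q /\ S q U0 p0.
  move=> /(locally_nondeg nU0)[V [f [[q [ltq Sq]] nV]]]; exists q; split=> //.
  exact: (transfer (S q) V (res f p0) U0 p0 nV (fib_stable f ap0) ap0 Sq).
have [l0 Ll0] : exists q, L q.
  have [|q [_ Lq]] := at_p0 (lower r) (fun _ => True); last by exists q.
  by apply: locally_mono (@lower_inhabited _ _ r _ p0) => V f [q Lq]; exists q.
have [m0 Pm0] : exists q, P q.
  have [|q [_ Lq]] := at_p0 (upper r) (fun _ => True); last by exists q.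
  by apply: locally_mono (@upper_inhabited _ _ r _ p0) => V f [q Lq]; exists q.
have LR q : L q -> exists s, q < s /\ L s by move=> /lower_rounded/at_p0.
have PR q : P q -> exists s, s < q /\ P s by move=> /upper_rounded/(at_p0 _ (fun s => s < q)).
have Ldown q s : q < s -> L s -> L q.
  move=> qs Ls; apply/lower_rounded; apply: locally_ret => V f; exists s; split=> //.
  exact: sub_stable.
have LP q s : L q -> P s -> q < s.
  move=> Lq Ps; rewrite ltNge; apply/negP; rewrite le_eqVlt => /orP[/eqP sq|sq].
    by apply: (disj q Lq); rewrite -sq.
  by apply: (disj s) => //; exact: Ldown sq Lq.
have loc q s : q < s -> L q \/ P s.
  move=> qs; have := @cut_located _ _ r q s U0 p0 qs.
  move=> /(locally_nondeg nU0)[V [f [H nV]]]; case: H => [H|H]; [left|right].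
    exact: (transfer _ V (res f p0) U0 p0 nV (fib_stable f ap0) ap0 H).
  exact: (transfer _ V (res f p0) U0 p0 nV (fib_stable f ap0) ap0 H).
pose A : set R := [set ratr q | q in L].
have hsA : has_sup A.
  split; first by exists (ratr l0), l0.
  exists (ratr m0) => _ [q Lq <-]; rewrite ler_rat; apply/ltW; exact: LP.
have LE q : L q <-> ratr q < sup A.
  split=> [/LR[s [qs Ls]]|/(sup_gt hsA.1)[_ [s Ls <-]]].
    apply: (@lt_le_trans _ _ (ratr s)); first by rewrite ltr_rat.
    by apply: sup_ubound; [exact: hsA.2|exists s].
  by rewrite ltr_rat => /Ldown; exact.
have PE q : P q <-> sup A < ratr q.
  split=> [/PR[s [qs Ps]]|/rat_between[s /andP[As sq]]].
    apply: (@le_lt_trans _ _ (ratr s)); last by rewrite ltr_rat.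
    by apply: ge_sup; [exact: hsA.1|move=> _ [t Lt <-]; rewrite ler_rat; apply/ltW; exact: LP].
  move: sq; rewrite ltr_rat => /loc[/LE|//].
  by move=> /(lt_trans As); rewrite ltxx.
exists (sup A) => U p ap q; split.
  rewrite -LE; split=> [H|[dU|H]].
  - have [|nU] := pselect (forced_false U); first by left.
    by right; exact: (transfer (lower r q) U p U0 p0 nU ap ap0 H).
  - exact: sub_degenerate.
  - exact: (transfer (lower r q) U0 p0 U p nU0 ap0 ap H).
rewrite -PE; split=> [H|[dU|H]].
- have [|nU] := pselect (forced_false U); first by left.
  by right; exact: (transfer (upper r q) U p U0 p0 nU ap ap0 H).
- exact: sub_degenerate.
- exact: (transfer (upper r q) U0 p0 U p nU0 ap0 ap H).
Qed.

Lemma cmap_values e (u : cmap (fib e)) : exists c, values u c.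
Proof.
case: u => r i; have [c rc] := rmap_values r; have [d id] := rmap_values i.
by exists (fun a => (c a +i* d a)%C); exact: cut_values_cmap.
Qed.

End Families.

(** * Internal scalar products as weighted sums over arrows *)

Section InnerProducts.
Variables (R : realType) (C : site) (B : sheaf C).
Hypotheses (hT : atomic_topos C) (hfin : locally_finite B).
Implicit Types (g a e : arrow B).

Definition union_family U n (s : 'I_n -> B U) m (t : 'I_m -> B U) (i : 'I_(n + m)) : B U :=
  match fintype.split i with inl j => s j | inr j => t j end.

Definition covered U (P : forall V, mor V U -> B V -> Prop) n (t : 'I_n -> B U) :=
  forall V f s, P V f s ->
     locally (fun W (h : mor W V) => exists i, res h s = res (f \c h) (t i)).

Lemma fiber_enum g U (x : B U) : carrier (src g) U x ->
  locally (fun V (f : mor V U) => exists t : 'I_(lcard g) -> B V,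
    enumerates (lfib g (res f x)) t).
Proof.
move=> gx; apply: locally_mono (lcardP hfin gx) => V f [t [tP dt Pt]].
exists t; split=> //.
- by move=> i W h; have := tP i W h; rewrite /lfib res_comp.
- by move=> W h s; rewrite /lfib -res_comp => /Pt.
Qed.

(** A labelled enumeration of the disjoint union of the left fibres over [x] of the arrows in
    [A]. *)
Definition fibers_family (A : seq (arrow B)) U (x : B U) n (t : 'I_n -> B U) (l : 'I_n -> arrow B) :=
  [/\ internally_distinct t, forall i, l i U (t i, x), forall i, l i \in A &
      forall a, a \in A -> covered (lfib a x) t].

Lemma fibers_family_ex (A : seq (arrow B)) e U (x : B U) : uniq A ->
  (forall a, a \in A -> src a = e) -> carrier e U x ->
  locally (fun V (f : mor V U) => exists n (t : 'I_n -> B V) l, fibers_family A (res f x) t l).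
Proof.
move=> + + ex; elim: A => [|a A IH] /= uA Ae.
  apply: locally_ret => V f; exists 0%N.
  exists (fun i : 'I_0 => match i with Ordinal _ p => match notF p with end end).
  exists (fun i : 'I_0 => match i with Ordinal _ p => match notF p with end end).
  by split=> //; case.
have /andP[aA {}uA] := uA.
have {}IH := IH uA (fun b bA => Ae b (mem_behead (s := a :: A) bA)).
have ax : carrier (src a) U x by rewrite Ae // mem_head.
apply: locally_mono (locally_and (fiber_enum ax) IH) => V f.
move=> [[s [sP ds Ps]] [m [t [l [dt tl lA ct]]]]].
exists (lcard a + m)%N, (union_family s t).
exists (fun i => match fintype.split i with inl j => a | inr j => l j end).
have sa i : a V (s i, res f x) by have := sP i V (idc V); rewrite /lfib !res_id.
have sep i j W (h : mor W V) : res h (s i) = res h (t j) -> forced_false W.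
  move=> st; apply: contrapT => nW; move/negP: aA; apply.
  have := arrow_stable h (sa i); rewrite st => at_.
  by rewrite (arrow_eq nW at_ (arrow_stable h (tl j))).
split.
- move=> i j W h; rewrite -(can_eq (@splitK _ _)) /union_family.
  case: (fintype.split i) => i'; case: (fintype.split j) => j' ij.
  + by apply: ds; apply: contra_neq ij => ->.
  + exact: sep.
  + by move=> /esym; exact: sep.
  + by apply: dt; apply: contra_neq ij => ->.
- by move=> i; rewrite /union_family; case: fintype.split.
- by move=> i; case: fintype.split => j; rewrite in_cons ?eqxx // lA orbT.
- move=> b; rewrite in_cons => /orP[/eqP -> |/ct cb] W h z.
    move=> /Ps; apply: locally_mono => Z k [i ->].
    by exists (unsplit (inl i)); rewrite /union_family unsplitK.
  move=> /cb; apply: locally_mono => Z k [i ->].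
  by exists (unsplit (inr i)); rewrite /union_family unsplitK.
Qed.

Lemma sum_labels (S : nmodType) (A : seq (arrow B)) n (l : 'I_n -> arrow B) (F : arrow B -> S) :
  uniq A -> (forall i, l i \in A \/ F (l i) = 0) ->
  \sum_i F (l i) = \sum_(a <- A) F a *+ #|[pred i | l i == a]|.
Proof.
move=> uA lA.
transitivity (\sum_i \sum_(a <- A) F a *+ (l i == a)).
  apply: eq_bigr => i _; have [iA|iA] := boolP (l i \in A).
    rewrite (bigD1_seq (l i)) //= eqxx mulr1n big1 ?addr0 // => a.
    by rewrite eq_sym => /negbTE ->; rewrite mulr0n.
  have -> : F (l i) = 0 by case: (lA i) => // iA'; rewrite iA' in iA.
  rewrite big_seq big1 // => a aA; case: eqP => [la|]; last by rewrite mulr0n.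
  by rewrite la aA in iA.
rewrite exchange_big /=; apply: eq_bigr => a _.
rewrite -sum1_card -sumrMnr [RHS]big_mkcond /=; apply: eq_bigr => i _.
by rewrite inE; case: eqP.
Qed.

Lemma partial_inner_num e (u v : cmap (fib e)) (c d : arrow B -> R[i]) U (x : ucar e U) n (t : 'I_n -> B U)
    (l : 'I_n -> arrow B) : values u c -> values v d ->
  (forall i, l i U (t i, sval x)) ->
  num_at (partial_inner R u v x t) (\sum_i conjc (c (l i)) * d (l i)).
Proof.
move=> uc vd tl.
apply: (@num_at_capply R C U _ _ _ (fun jb : 'I_n * bool => if jb.2 then c (l jb.1) else d (l jb.1))).
  apply: box_continuous_sum => j; apply: box_continuousM.
    apply: box_continuous_conj; exact: (box_continuous_proj (j, true)).
  exact: (box_continuous_proj (j, false)).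
by move=> [j [|]] /=; [exact: uc|exact: vd].
Qed.

Lemma partial_inner_res e (u v : cmap (fib e)) U (x : ucar e U) n (t : 'I_n -> B U)
    V W (f : mor V U) (h : mor W V) D :
  partial_inner R u v x t (f \c h) D <-> partial_inner R u v (res f x) (fun i => res f (t i)) h D.
Proof.
rewrite /partial_inner /capply.
split=> H; apply: locally_mono H => Z k [E [cE EF]]; exists E; split=> // jb.
  have := cE jb; rewrite -Defs.compA.
  by rewrite (@cmap_at_res C (fib e) _ U V Z f (h \c k) (x, t jb.1)).
rewrite -Defs.compA (@cmap_at_res C (fib e) _ U V Z f (h \c k) (x, t jb.1)).
exact: cE.
Qed.

Lemma cnear_partial_res e (u v : cmap (fib e)) U (x : ucar e U) n (t : 'I_n -> B U) (z : R[i]) (eps : R) :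
  locally (fun V (f : mor V U) => cnear (partial_inner R u v (res f x) (fun i => res f (t i))) z eps) ->
  cnear (partial_inner R u v x t) z eps.
Proof.
move=> H; apply: (locally_bind H) => V f; apply: locally_mono => W h [D [cD DP]].
by exists D; split=> //; apply/partial_inner_res.
Qed.

(** The scalar product of the l^2 space of arrows with weight [lcard], cut off to [A]: the left
    fibre of [a] contributes [lcard a] equal terms. *)
Definition wsum (A : seq (arrow B)) (c d : arrow B -> R[i]) : R[i] :=
  \sum_(a <- A) conjc (c a) * d a * (lcard a)%:R.

Lemma fibers_family_sum A e U (x : B U) n (t : 'I_n -> B U) (l : 'I_n -> arrow B)
    (c d : arrow B -> R[i]) :
  ~ forced_false U -> uniq A -> (forall a, a \in A -> src a = e) -> carrier e U x ->
  internally_distinct t -> (forall i, l i U (t i, x)) ->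
  (forall a, a \in A -> covered (lfib a x) t) ->
  (forall i, l i \in A \/ conjc (c (l i)) * d (l i) = 0) ->
  \sum_i conjc (c (l i)) * d (l i) = wsum A c d.
Proof.
move=> nU uA Ae ex dt tl cov lA.
rewrite (sum_labels (F := fun a => conjc (c a) * d a) uA lA).
rewrite /wsum [LHS]big_seq [RHS]big_seq; apply: eq_bigr => a aA.
rewrite (@lcard_filter _ _ hfin a U x n t l) ?mulr_natr //; last exact: cov.
by rewrite Ae.
Qed.

(** Let [s] enumerate the fibres of the arrows in [A]. A finite family [t] containing [s] has
    further members only along arrows where the product vanishes, so its partial sum is exactly
    [wsum A c d]. *)
Lemma has_inner_values e (u v : cmap (fib e)) (c d : arrow B -> R[i]) A :
  values u c -> values v d -> uniq A -> (forall a, a \in A -> src a = e) ->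
  (forall a, src a = e -> a \notin A -> conjc (c a) * d a = 0) ->
  has_inner u v (wsum A c d).
Proof.
move=> uc vd uA Ae cdA eps e0 U x.
apply: locally_mono (fibers_family_ex uA Ae (svalP x)) => V f [n [s [l [ds sl lA cs]]]].
exists n, s => W h m t dt st; apply: cnear_partial_res.
have := label_family hT (fun i => (t i, sval (res (f \c h) x))).
apply: locally_mono => Z k [l' /= tl']; have [dZ|nZ] := pselect (forced_false Z).
  exact: degenerate_locally.
apply: cnear_num => //.
rewrite -(@fibers_family_sum A e Z (res k (sval (res (f \c h) x))) m
  (fun i => res k (t i)) l' c d nZ uA Ae) //.
- by apply: partial_inner_num.
- exact: (sub_stable k (svalP (res (f \c h) x))).
- exact: distinct_res.
- move=> a aA; have csa := cs a aA.
  move=> Y j z; rewrite /lfib -res_comp => az.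
  have : lfib a (res f (sval x)) (h \c k \c j) z.
    by rewrite /lfib -res_comp !Defs.compA; move: az; rewrite /= -res_comp !Defs.compA.
  move=> /csa H; apply: (locally_bind H) => Y' j' [i zE].
  have := locally_pull (k \c j \c j') (st i); apply: locally_mono => Y'' j'' [i' iE].
  exists i'; rewrite res_comp zE -!res_comp !Defs.compA.
  by rewrite !Defs.compA in iE; rewrite iE.
- move=> i; have [iA|iA] := boolP (l' i \in A); first by left.
  right; apply: cdA => //.
  apply: (src_eq nZ _ (tl' i)).
  exact: (sub_stable k (svalP (res (f \c h) x))).
Qed.

(** Let [s] be a finite family beyond which all partial sums are within [eps] of [z], and [A] the
    set of its labels. Completing [s] to the full fibres of [A] keeps the estimate and makes the
    partial sum equal to [wsum A c c]. *)
Lemma l2_approx e (u : cmap (fib e)) (c : arrow B -> R[i]) z (eps : R) : values u c -> units e ->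
  has_inner u u z -> 0 < eps ->
  exists A, [/\ uniq A, forall a, a \in A -> src a = e & `|wsum A c c - z| < eps%:C%C].
Proof.
move=> uc ue uz e0; have [U [x0 [nU ex]]] := unit_nondeg ue.
pose x : ucar e U := exist _ x0 ex.
have [V [f [[n [s sP]] nV]]] := locally_nondeg nU (uz eps e0 U x).
have := label_family hT (fun i => (s i, sval (res f x))).
move=> /(locally_nondeg nV)[W [h [[l /= sl] nW]]].
have exW : carrier e W (res h (res f x0)) by apply: sub_stable; apply: sub_stable.
pose A := undup (codom l).
have uA : uniq A by exact: undup_uniq.
have Ae a : a \in A -> src a = e.
  rewrite mem_undup => /codomP[i ->]; exact: (src_eq nW exW (sl i)).
exists A; split=> //.
have [Z [k [[m [t [l' [dt tl lA ct]]]] nZ]]] := locally_nondeg nW (fibers_family_ex uA Ae exW).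
have exZ : carrier e Z (res k (res h (res f x0))) by apply: sub_stable.
have tl' i : l' i Z (t i, sval (res (f \c (h \c k)) x)) by rewrite /= !res_comp.
have near := sP Z (h \c k) m t dt.
rewrite -(@fibers_family_sum A e Z _ m t l' c c nZ uA Ae exZ dt tl ct) ?(fun i => or_introl (lA i)) //.
  apply: (cnear_dist nZ (partial_inner_num uc uc tl')); apply: near => i.
  have si : l i Z (res (h \c k) (s i), res k (res h (res f x0))).
    by rewrite res_comp; exact: (arrow_stable k (sl i)).
  have iA : l i \in A by rewrite mem_undup; apply: codom_f.
  have := ct _ iA Z (idc Z) (res (h \c k) (s i)); rewrite /lfib res_id => /(_ si).
  by apply: locally_mono => Y j [i' iE]; exists i'; rewrite res_comp iE comp_idl.
by move=> i; left.
Qed.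

(** For [(b, x)] in [a], summing the indicator of [g] over the [y] with [y h x] counts those that
    also satisfy [b g y], i.e. the middle points. *)
Lemma right_action_values g (h : arrow B) (v : cmap (fib (tgt h))) (w : cmap (fib (src h))) :
  values v (bvec R[i] g) -> values w (fun a => (binom g h a)%:R : R[i]) ->
  is_right_action R h v w.
Proof.
move=> vg wd U x b; apply: locally_assuming_nondeg => nU.
have hx : carrier (src h) U (sval x) := svalP x.
apply: (locally_bind (fiber_enum hx)) => V f [t tP].
have th i : h V (t i, res f (sval x)) by case: tP => /(_ i V (idc V)); rewrite /lfib !res_id.
pose t' i : ucar (tgt h) V := exist _ (t i) (in_tgt (th i)).
have := locally_and (arrow_cover hT (res f b) (res f (sval x)))
  (label_family hT (fun i => (res f b, t i))).
move=> H; apply: (locally_bind H) => W k [[a ab] [l /= tl]].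
apply: locally_ret => Z j.
pose q := k \c j.
exists (lcard h), (fun i => res q (t' i)); split.
  have := enumerates_res q tP => -[tP' dt' Pt']; split.
  - by move=> i Y y; have := tP' i Y y; rewrite /pshift /lfib /= /q !res_comp.
  - by move=> i i' Y y ii' E; apply: (dt' i i' Y y ii'); have := congr1 sval E.
  - move=> Y y s Hs; have := Pt' Y y (sval s).
    rewrite /pshift /lfib => /(_ _)H'.
    have {}H' := H' ltac:(by move: Hs; rewrite /= /q !res_comp).
    apply: locally_mono H' => Y' y' [i E]; exists i; exact: sig_ext.
have [dZ|nZ] := pselect (forced_false Z).
  move=> Y y D; have dY := degenerate_pull y dZ; split=> _; first exact: degenerate_locally.
  by split; exact: sub_degenerate.
apply: (@num_at_eq _ _ _ _ _ (binom g h a)%:R).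
  apply: wd; have := arrow_stable j ab.
  by rewrite /= /q !res_comp.
have tPZ : enumerates (lfib h (res (f \c q) (sval x))) (fun i => res q (t i)).
  have := enumerates_res q tP => -[tP' dt' Pt']; split=> //.
  - by move=> i Y y; have := tP' i Y y; rewrite /pshift /lfib /= !res_comp.
  - by move=> Y y s Hs; apply: Pt'; move: Hs; rewrite /pshift /lfib !res_comp.
have abZ : a Z (res (f \c q) b, res (f \c q) (sval x)).
  by have := arrow_stable j ab; rewrite /q !res_comp.
have tlZ i : l i Z (res (f \c q) b, res q (t i)).
  by have := arrow_stable j (tl i); rewrite /q !res_comp.
rewrite (@binom_left _ _ hT hfin g h a Z _ _ _ _ l nZ abZ tPZ tlZ).
have -> : #|[pred i | l i == g]|%:R = \sum_i bvec R[i] g (l i) :> R[i].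
  rewrite -sum1_card natr_sum big_mkcond /=; apply: eq_bigr => i _.
  by rewrite inE /bvec; case: eqP.
apply: (@num_at_capply R C Z _ _ _ (fun i => bvec R[i] g (l i))).
  apply: box_continuous_sum => i; exact: box_continuous_proj.
by move=> i; apply: vg; exact: tlZ.
Qed.

(** For [x] in the unit [e], a pair [(b, x)] is diagonal exactly when it lies in [e]; so the delta
    function at [x] is the indicator of [e]. *)
Lemma delta_values e (u : cmap (fib e)) : units e ->
  is_delta R u <-> values u (bvec R[i] e).
Proof.
move=> ue; split=> [du U x b a ab|uv U x b].
  have [d1 d0] := du U x b; rewrite /bvec; case: eqP => [ae|nae].
    by apply/num_at_cconstP; apply: d1; move: ab; rewrite ae => /ue ->.
  apply/num_at_cconstP; apply: d0 => V f xb; apply: contrapT => nV; apply: nae.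
  have abV := arrow_stable f ab; rewrite -xb in abV.
  exact: (arrow_eq nV abV (sub_stable f (svalP x))).
split=> H; apply/num_at_cconstP.
  by have := uv U x b e; rewrite /bvec eqxx; apply; rewrite -H; exact: svalP x.
apply: num_at_cmap_local.
apply: locally_mono (arrow_cover hT b (sval x)) => V f [a ab].
have [dV|nV] := pselect (forced_false V).
  move=> W h D; have dW := degenerate_pull h dV; split=> _; first by left.
  by split; exact: sub_degenerate.
have := uv V (res f x) (res f b) a ab; rewrite /bvec; case: eqP => // ae.
by case: nV; apply: (H V f); move: ab; rewrite ae => /ue ->.
Qed.

Lemma lcard_unit e : units e -> lcard e = 1%N.
Proof.
move=> ue; have [U [x [nU ex]]] := unit_nondeg ue.
have ex' : carrier (src e) U x by rewrite src_unitE.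
apply: (internal_card_inj nU (lcardP hfin ex')).
apply: (internal_card_enum (t := fun i : 'I_1 => x)); split.
- by move=> _ V f; exact: (sub_stable f ex).
- by move=> i j; rewrite !ord1 eqxx.
- by move=> V f s /ue ->; apply: locally_ret => W h; exists ord0; rewrite res_comp.
Qed.

End InnerProducts.

(** * Hilbert spaces *)

Lemma le_eps_mul_eq0 (R : realFieldType) (r M : R) : 0 <= r ->
  (forall eps : R, 0 < eps -> eps <= 1 -> r <= eps * M) -> r = 0.
Proof.
move=> r0 rM; apply/eqP; rewrite eq_le r0 andbT leNgt; apply/negP => x0.
have M0 : 0 <= M by have := rM 1 ltr01 (lexx _); rewrite mul1r; apply: le_trans.
(* Chosen so that [eps * M] is at most [r / 2]; [M + 1] keeps the denominator positive. *)
pose eps := Num.min 1 (r / (2 * (M + 1))).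
have p0 : 0 < 2 * (M + 1) by rewrite mulr_gt0 // ltr_pwDr.
have e0 : 0 < eps by rewrite lt_min ltr01 divr_gt0.
have e1 : eps <= 1 by rewrite ge_min lexx.
have := rM eps e0 e1; rewrite leNgt => /negP; apply.
have e2 : eps * (2 * (M + 1)) <= r.
  by rewrite -ler_pdivlMr // ge_min lexx orbT.
have : eps * M <= eps * (M + 1) by rewrite ler_pM2l // lerDl.
nra.
Qed.

Section HilbertSpaces.
Variables (R : realType) (H : hilbert R).
Implicit Types (x y z : H).

Lemma ipDr x y z : ip x (y + z) = ip x y + ip x z.
Proof. by rewrite -[y in LHS]scale1r ip_linear mul1r. Qed.
Lemma ip0r x : ip x 0 = 0.
Proof. by apply: (addIr (ip x 0)); rewrite -ipDr addr0 add0r. Qed.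
Lemma ipZr k x y : ip x (k *: y) = k * ip x y.
Proof. by rewrite -[k *: y]addr0 ip_linear ip0r addr0. Qed.
Lemma ipNr x y : ip x (- y) = - ip x y.
Proof. by rewrite -scaleN1r ipZr mulN1r. Qed.
Lemma ipBr x y z : ip x (y - z) = ip x y - ip x z.
Proof. by rewrite ipDr ipNr. Qed.
Lemma ipDl x y z : ip (y + z) x = ip y x + ip z x.
Proof. by rewrite !(ip_conj x) ipDr rmorphD. Qed.
Lemma ip0l x : ip 0 x = 0.
Proof. by rewrite ip_conj ip0r conjc0. Qed.
Lemma ipZl k x y : ip (k *: y) x = conjc k * ip y x.
Proof. by rewrite !(ip_conj x) ipZr rmorphM. Qed.
Lemma ipNl x y : ip (- y) x = - ip y x.
Proof. by rewrite !(ip_conj x) ipNr rmorphN. Qed.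
Lemma ipBl x y z : ip (y - z) x = ip y x - ip z x.
Proof. by rewrite ipDl ipNl. Qed.
Lemma ip_sumr x (I : Type) (s : seq I) (F : I -> H) :
  ip x (\sum_(i <- s) F i) = \sum_(i <- s) ip x (F i).
Proof. by elim: s => [|i s IH]; rewrite ?big_nil ?ip0r // !big_cons ipDr IH. Qed.
Lemma ip_suml x (I : Type) (s : seq I) (F : I -> H) :
  ip (\sum_(i <- s) F i) x = \sum_(i <- s) ip (F i) x.
Proof. by elim: s => [|i s IH]; rewrite ?big_nil ?ip0l // !big_cons ipDl IH. Qed.

Lemma hnorm_ge0 x : 0 <= hnorm x.
Proof. exact: sqrtr_ge0. Qed.

Lemma Re_ge0 (z : R[i]) : 0 <= z -> 0 <= complex.Re z.
Proof. by rewrite lecE => /andP[]. Qed.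

Lemma hnorm_sqr x : (hnorm x ^+ 2)%:C%C = ip x x.
Proof.
have := ip_ge0 x; rewrite lecE /hnorm => /andP[/eqP i0 r0].
rewrite sqr_sqrtr //; move: i0 => /=.
by case: (ip x x) => a b /= ->.
Qed.

Lemma hnorm_eq0 x : hnorm x = 0 -> x = 0.
Proof. by move=> x0; apply: ip_def; rewrite -hnorm_sqr x0 expr0n. Qed.

Lemma hnorm0 : hnorm (0 : H) = 0.
Proof. by rewrite /hnorm ip0r sqrtr0. Qed.

Lemma mulc_conj (z : R[i]) : conjc z * z = `|z| ^+ 2.
Proof.
rewrite -add_Re2_Im2; case: z => a b; apply/eqP; rewrite eq_complex /=.
by apply/andP; split; apply/eqP; ring.
Qed.

Lemma cauchy_schwarz x y : `|ip x y| <= (hnorm x * hnorm y)%:C%C.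
Proof.
have [/hnorm_eq0 ->|y0] := eqVneq (hnorm y) 0; first by rewrite ip0r normr0 hnorm0 mulr0.
have b0 : 0 < ip y y by rewrite -hnorm_sqr ltcR exprn_gt0 // lt_def y0 hnorm_ge0.
(* This vector is [ip y y] times the component of [x] orthogonal to [y]; the scaling avoids a
   division. *)
have := ip_ge0 (ip y y *: x - ip y x *: y).
rewrite ipBl !ipBr !ipZl !ipZr.
have -> : conjc (ip y y) = ip y y by rewrite -ip_conj.
have -> : conjc (ip y x) = ip x y by rewrite -ip_conj.
rewrite [X in 0 <= X](_ : _ = ip y y * (ip x x * ip y y - ip y x * ip x y)); last by ring.
rewrite pmulr_rge0 // subr_ge0 [ip y x]ip_conj mulc_conj -!hnorm_sqr -rmorphM.
rewrite -exprMn rmorphXn /= ler_sqr ?nnegrE //.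
by rewrite ler0c mulr_ge0 ?hnorm_ge0.
Qed.

Lemma Re_le_norm (z : R[i]) (r : R) : `|z| <= r%:C%C -> complex.Re z <= r.
Proof.
rewrite normc_def lecR => /(le_trans _); apply.
apply: (le_trans (ler_norm _)); rewrite -sqrtr_sqr ler_sqrt ?addr_ge0 ?sqr_ge0 //.
by rewrite lerDl sqr_ge0.
Qed.

Lemma hnorm_add x y : hnorm (x + y) <= hnorm x + hnorm y.
Proof.
rewrite -(ler_sqr (R := R)) ?nnegrE ?addr_ge0 ?hnorm_ge0 //.
have E : hnorm (x + y) ^+ 2 = hnorm x ^+ 2 + complex.Re (ip x y) *+ 2 + hnorm y ^+ 2.
  apply: complexI; rewrite hnorm_sqr !ipDl !ipDr [ip y x]ip_conj -!hnorm_sqr.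
  rewrite !rmorphD /=.
  by case: (ip x y) => a b; apply/eqP; rewrite eq_complex /=; apply/andP; split; apply/eqP; ring.
rewrite E sqrrD lerD2r lerD2l lerMn2r /=; exact: Re_le_norm (cauchy_schwarz x y).
Qed.

Lemma hnorm_scale (k : R[i]) x : (hnorm (k *: x))%:C%C = `|k| * (hnorm x)%:C%C.
Proof.
apply: (@pexpIrn _ 2) => //; rewrite ?nnegrE ?ler0c ?hnorm_ge0 //; first by rewrite mulr_ge0 ?normr_ge0 ?ler0c ?hnorm_ge0.
have sq y : (hnorm y)%:C%C ^+ 2 = ip y y by rewrite -hnorm_sqr rmorphXn.
by rewrite sq exprMn sq ipZl ipZr mulrA mulc_conj.
Qed.

Lemma hnorm_opp x : hnorm (- x) = hnorm x.
Proof. by rewrite /hnorm ipNl ipNr opprK. Qed.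

Lemma hnorm_sub x y : hnorm (x - y) = hnorm (y - x).
Proof. by rewrite -opprB hnorm_opp. Qed.

Lemma hnorm_trans x y z : hnorm (x - z) <= hnorm (x - y) + hnorm (y - z).
Proof. by apply: le_trans (hnorm_add _ _); rewrite addrA subrK. Qed.

Lemma hnorm_sum (I : Type) (s : seq I) (F : I -> H) :
  hnorm (\sum_(i <- s) F i) <= \sum_(i <- s) hnorm (F i).
Proof.
elim: s => [|i s IH]; first by rewrite !big_nil hnorm0.
by rewrite !big_cons; apply: (le_trans (hnorm_add _ _)); rewrite lerD2l.
Qed.

Lemma hnorm_le0 x (M : R) :
  (forall eps : R, 0 < eps -> eps <= 1 -> hnorm x <= eps * M) -> x = 0.
Proof. by move=> xM; apply: hnorm_eq0; exact: le_eps_mul_eq0 (hnorm_ge0 x) xM. Qed.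

Lemma complex_le0 (z : R[i]) (M : R) :
  (forall eps : R, 0 < eps -> eps <= 1 -> `|z| <= (eps * M)%:C%C) -> z = 0.
Proof.
move=> xM; apply/eqP; rewrite -normr_eq0; move: xM; rewrite !normc_def.
set r := Num.sqrt _ => xM.
rewrite (@le_eps_mul_eq0 R r M) ?sqrtr_ge0 // => eps e0 e1.
by rewrite -lecR; exact: xM.
Qed.

Lemma ip_near x x' y y' (eps : R) : 0 < eps -> eps <= 1 ->
  hnorm (x - x') < eps -> hnorm (y - y') < eps ->
  `|ip x y - ip x' y'| <= (eps * (hnorm x + hnorm y + 1))%:C%C.
Proof.
move=> e0 e1 xx yy.
have -> : ip x y - ip x' y' = ip (x - x') y + (ip x (y - y') - ip (x - x') (y - y')).
  by rewrite !ipBl !ipBr; ring.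
apply: (le_trans (ler_normD _ _)).
apply: (@le_trans _ _ ((hnorm (x - x') * hnorm y)%:C%C + ((hnorm x * hnorm (y - y'))%:C%C +
   (hnorm (x - x') * hnorm (y - y'))%:C%C))).
  apply: lerD; first exact: cauchy_schwarz.
  by apply: (le_trans (ler_normB _ _)); apply: lerD; exact: cauchy_schwarz.
rewrite -!rmorphD lecR.
have := hnorm_ge0 x; have := hnorm_ge0 y; have := hnorm_ge0 (x - x'); have := hnorm_ge0 (y - y').
move: (hnorm _) (hnorm _) (hnorm _) (hnorm _) xx yy => a b c d ac bc; nra.
Qed.

End HilbertSpaces.

(** * Extension of isometries from dense families *)

Section DenseIsometry.
Variables (R : realType).

(** The squared norm of [Q (k *: x + y) - k *: Q x - Q y] expands into scalar products, which [Q]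
    preserves; without [Q] the same expansion gives 0. *)
Lemma isometry_linear (K H : hilbert R) (Q : K -> H) :
  (forall x y, ip (Q x) (Q y) = ip x y) ->
  forall (k : R[i]) x y, Q (k *: x + y) = k *: Q x + Q y.
Proof.
move=> Qip k x y; apply/eqP; rewrite -subr_eq0; apply/eqP; apply: ip_def.
have : ip (k *: x + y - (k *: x + y)) (k *: x + y - (k *: x + y)) = 0 by rewrite subrr ip0r.
rewrite !(ipBl, ipBr, ipDl, ipDr, ipZl, ipZr) => <-.
rewrite !Qip !(ipDl, ipDr, ipZl, ipZr); ring.
Qed.

Lemma isometry_inj (K H : hilbert R) (Q : K -> H) :
  (forall x y, ip (Q x) (Q y) = ip x y) -> injective Q.
Proof.
move=> Qip x y xy; apply/eqP; rewrite -subr_eq0; apply/eqP; apply: ip_def.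
by rewrite !(ipBl, ipBr) -!Qip xy !subrr.
Qed.

Section Extension.
Variables (T : Type) (D : T -> Prop).

Definition limit_pair (K H : hilbert R) (f : T -> K) (f' : T -> H) (x : K) (l : H) : Prop :=
  forall eps : R, 0 < eps -> exists a, [/\ D a, hnorm (x - f a) < eps & hnorm (l - f' a) < eps].

(** Approximants of [x] with error [1 / (n + 1)] have images under [f'] with the same mutual
    distances, hence a Cauchy sequence. *)
Lemma limit_pair_ex (K H : hilbert R) (f : T -> K) (f' : T -> H) :
  (forall a b, D a -> D b -> ip (f a) (f b) = ip (f' a) (f' b)) ->
  (forall (x : K) (eps : R), 0 < eps -> exists a, D a /\ hnorm (x - f a) < eps) ->
  forall x, exists l, limit_pair f f' x l.
Proof.
move=> ff' fd x.
have inv0 n : 0 < (n.+1%:R : R)^-1 by rewrite invr_gt0 ltr0n.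
have [a aP] := choice (fun n => fd x _ (inv0 n)).
have inv_small (eps : R) : 0 < eps -> exists N, forall n, (N <= n)%N -> (n.+1%:R : R)^-1 < eps.
  move=> e0; exists (Num.truncn eps^-1) => n Nn.
  rewrite invf_plt ?posrE ?ltr0n //.
  by apply: (lt_le_trans (truncnS_gt _)); rewrite ler_nat.
have normE m n : hnorm (f' (a m) - f' (a n)) = hnorm (f (a m) - f (a n)).
  have [[am _] [an _]] := (aP m, aP n).
  by rewrite /hnorm !(ipBl, ipBr) !ff'.
have [|l lP] := @hilbert_complete R H (fun n => f' (a n)).
  move=> eps e0; have [N NP] := inv_small _ (divr_gt0 e0 (ltr0n R 2)).
  exists N => m n Nm Nn; rewrite -/(hnorm _) normE.
  apply: (le_lt_trans (hnorm_trans _ x _)); rewrite hnorm_sub.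
  have [[_ xm] [_ xn]] := (aP m, aP n).
  have := lt_trans xm (NP m Nm); have := lt_trans xn (NP n Nn).
  by move=> h1 h2; rewrite [eps]splitr; exact: ltrD.
exists l => eps e0; have [N NP] := inv_small eps e0; have [N' NP'] := lP eps e0.
exists (a (maxn N N')); have [Da xa] := aP (maxn N N'); split=> //.
  by apply: (lt_trans xa); apply: NP; rewrite leq_maxl.
by rewrite hnorm_sub; apply: NP'; rewrite leq_maxr.
Qed.

Lemma limit_pair_sym (K H : hilbert R) (f : T -> K) (f' : T -> H) x l :
  limit_pair f f' x l -> limit_pair f' f l x.
Proof. by move=> H1 eps /H1[a []]; exists a. Qed.

(** Serves twice: it makes the extension isometric and, applied with [x = y], makes the limit
    unique. *)
Lemma limit_pair_ip (K H : hilbert R) (f : T -> K) (f' : T -> H) :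
  (forall a b, D a -> D b -> ip (f a) (f b) = ip (f' a) (f' b)) ->
  forall x l y m, limit_pair f f' x l -> limit_pair f f' y m -> ip x y = ip l m.
Proof.
move=> ff' x l y m xl ym; apply/eqP; rewrite -subr_eq0; apply/eqP.
apply: (@complex_le0 R _ (hnorm x + hnorm y + 1 + (hnorm l + hnorm m + 1))) => eps e0 e1.
have [a [Da xa la]] := xl eps e0; have [b [Db yb mb]] := ym eps e0.
have -> : ip x y - ip l m = (ip x y - ip (f a) (f b)) - (ip l m - ip (f' a) (f' b)).
  by rewrite ff' //; ring.
apply: (le_trans (ler_normB _ _)).
rewrite mulrDr rmorphD; apply: lerD; exact: ip_near.
Qed.

(* The isometry is the closure of the graph [{(f a, f' a)}]. *)
Lemma dense_isometry (K H : hilbert R) (f : T -> K) (f' : T -> H) :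
  (forall a b, D a -> D b -> ip (f a) (f b) = ip (f' a) (f' b)) ->
  (forall (x : K) (eps : R), 0 < eps -> exists a, D a /\ hnorm (x - f a) < eps) ->
  (forall (x : H) (eps : R), 0 < eps -> exists a, D a /\ hnorm (x - f' a) < eps) ->
  exists Q : K -> H, unitary Q /\ forall a, D a -> Q (f a) = f' a.
Proof.
move=> ff' fd fd'; have [Q QP] := choice (limit_pair_ex ff' fd).
have Qip x y : ip (Q x) (Q y) = ip x y by rewrite (limit_pair_ip ff' (QP x) (QP y)).
have Quniq x l : limit_pair f f' x l -> Q x = l.
  move=> xl; apply/eqP; rewrite -subr_eq0; apply/eqP; apply: ip_def.
  rewrite !(ipBl, ipBr) -(limit_pair_ip ff' (QP x) (QP x)) -(limit_pair_ip ff' xl xl).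
  by rewrite -(limit_pair_ip ff' (QP x) xl) -(limit_pair_ip ff' xl (QP x)) !subrr.
exists Q; split.
  split=> //; first exact: isometry_linear.
  move=> y; have [x xy] := limit_pair_ex (fun a b Da Db => esym (ff' a b Da Db)) fd' y.
  by exists x; apply: Quniq; exact: limit_pair_sym.
by move=> a Da; apply: Quniq => eps e0; exists a; rewrite !subrr !hnorm0.
Qed.

End Extension.

Lemma unitary_transport (K H : hilbert R) (Q : K -> H) (T : H -> H) : unitary Q ->
  bounded_op T -> exists T' : K -> K, bounded_op T' /\ forall x, Q (T' x) = T (Q x).
Proof.
move=> [Ql Qip Qs] [Tl [M TM]]; have [P PQ] := choice Qs.
have Qn x : hnorm (Q x) = hnorm x by rewrite /hnorm Qip.
exists (fun x => P (T (Q x))); split; last by move=> x; rewrite PQ.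
split; last by exists M => x; rewrite -Qn PQ -Qn.
move=> k x y; apply: (isometry_inj Qip).
by rewrite PQ !Ql !PQ Tl.
Qed.

End DenseIsometry.

(** * The algebra and its action *)

Section FiniteSupport.
Variables (C : site) (B : sheaf C).
Implicit Types (g h e : arrow B) (A : seq (arrow B)).

Lemma fsum_seq (V : nmodType) (T : choiceType) (A : seq T) (f : T -> V) : uniq A ->
  (forall i, i \notin A -> f i = 0) -> \sum_(i \in [set: T]) f i = \sum_(i <- A) f i.
Proof.
move=> uA fA; rewrite [RHS](@bigfs _ _ _ _ _ xpredT) //; last by move=> i _; exact: fA.
by congr (\sum_(i \in _) _); apply/seteqP.
Qed.

Lemma fsum_seq_in (V : nmodType) (T : choiceType) (D : set T) (A : seq T) (f : T -> V) : uniq A ->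
  (forall i, D i -> i \notin A -> f i = 0) ->
  \sum_(i \in D) f i = \sum_(i <- A | i \in D) f i.
Proof.
move=> uA fA; rewrite [RHS]bigfs //; last by move=> i; rewrite inE; exact: fA.
by rewrite set_mem_set.
Qed.

(** The list may be larger than the support, so that several elements can share one list. *)
Definition supported (K : pzRingType) A (a : arrow B -> K) : Prop :=
  uniq A /\ forall g, g \notin A -> a g = 0.

Lemma fin_supportedP (K : pzRingType) (a : arrow B -> K) :
  fin_supported a <-> exists A, supported A a.
Proof.
split=> [fa|[A [uA aA]]].
  exists (finmap.enum_fset (fset_set [set g | a g != 0])); split; first exact: finmap.fset_uniq.
  by move=> g; rewrite in_fset_set // notin_setE /= => /negP/negPn/eqP.
apply: (@sub_finite_set _ _ [set` A]); last exact: finite_seq.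
by move=> g /=; apply: contraNT => /aA ->.
Qed.

Lemma supported_widen (K : pzRingType) A A' (a : arrow B -> K) :
  supported A a -> uniq A' -> {subset A <= A'} -> supported A' a.
Proof. by move=> [uA aA] uA' AA'; split=> // g gA'; apply: aA; apply: contra gA'; exact: AA'. Qed.

Lemma supported_common (K : pzRingType) (a b : arrow B -> K) :
  fin_supported a -> fin_supported b -> exists A, supported A a /\ supported A b.
Proof.
move=> /fin_supportedP[A aA] /fin_supportedP[A' bA'].
exists (undup (A ++ A')); split; [apply: supported_widen aA _ _|apply: supported_widen bA' _ _];
  rewrite ?undup_uniq // => g; by rewrite mem_undup mem_cat => ->; rewrite ?orbT.
Qed.

Lemma bvec_supported (K : pzRingType) g : supported [:: g] (bvec K g).
Proof. by split=> // h; rewrite inE /bvec => /negbTE ->. Qed.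

Lemma fin_supported_bvec (K : pzRingType) g : fin_supported (bvec K g).
Proof. by apply/fin_supportedP; exists [:: g]; exact: bvec_supported. Qed.

Lemma fin_supported_lin (K : pzRingType) (k : K) (a b : arrow B -> K) :
  fin_supported a -> fin_supported b -> fin_supported (fun g => k * a g + b g).
Proof.
move=> fa fb; have [A [[uA aA] [_ bA]]] := supported_common fa fb.
by apply/fin_supportedP; exists A; split=> // g gA; rewrite aA // bA // mulr0 addr0.
Qed.

Lemma sum_bvec (K : pzRingType) A g (f : arrow B -> K) : uniq A -> (g \notin A -> f g = 0) ->
  \sum_(h <- A) f h * bvec K g h = f g.
Proof.
move=> uA fA; have [gA|gA] := boolP (g \in A).
  rewrite (bigD1_seq g) //= /bvec eqxx mulr1 big1 ?addr0 // => h /negbTE ->.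
  by rewrite mulr0.
rewrite fA // big_seq big1 // => h hA; rewrite /bvec; case: eqP => [hg|]; last by rewrite mulr0.
by rewrite -hg hA in gA.
Qed.

Hypotheses (hT : atomic_topos C) (hfin : locally_finite B).

Lemma amul_seq (K : pzRingType) (a b : arrow B -> K) A A' c : supported A a -> supported A' b ->
  amul a b c = \sum_(g <- A) \sum_(h <- A') a g * b h * (binom g h c)%:R.
Proof.
move=> [uA aA] [uA' bA']; rewrite /amul (@fsum_seq _ _ [seq (g, h) | g <- A, h <- A']).
- rewrite big_allpairs /=; apply: eq_bigr => g _; apply: eq_bigr => h _.
  by rewrite (struct_constE hT hfin).
- by apply: allpairs_uniq => // -[x y] [x' y'].
move=> [g h] gh /=; have [gA|gA] := boolP (g \in A); last by rewrite aA // !mul0r.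
have [hA|hA] := boolP (h \in A'); last by rewrite bA' // mulr0 mul0r.
by move/negP: gh; case; apply/allpairsP; exists (g, h).
Qed.

Lemma amul_supported (K : pzRingType) (a b : arrow B -> K) :
  fin_supported a -> fin_supported b -> fin_supported (amul a b).
Proof.
move=> /fin_supportedP[A aA] /fin_supportedP[A' bA'].
apply: (@sub_finite_set _ _ (\bigcup_(p in [set p | p \in [seq (g, h) | g <- A, h <- A']])
   [set c | binom p.1 p.2 c <> 0%N])).
  move=> c /= /eqP c0; apply: contrapT => nc; apply: c0.
  rewrite (amul_seq _ aA bA') big_seq big1 // => g gA; rewrite big_seq big1 // => h hA'.
  have [->|/eqP n0] := eqVneq (binom g h c) 0%N; first by rewrite mulr0.
  by case: nc; exists (g, h) => //=; apply/allpairsP; exists (g, h).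
apply: bigcup_finite; first exact: finite_seq.
by move=> [g h] _; exact: (binom_finite hT hfin).
Qed.

Lemma binom_unit_r g a e : units e -> binom g e a = (a == g) && (e == src g) :> nat.
Proof.
move=> ue; case: eqP => [->|nag] /=; last first.
  apply: contrapT => n0; have [U [x [y [nU axy]]]] := arrow_nondeg a.
  have [V [f [[s [gxs /ue sy]] nV]]] := locally_nondeg nU (binom_neq0 hT hfin axy n0).
  by apply: nag; apply: (arrow_eq nV (arrow_stable f axy)); rewrite -sy.
case: eqP => [->|ne]; last first.
  apply: contrapT => n0; have [E _ _] := binom_ends hT hfin n0.
  by apply: ne; rewrite E (tgt_unitE ue).
have [U [x [y [nU gxy]]]] := arrow_nondeg g.
apply: (internal_card_inj nU (binomP hT hfin g (src g) gxy)).
apply: (internal_card_enum (t := fun i : 'I_1 => y)); split.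
- move=> _ V f; split; first exact: arrow_stable.
  exact: (sub_stable f (in_src gxy)).
- by move=> i j; rewrite !ord1 eqxx.
- by move=> V f s [_ /src_unit ->]; apply: locally_ret => W h; exists ord0; rewrite res_comp.
Qed.

(** Reversing all arrows exchanges the two factors, which reduces the claim to [binom_unit_r]. *)
Lemma binom_unit_l g a e : units e -> binom e g a = (a == g) && (e == tgt g) :> nat.
Proof.
move=> ue; have -> : binom e g a = binom (star g) (star e) (star a).
  have [U [x [y [nU axy]]]] := arrow_nondeg a.
  apply: (internal_card_inj nU (binomP hT hfin e g axy)).
  have := @binomP _ _ hT hfin (star g) (star e) (star a) U y x axy.
  by apply: internal_card_ext => V f s; rewrite /mfib /=; split=> -[].
by rewrite (unit_star ue) (binom_unit_r _ _ ue) (inj_eq (@star_inj _ B)) src_star.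
Qed.

End FiniteSupport.

(** * The orthogonal basis of the l^2 representation *)

Section Representation.
Variables (R : realType) (C : site) (B : sheaf C).
Hypotheses (hT : atomic_topos C) (hfin : locally_finite B).
Variables (H : hilbert R) (L : l2_rep B H).
Implicit Types (g h e : arrow B) (A : seq (arrow B)) (a b : arrow B -> R[i]).

Definition vec g : H := l2_incl L (step hT (src g) (bvec R[i] g)).

Lemma values_inner e (u v : cmap (fib e)) (c d : arrow B -> R[i]) A :
  values u c -> values v d -> uniq A -> (forall g, g \in A -> src g = e) ->
  (forall g, src g = e -> g \notin A -> conjc (c g) * d g = 0) ->
  units e -> l2 R u -> l2 R v -> ip (l2_incl L u) (l2_incl L v) = wsum A c d.
Proof.
move=> uc vd uA Ae cdA ue lu lv; apply: iota_ip => //.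
exact: (has_inner_values hT hfin uc vd uA Ae cdA).
Qed.

Lemma values_l2 e (u : cmap (fib e)) (c : arrow B -> R[i]) A :
  values u c -> uniq A -> (forall g, g \in A -> src g = e) ->
  (forall g, src g = e -> g \notin A -> c g = 0) -> l2 R u.
Proof.
move=> uc uA Ae cA; exists (wsum A c c); apply: (has_inner_values hT hfin uc uc uA Ae).
by move=> g ge gA; rewrite cA // mulr0.
Qed.

Lemma vec_l2 g : l2 R (step hT (src g) (bvec R[i] g)).
Proof.
apply: (@values_l2 (src g) _ (bvec R[i] g) [:: g]) => //; first exact: stepP.
  by move=> h; rewrite inE => /eqP ->.
by move=> h _; exact: (bvec_supported R[i] g).2.
Qed.

Lemma ip_incl_vec e (u : cmap (fib e)) (c : arrow B -> R[i]) g :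
  values u c -> units e -> l2 R u -> src g = e ->
  ip (l2_incl L u) (vec g) = conjc (c g) * (lcard g)%:R.
Proof.
move=> uc ue lu ge; subst e.
rewrite (@values_inner _ _ _ c (bvec R[i] g) [:: g]) //; last exact: vec_l2.
- by rewrite /wsum big_seq1 /bvec eqxx mulr1.
- exact: stepP.
- by move=> h; rewrite inE => /eqP ->.
- by move=> h _ hg; rewrite (bvec_supported R[i] g).2 ?mulr0.
Qed.

Lemma vec_ip g h : ip (vec g) (vec h) = (g == h)%:R * (lcard h)%:R.
Proof.
have [gh|gh] := pselect (src h = src g).
  rewrite (ip_incl_vec (@stepP R C B hT _ _) (src_unit g) (vec_l2 g) gh) /bvec.
  by rewrite eq_sym conjc_nat.
rewrite iota_orth; first by case: eqP => [E|_]; [rewrite E in gh|rewrite mul0r].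
- exact: src_unit.
- exact: src_unit.
- by move=> E; case: gh; rewrite E.
- exact: vec_l2.
- exact: vec_l2.
Qed.

Definition emb a : H := \sum_(g \in [set: arrow B]) a g *: vec g.

Lemma emb_seq a A : supported A a -> emb a = \sum_(g <- A) a g *: vec g.
Proof. by move=> [uA aA]; apply: fsum_seq => // g /aA ->; rewrite scale0r. Qed.

Lemma ip_emb_vec a A h : supported A a -> ip (emb a) (vec h) = conjc (a h) * (lcard h)%:R.
Proof.
move=> aA; rewrite (emb_seq aA) ip_suml.
rewrite -(@sum_bvec _ _ R[i] A h (fun g => conjc (a g) * (lcard g)%:R)); first last.
- by move=> hA; rewrite aA.2 // conjc0 mul0r.
- exact: aA.1.
apply: eq_bigr => g _; rewrite ipZl vec_ip /bvec.
by case: eqP => [->|]; rewrite ?mul1r ?mulr1 // mul0r !mulr0.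
Qed.

Lemma ip_emb a b A A' : supported A a -> supported A' b ->
  ip (emb a) (emb b) = \sum_(g <- A') conjc (a g) * b g * (lcard g)%:R.
Proof.
move=> aA bA; rewrite (emb_seq bA) ip_sumr; apply: eq_bigr => g _.
by rewrite ipZr (ip_emb_vec _ aA); ring.
Qed.

Lemma emb_lin (k : R[i]) a b : fin_supported a -> fin_supported b ->
  emb (fun g => k * a g + b g) = k *: emb a + emb b.
Proof.
move=> fa fb; have [A [aA bA]] := supported_common fa fb.
rewrite (emb_seq aA) (emb_seq bA) (@emb_seq _ A); last first.
  by split=> [|g gA]; [exact: aA.1|rewrite aA.2 // bA.2 // mulr0 addr0].
rewrite scaler_sumr -big_split /=; apply: eq_bigr => g _.
by rewrite scalerDl scalerA.
Qed.

(** Pythagoras: the sum is the orthogonal projection of the vector onto the span of the [vec g] for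
    [g] in [A]. *)
Lemma incl_sub_emb e (u : cmap (fib e)) (c : arrow B -> R[i]) A :
  values u c -> units e -> l2 R u -> uniq A -> (forall g, g \in A -> src g = e) ->
  let d := l2_incl L u - \sum_(g <- A) c g *: vec g in
  ip d d = ip (l2_incl L u) (l2_incl L u) - wsum A c c.
Proof.
move=> uc ue lu uA Ae d; rewrite /d ipBl !ipBr.
set S := \sum_(g <- A) _; set w := l2_incl L u.
have wS : ip w S = wsum A c c.
  rewrite ip_sumr /wsum [LHS]big_seq [RHS]big_seq; apply: eq_bigr => g gA.
  by rewrite ipZr (ip_incl_vec uc ue lu (Ae g gA)); ring.
have SS : ip S S = wsum A c c.
  pose cA g := if g \in A then c g else 0.
  have sA : supported A cA by split=> // g; rewrite /cA => /negbTE ->.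
  have -> : S = emb cA.
    by rewrite (emb_seq sA) /S [LHS]big_seq [RHS]big_seq; apply: eq_bigr => g gA; rewrite /cA gA.
  rewrite (ip_emb sA sA) /wsum [LHS]big_seq [RHS]big_seq; apply: eq_bigr => g gA.
  by rewrite /cA gA.
have Sw : ip S w = wsum A c c.
  rewrite ip_conj wS /wsum rmorph_sum; apply: eq_bigr => g _.
  by rewrite !rmorphM /= conjcK conjc_nat; ring.
by rewrite wS SS Sw; ring.
Qed.

(** The difference has norm zero by [incl_sub_emb]. In particular the vector depends only on the
    values of [u]. *)
Lemma incl_values e (u : cmap (fib e)) (c : arrow B -> R[i]) A :
  values u c -> units e -> l2 R u -> uniq A -> (forall g, g \in A -> src g = e) ->
  (forall g, src g = e -> g \notin A -> c g = 0) ->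
  l2_incl L u = \sum_(g <- A) c g *: vec g.
Proof.
move=> uc ue lu uA Ae cA; apply/eqP; rewrite -subr_eq0; apply/eqP; apply: ip_def.
rewrite (incl_sub_emb uc ue lu uA Ae) (values_inner uc uc uA Ae) ?subrr //.
by move=> g ge gA; rewrite cA // mulr0.
Qed.

(** All delta maps have the same image in [H], so the choice made by [xget] is harmless; [step]
    provides such a map, so the default is never reached. *)
Lemma delta_vecE e : units e -> delta_vec L e = vec e.
Proof.
move=> ue; have se := src_unitE ue.
have uniqe (u : cmap (fib e)) : is_delta R u -> l2_incl L u = vec e.
  move=> /(delta_values R hT u ue) uv.
  have Ae g : g \in [:: e] -> src g = e by rewrite inE => /eqP ->.
  have cA g : src g = e -> g \notin [:: e] -> bvec R[i] e g = 0.
    by move=> _; exact: (bvec_supported R[i] e).2.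
  rewrite (incl_values uv ue _ _ Ae cA) //; last exact: (values_l2 uv _ Ae cA).
  by rewrite big_seq1 /bvec eqxx scale1r.
rewrite /delta_vec; case: xgetP => [x _ [u [du ->]]|nex]; first exact: uniqe.
have du : is_delta R (step hT e (bvec R[i] e)) by apply/(delta_values R hT _ ue); exact: stepP.
by case: (nex (l2_incl L (step hT e (bvec R[i] e)))); exists (step hT e (bvec R[i] e)).
Qed.

Lemma rho_lin h (k : R[i]) (x y : H) : rho L h (k *: x + y) = k *: rho L h x + rho L h y.
Proof. exact: (rho_bounded L h).1. Qed.
Lemma rho0 h : rho L h 0 = 0.
Proof. by have := rho_lin h (-1) 0 0; rewrite scaler0 add0r scaleN1r addNr. Qed.
Lemma rhoD h (x y : H) : rho L h (x + y) = rho L h x + rho L h y.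
Proof. by have := rho_lin h 1 x y; rewrite !scale1r. Qed.
Lemma rhoZ h (k : R[i]) (x : H) : rho L h (k *: x) = k *: rho L h x.
Proof. by have := rho_lin h k x 0; rewrite rho0 !addr0. Qed.
Lemma rho_sum h (I : Type) (s : seq I) (F : I -> H) :
  rho L h (\sum_(i <- s) F i) = \sum_(i <- s) rho L h (F i).
Proof. by elim: s => [|i s IH]; rewrite ?big_nil ?rho0 // !big_cons rhoD IH. Qed.

Definition binom_supp g h : seq (arrow B) :=
  finmap.enum_fset (fset_set [set c | binom g h c <> 0%N]).

Lemma binom_suppP g h : supported (binom_supp g h) (fun c => (binom g h c)%:R : R[i]).
Proof.
split; first exact: finmap.fset_uniq.
move=> c; rewrite in_fset_set; last exact: binom_finite.
by rewrite notin_setE /= => /contrapT ->.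
Qed.

(** If [src g] is [tgt h], the translate has values [binom g h] by [right_action_values]; otherwise
    [rho_kill] gives 0 and all the counts vanish too. *)
Lemma rho_vec g h : rho L h (vec g) = emb (fun c => (binom g h c)%:R).
Proof.
have [gh|ngh] := pselect (src g = tgt h); last first.
  rewrite /vec (@rho_kill _ _ _ _ L h (src h) (tgt h) (src g)) //; last exact: vec_l2.
  - rewrite (emb_seq (binom_suppP g h)) big1 // => c _.
    have -> : binom g h c = 0%N by apply: contrapT => /(binom_ends hT hfin)[].
    by rewrite scale0r.
  - exact: endpoints.
  - exact: src_unit.
have sA := binom_suppP g h.
have Ae c : c \in binom_supp g h -> src c = src h.
  rewrite in_fset_set; last exact: binom_finite.
  by rewrite inE /= => /(binom_ends hT hfin)[].
have wv := @stepP R C B hT (src h) (fun c => (binom g h c)%:R).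
have wl2 : l2 R (step hT (src h) (fun c => (binom g h c)%:R : R[i])).
  by apply: (values_l2 wv sA.1 Ae) => c _; exact: sA.2.
have vv := @stepP R C B hT (tgt h) (bvec R[i] g).
have lv : l2 R (step hT (tgt h) (bvec R[i] g)) by have := vec_l2 g; rewrite gh.
rewrite /vec gh (rho_act L (endpoints h) lv wl2 (right_action_values hT hfin vv wv)).
rewrite (incl_values wv (src_unit h) wl2 sA.1 Ae) ?(emb_seq sA) //.
by move=> c _; exact: sA.2.
Qed.

Lemma amul_bvec a A h c : supported A a ->
  amul a (bvec R[i] h) c = \sum_(g <- A) a g * (binom g h c)%:R.
Proof.
move=> aA; rewrite (amul_seq hT hfin _ aA (bvec_supported R[i] h)).
by apply: eq_bigr => g _; rewrite big_seq1 /bvec eqxx mulr1.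
Qed.

Lemma rho_emb a h : fin_supported a -> rho L h (emb a) = emb (amul a (bvec R[i] h)).
Proof.
move=> fa; have /fin_supportedP[A aA] := fa.
have fm := amul_supported hT hfin fa (fin_supported_bvec R[i] h).
pose S := undup (flatten [seq binom_supp g h | g <- A]).
have gS g : g \in A -> supported S (fun c => (binom g h c)%:R : R[i]).
  move=> gA; apply: supported_widen (binom_suppP g h) (undup_uniq _) _ => c cg.
  by rewrite mem_undup; apply/flattenP; exists (binom_supp g h) => //; exact: map_f.
have mS : supported S (amul a (bvec R[i] h)).
  split=> [|c cS]; first exact: undup_uniq.
  rewrite (amul_bvec _ _ aA) big_seq big1 // => g /gS[_ /(_ c cS) ->].
  by rewrite mulr0.
rewrite (emb_seq mS) (emb_seq aA) rho_sum.
transitivity (\sum_(g <- A) \sum_(c <- S) (a g * (binom g h c)%:R) *: vec c).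
  rewrite [LHS]big_seq [RHS]big_seq; apply: eq_bigr => g gA.
  rewrite rhoZ rho_vec (emb_seq (gS g gA)) scaler_sumr.
  by apply: eq_bigr => c _; rewrite scalerA.
rewrite exchange_big /=; apply: eq_bigr => c _.
by rewrite (amul_bvec _ _ aA) scaler_suml.
Qed.

(** Internal convergence enters here: each vector of Hom(e, l^2(B)) is cut off to a finite set of
    arrows whose [wsum] nearly exhausts its squared norm. *)
Lemma emb_dense (x : H) (eps : R) : 0 < eps ->
  exists a, fin_supported a /\ hnorm (x - emb a) < eps.
Proof.
move=> e0; have [n [e [u [uP xu]]]] := iota_dense L x (divr_gt0 e0 (ltr0n R 2)).
(* Half of [eps] is shared between [n] summands; [n.+1] covers the case [n = 0]. *)
pose d := eps / 2 / (n.+1)%:R.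
have d0 : 0 < d by rewrite !divr_gt0 ?ltr0n.
have approx i : exists a, fin_supported a /\ hnorm (l2_incl L (u i) - emb a) <= d.
  have [ue lu] := uP i; have [c uc] := cmap_values R (u i).
  have [z uz] := lu; have d20 : 0 < d ^+ 2 by rewrite exprn_gt0.
  have [A [uA Ae Az]] := l2_approx hT hfin uc ue uz d20.
  pose cA g := if g \in A then c g else 0.
  have sA : supported A cA by split=> // g; rewrite /cA => /negbTE ->.
  exists cA; split; first by apply/fin_supportedP; exists A.
  have -> : emb cA = \sum_(g <- A) c g *: vec g.
    by rewrite (emb_seq sA) [LHS]big_seq [RHS]big_seq; apply: eq_bigr => g gA; rewrite /cA gA.
  have := incl_sub_emb uc ue lu uA Ae; rewrite (iota_ip L ue lu lu uz) /= -hnorm_sqr => E.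
  rewrite -ler_sqr ?nnegrE ?hnorm_ge0 ?(ltW d0) //.
  have N : `|(hnorm (l2_incl L (u i) - \sum_(g <- A) c g *: vec g) ^+ 2)%:C%C| <= (d ^+ 2)%:C%C.
    by rewrite E distrC ltW.
  exact: Re_le_norm N.
have [a aP] := choice approx.
exists (fun g => \sum_i a i g).
have [fa ea] : fin_supported (fun g => \sum_i a i g) /\
    emb (fun g => \sum_i a i g) = \sum_i emb (a i).
  suff K (s : seq 'I_n) : fin_supported (fun g => \sum_(i <- s) a i g) /\
    emb (fun g => \sum_(i <- s) a i g) = \sum_(i <- s) emb (a i) by exact: K.
  elim: s => [|i s [fs es]].
    have sn : supported [::] (fun g : arrow B => \sum_(i <- [::]) a i g).
      by split=> // g _; rewrite big_nil.
    split; first by apply/fin_supportedP; exists [::].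
    by rewrite (emb_seq sn) !big_nil.
  have -> : (fun g => \sum_(j <- i :: s) a j g) = (fun g => 1 * a i g + \sum_(j <- s) a j g).
    by apply/funext => g; rewrite big_cons mul1r.
  have [fai _] := aP i; split; first exact: fin_supported_lin.
  by rewrite emb_lin // scale1r es big_cons.
split=> //; rewrite ea; apply: (le_lt_trans (hnorm_trans _ (\sum_(i < n) l2_incl L (u i)) _)).
rewrite [eps]splitr; apply: ltr_leD => //.
rewrite -sumrB; apply: (le_trans (hnorm_sum _ _)).
apply: (@le_trans _ _ (\sum_(i < n) d)).
  by apply: ler_sum => i _; case: (aP i).
rewrite sumr_const card_ord -[d *+ n]mulr_natr.
have -> : eps / 2 = d * n.+1%:R by rewrite /d divfK // pnatr_eq0.
by rewrite ler_pM2l // ler_nat.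
Qed.

End Representation.

(** * Bounded operators tested on a dense subset *)

Section BoundedOperators.
Variables (R : realType) (H : hilbert R).
Implicit Types (S T : H -> H).

Lemma bounded_nonneg T : bounded_op T -> exists2 M : R, 0 <= M & forall x, hnorm (T x) <= M * hnorm x.
Proof.
case=> _ [M TM]; exists (Num.max 0 M) => [|x]; first by rewrite le_max lexx.
by apply: (le_trans (TM x)); rewrite ler_wpM2r ?hnorm_ge0 // le_max lexx orbT.
Qed.

Lemma bounded_comp S T : bounded_op S -> bounded_op T -> bounded_op (fun x => S (T x)).
Proof.
move=> bS bT; split=> [k x y|]; first by rewrite bT.1 bS.1.
have [M M0 SM] := bounded_nonneg bS; have [N N0 TN] := bounded_nonneg bT.
exists (M * N) => x; apply: (le_trans (SM _)).
by rewrite -mulrA ler_wpM2l.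
Qed.

Lemma bounded_add S T : bounded_op S -> bounded_op T -> bounded_op (fun x => S x + T x).
Proof.
move=> bS bT; split=> [k x y|]; first by rewrite bT.1 bS.1 scalerDr addrACA.
case: bS bT => _ [M SM] [_ [N TN]]; exists (M + N) => x.
rewrite /=; apply: (le_trans (hnorm_add _ _)); rewrite mulrDl; exact: lerD.
Qed.

Lemma bounded_scale (k : R[i]) T : bounded_op T -> bounded_op (fun x => k *: T x).
Proof.
move=> bT; split=> [j x y|]; first by rewrite bT.1 scalerDr !scalerA mulrC.
have [M M0 TM] := bounded_nonneg bT.
exists (Num.sqrt (complex.Re k ^+ 2 + complex.Im k ^+ 2) * M) => x.
rewrite -lecR hnorm_scale normc_def -rmorphM lecR -mulrA.
by rewrite ler_wpM2l ?sqrtr_ge0.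
Qed.

Lemma bounded_sum (I : Type) (s : seq I) (F : I -> H -> H) :
  (forall i, bounded_op (F i)) -> bounded_op (fun x => \sum_(i <- s) F i x).
Proof.
move=> bF; elim: s => [|i s IH].
  have -> : (fun x => \sum_(i <- [::]) F i x) = (fun=> 0) by apply/funext => x; rewrite big_nil.
  by split=> [k x y|]; [rewrite scaler0 addr0|exists 0 => x; rewrite hnorm0 mul0r].
have -> : (fun x => \sum_(i <- i :: s) F i x) = (fun x => F i x + \sum_(i <- s) F i x).
  by apply/funext => x; rewrite big_cons.
exact: bounded_add.
Qed.

Lemma bounded_sub T x y : bounded_op T -> T (x - y) = T x - T y.
Proof. by move=> [Tl _]; rewrite addrC -scaleN1r Tl scaleN1r addrC. Qed.

Variable D : set H.
Hypothesis dense : forall (x : H) (eps : R), 0 < eps -> exists a, D a /\ hnorm (x - a) < eps.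

Lemma bounded_dense T (x : H) (eps : R) : bounded_op T -> 0 < eps ->
  exists d, 0 < d /\ forall a, hnorm (x - a) < d -> hnorm (T x - T a) < eps.
Proof.
move=> bT e0; have [M M0 TM] := bounded_nonneg bT.
have M1 : 0 < M + 1 by rewrite ltr_pwDr.
exists (eps / (M + 1)); split=> [|a]; first exact: divr_gt0.
rewrite ltr_pdivlMr // mulrC => xa; rewrite -bounded_sub //.
apply: (le_lt_trans (TM _)); apply: le_lt_trans xa.
by rewrite ler_wpM2r ?hnorm_ge0 // lerDl.
Qed.

Lemma bounded_eq S T : bounded_op S -> bounded_op T -> (forall a, D a -> S a = T a) ->
  forall x, S x = T x.
Proof.
move=> bS bT ST x; apply/eqP; rewrite -subr_eq0; apply/eqP.
apply: (@hnorm_le0 _ _ _ 2) => eps e0 _.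
have [d [d0 dS]] := bounded_dense x bS e0; have [d' [d0' dT]] := bounded_dense x bT e0.
have m0 : 0 < Num.min d d' by rewrite lt_min d0.
have [a [Da]] := dense x m0; rewrite lt_min => /andP[xa xa'].
apply: (le_trans (hnorm_trans _ (S a) _)); rewrite mulrDr mulr1; apply: lerD.
  exact/ltW/dS.
by rewrite ST // hnorm_sub; exact/ltW/dT.
Qed.

Lemma adjoint_dense S T (c : R[i]) : bounded_op S -> bounded_op T ->
  (forall a b, D a -> D b -> ip a (T b) = c * ip (S a) b) ->
  forall x y, ip x (T y) = c * ip (S x) y.
Proof.
move=> bS bT ST x y; apply/eqP; rewrite -subr_eq0; apply/eqP.
set r := Num.sqrt (complex.Re c ^+ 2 + complex.Im c ^+ 2).
apply: (@complex_le0 R _ (hnorm x + hnorm (T y) + 1 + r * (hnorm (S x) + hnorm y + 1))) => eps e0 e1.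
have [d [d0 dS]] := bounded_dense x bS e0; have [d' [d0' dT]] := bounded_dense y bT e0.
have m0 : 0 < Num.min d eps by rewrite lt_min d0.
have m0' : 0 < Num.min d' eps by rewrite lt_min d0'.
have [a [Da]] := dense x m0; rewrite lt_min => /andP[xa xa'].
have [b [Db]] := dense y m0'; rewrite lt_min => /andP[yb yb'].
have -> : ip x (T y) - c * ip (S x) y =
    (ip x (T y) - ip a (T b)) - c * (ip (S x) y - ip (S a) b) by rewrite (ST a b Da Db); ring.
apply: (le_trans (ler_normB _ _)); rewrite [eps * _]mulrDr rmorphD; apply: lerD.
  exact: (ip_near e0 e1 xa' (dT b yb)).
rewrite normrM normc_def -/r mulrCA rmorphM ler_wpM2l ?ler0c ?sqrtr_ge0 //.
exact: (ip_near e0 e1 (dS a xa) yb').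
Qed.

End BoundedOperators.

(** * The functional [eta] on the algebra, the KMS condition and adjoints *)

Section Weight.
Variables (R : realType) (C : site) (B : sheaf C).
Hypotheses (hT : atomic_topos C) (hfin : locally_finite B).
Variables (H : hilbert R) (L : l2_rep B H).
Implicit Types (g h e : arrow B) (A : seq (arrow B)) (a b : arrow B -> R[i]).

Notation vec := (vec hT L).
Notation emb := (emb hT L).

Lemma alg_act_seq a A (x : H) : supported A a ->
  alg_act (rho L) a x = \sum_(g <- A) a g *: rho L g x.
Proof. by move=> [uA aA]; apply: fsum_seq => // g /aA ->; rewrite scale0r. Qed.

Lemma alg_act_bvec g (x : H) : alg_act (rho L) (bvec R[i] g) x = rho L g x.
Proof. by rewrite (alg_act_seq _ (bvec_supported R[i] g)) big_seq1 /bvec eqxx scale1r. Qed.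

Lemma alg_act_lin (k : R[i]) a b (x : H) : fin_supported a -> fin_supported b ->
  alg_act (rho L) (fun g => k * a g + b g) x = k *: alg_act (rho L) a x + alg_act (rho L) b x.
Proof.
move=> fa fb; have [A [aA bA]] := supported_common fa fb.
rewrite (alg_act_seq _ aA) (alg_act_seq _ bA) (@alg_act_seq _ A); last first.
  by split=> [|g gA]; [exact: aA.1|rewrite aA.2 // bA.2 // mulr0 addr0].
rewrite scaler_sumr -big_split /=; apply: eq_bigr => g _.
by rewrite scalerDl scalerA.
Qed.

Lemma alg_act_bounded a : fin_supported a -> bounded_op (alg_act (rho L) a).
Proof.
move=> /fin_supportedP[A aA].
have -> : alg_act (rho L) a = (fun x => \sum_(g <- A) a g *: rho L g x).
  by apply/funext => x; exact: alg_act_seq.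
by apply: bounded_sum => g; apply: bounded_scale; exact: rho_bounded.
Qed.

Lemma alg_act_Cred a : fin_supported a -> in_Cred L (alg_act (rho L) a).
Proof.
move=> fa; split; first exact: alg_act_bounded.
move=> eps e0; exists a; split=> // x.
by rewrite subrr hnorm0 mulr_ge0 ?hnorm_ge0 ?ltW.
Qed.

Lemma ip_vec_rho g h k : ip (vec h) (rho L g (vec k)) = (binom k g h)%:R * (lcard h)%:R.
Proof.
rewrite (rho_vec hT hfin) ip_conj (ip_emb_vec hT hfin L _ (binom_suppP R hT hfin k g)).
by rewrite rmorphM /= conjcK !conjc_nat.
Qed.

(** Only [g = e] contributes, as [binom e g e] vanishes for other arrows, and [vec e] has norm 1
    because [lcard e] is 1. *)
Lemma vstate_alg_act e a : units e -> fin_supported a ->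
  vstate L e (alg_act (rho L) a) = a e.
Proof.
move=> ue /fin_supportedP[A aA].
rewrite /vstate (delta_vecE hT hfin L ue) (alg_act_seq _ aA) ip_sumr.
rewrite -(@sum_bvec _ _ R[i] A e a aA.1 (aA.2 e)); apply: eq_bigr => g _.
rewrite ipZr ip_vec_rho (binom_unit_l hT hfin _ _ ue) (lcard_unit hfin ue) mulr1.
rewrite /bvec eq_sym; congr (_ * _%:R).
by case: eqP => // ge; rewrite ge (tgt_unitE ue) eqxx.
Qed.

Lemma eta_formE a A : supported A a ->
  eta_form L a = \sum_(e <- A | e \in @units C B) a e.
Proof.
move=> aA; have fa : fin_supported a by apply/fin_supportedP; exists A.
rewrite /eta_form -(fsum_seq_in (f := a) aA.1); last by move=> e _; exact: aA.2.
by apply: eq_fsbigr => e; rewrite inE => ue; exact: vstate_alg_act.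
Qed.

Lemma eta_amul a b A : supported A a -> fin_supported b ->
  eta_form L (amul a b) = \sum_(g <- A) a g * b (star g) * (rcard g)%:R.
Proof.
move=> aA /fin_supportedP[A' bA'].
have fm : fin_supported (amul a b).
  by apply: (amul_supported hT hfin); apply/fin_supportedP; [exists A|exists A'].
(* Among the units, [[g][h]] can have a nonzero coefficient only at [tgt g], so these units
   suffice. *)
pose S := undup [seq tgt g | g <- A].
have mE e : units e -> amul a b e =
    \sum_(g <- A) a g * b (star g) * (rcard g)%:R * (e == tgt g)%:R.
  move=> ue; rewrite (amul_seq hT hfin _ aA bA'); apply: eq_bigr => g _.
  rewrite -(@sum_bvec _ _ R[i] A' (star g)
     (fun h => a g * b h * (rcard g)%:R * (e == tgt g)%:R) bA'.1); last first.
    by move=> /bA'.2 ->; rewrite mulr0 !mul0r.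
  apply: eq_bigr => h _; rewrite (binom_unit hT hfin _ _ ue) /bvec.
  by case: eqP => _ /=; case: eqP => _ /=; rewrite ?mulr1 ?mulr0.
have -> : eta_form L (amul a b) = \sum_(e <- S | e \in @units C B) amul a b e.
  have -> : eta_form L (amul a b) = \sum_(e \in @units C B) amul a b e.
    by apply: eq_fsbigr => e; rewrite inE => ue; exact: vstate_alg_act.
  apply: fsum_seq_in; first exact: undup_uniq.
  move=> e ue eS; rewrite mE // big_seq big1 // => g gA.
  case: eqP => [eg|]; last by rewrite mulr0.
  by move/negP: eS; case; rewrite mem_undup eg; exact: map_f.
transitivity (\sum_(e <- S | e \in @units C B)
   \sum_(g <- A) a g * b (star g) * (rcard g)%:R * (e == tgt g)%:R).
  by apply: eq_bigr => e; rewrite inE; exact: mE.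
rewrite exchange_big /= [LHS]big_seq [RHS]big_seq; apply: eq_bigr => g gA.
rewrite -big_filter (bigD1_seq (tgt g)) ?filter_uniq ?undup_uniq //=; last first.
  rewrite mem_filter mem_undup map_f // andbT inE; exact: tgt_unit.
rewrite eqxx mulr1 big1 ?addr0 // => e /negbTE ->.
by rewrite mulr0.
Qed.

Lemma chi_star_rcard g : chi R g * (rcard g)%:R = (lcard g)%:R.
Proof. by rewrite /chi divfK // pnatr_eq0 -lt0n; exact: (rcard_gt0 hfin). Qed.

Lemma astar_star a A g : supported A a -> astar a (star g) = conjc (a g) * (chi R g)%:C%C.
Proof.
move=> [uA aA]; rewrite /astar (fsum_seq uA); last first.
  by move=> h /aA ->; rewrite conjc0 !mul0r.
rewrite -(@sum_bvec _ _ R[i] A g (fun h => conjc (a h) * (chi R h)%:C%C) uA); last first.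
  by move=> /aA ->; rewrite conjc0 mul0r.
by apply: eq_bigr => h _; rewrite /bvec (inj_eq (@star_inj _ B)) eq_sym.
Qed.

Lemma fin_supported_astar a : fin_supported a -> fin_supported (astar a).
Proof.
move=> /fin_supportedP[A aA]; apply/fin_supportedP; exists (map (@star C B) A).
split=> [|g gA]; first by rewrite map_inj_uniq ?aA.1 //; exact: star_inj.
rewrite -[g]starK (astar_star _ aA) aA.2 ?conjc0 ?mul0r //.
by apply: contra gA => gA; rewrite -[g]starK map_f.
Qed.

(** The factor [chi g] of the involution turns the weight [rcard g] of [eta_amul] into the weight
    [lcard g] of the scalar product of [H]. *)
Lemma eta_gns a b : fin_supported a -> fin_supported b ->
  eta_form L (amul b (astar a)) = ip (emb a) (emb b).
Proof.
move=> fa fb; have [A [aA bA]] := supported_common fa fb.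
rewrite (eta_amul bA (fin_supported_astar fa)) (ip_emb hT hfin L aA bA).
apply: eq_bigr => g _; rewrite (astar_star _ aA).
have -> : (lcard g)%:R = (chi R g)%:C%C * (rcard g)%:R :> R[i].
  by rewrite -(rmorph_nat (real_complex R)) -chi_star_rcard rmorphM rmorph_nat.
by ring.
Qed.

Lemma chi_gt0 g : 0 < chi R g.
Proof. by rewrite divr_gt0 ?ltr0n ?(lcard_gt0 hfin) ?(rcard_gt0 hfin). Qed.

Lemma chi_ipow_i g : chi_ipow g ('i)%C = ((chi R g)^-1)%:C%C.
Proof.
rewrite /chi_ipow /= mul0r cos0 sin0 mulr1 mulr0 mulN1r expRN lnK //.
by rewrite posrE chi_gt0.
Qed.

Lemma eta_kms : kms (eta_form L).
Proof.
move=> a b fa fb; have [A0 [aA0 bA0]] := supported_common fa fb.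
(* A list closed under [star] allows the sum for [amul b a] to be reindexed by [star]. *)
pose A := undup (A0 ++ map (@star C B) A0).
have sA : {subset A0 <= A} by move=> g gA; rewrite mem_undup mem_cat gA.
have aA := supported_widen aA0 (undup_uniq _) sA.
have bA := supported_widen bA0 (undup_uniq _) sA.
have starA : perm_eq (map (@star C B) A) A.
  apply: uniq_perm; rewrite ?map_inj_uniq ?undup_uniq //; first exact: star_inj.
  have mem_star (s : seq (arrow B)) g : (g \in map (@star C B) s) = (star g \in s).
    by rewrite -{1}[g]starK (mem_map (@star_inj _ B)).
  by move=> g; rewrite mem_star !mem_undup !mem_cat !mem_star starK orbC.
have sb : fin_supported (sigma ('i)%C b).
  apply/fin_supportedP; exists A; split; first exact: undup_uniq.
  by move=> g gA; rewrite /sigma bA.2 // mulr0.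
rewrite (eta_amul aA sb) (eta_amul bA fa) -[RHS](perm_big _ starA) big_map.
apply: eq_bigr => g _; rewrite starK (rcard_star hfin) /sigma chi_ipow_i.
have -> : (chi R (star g))^-1 = chi R g.
  by rewrite /chi (lcard_star hfin) (rcard_star hfin) invf_div.
have -> : (lcard g)%:R = (chi R g)%:C%C * (rcard g)%:R :> R[i].
  by rewrite -(rmorph_nat (real_complex R)) -chi_star_rcard rmorphM rmorph_nat.
by ring.
Qed.

Lemma vec_dense_emb (x : H) (eps : R) : 0 < eps ->
  exists y, (exists2 a, fin_supported a & y = emb a) /\ hnorm (x - y) < eps.
Proof.
by move=> e0; have [a [fa xa]] := emb_dense hT hfin L x e0; exists (emb a); split=> //; exists a.
Qed.

Lemma bounded_eq_vec (S T : H -> H) : bounded_op S -> bounded_op T ->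
  (forall g, S (vec g) = T (vec g)) -> forall x, S x = T x.
Proof.
move=> bS bT ST; apply: (bounded_eq vec_dense_emb bS bT) => _ [a fa ->].
have /fin_supportedP[A aA] := fa.
have lin (U : H -> H) : bounded_op U -> U (emb a) = \sum_(g <- A) a g *: U (vec g).
  move=> bU; have U0 : U 0 = 0 by have := bU.1 (-1) 0 0; rewrite scaler0 add0r scaleN1r addNr.
  rewrite (emb_seq hT L aA); elim: A {aA} => [|g A IH]; first by rewrite !big_nil.
  by rewrite !big_cons bU.1 IH.
by rewrite !lin //; apply: eq_bigr => g _; rewrite ST.
Qed.

Lemma rho_unit_vec e g : units e -> rho L e (vec g) = (e == src g)%:R *: vec g.
Proof.
move=> ue; rewrite (rho_vec hT hfin).
rewrite (@emb_seq _ _ _ hT _ L _ [:: g]); last first.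
  split=> // c; rewrite inE => /negbTE cg.
  by rewrite (binom_unit_r hT hfin _ _ ue) cg.
by rewrite big_seq1 (binom_unit_r hT hfin _ _ ue) eqxx.
Qed.

(** Every arrow occurring in [[k][g]] has the source of [g], so the projection of that source fixes
    the image of each basis vector. *)
Lemma rho_src g (x : H) : rho L (src g) (rho L g x) = rho L g x.
Proof.
apply: (bounded_eq_vec (S := fun x => rho L (src g) (rho L g x))); last first.
- move=> k; rewrite (rho_vec hT hfin) (emb_seq hT L (binom_suppP R hT hfin k g)) rho_sum.
  apply: eq_bigr => c _; rewrite rhoZ (rho_unit_vec _ (src_unit g)).
  have [->|/eqP n0] := eqVneq (binom k g c) 0%N; first by rewrite !scale0r.
  by have [_ _ ->] := binom_ends hT hfin n0; rewrite eqxx scale1r.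
- exact: rho_bounded.
- by apply: bounded_comp; exact: rho_bounded.
Qed.

Lemma rho_tgt g (x : H) : rho L g (rho L (tgt g) x) = rho L g x.
Proof.
apply: (bounded_eq_vec (S := fun x => rho L g (rho L (tgt g) x))); last first.
- move=> k; rewrite (rho_unit_vec _ (tgt_unit g)) rhoZ.
  case: eqP => [_|ne]; first by rewrite scale1r.
  rewrite scale0r (rho_vec hT hfin) (emb_seq hT L (binom_suppP R hT hfin k g)) big1 // => c _.
  have -> : binom k g c = 0%N.
    by apply: contrapT => /(binom_ends hT hfin)[E _ _]; apply: ne; rewrite E.
  by rewrite scale0r.
- exact: rho_bounded.
- by apply: bounded_comp; exact: rho_bounded.
Qed.

(** By density it is enough to test basis vectors, where the identity becomes [binom_adjoint] once
    multiplied by [rcard g], the denominator of [chi g]. *)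
Lemma rho_adjoint g (x y : H) :
  ip x (rho L g y) = (chi R g)%:C%C * ip (rho L (star g) x) y.
Proof.
apply: (adjoint_dense vec_dense_emb) => [||_ _ [a fa ->] [b fb ->]].
- exact: rho_bounded.
- exact: rho_bounded.
have [A [aA bA]] := supported_common fa fb.
rewrite (emb_seq hT L aA) (emb_seq hT L bA) !rho_sum !ip_suml mulr_sumr.
apply: eq_bigr => h _; rewrite !ip_sumr mulr_sumr; apply: eq_bigr => k _.
rewrite !rhoZ !ipZl !ipZr ip_vec_rho.
have -> : ip (rho L (star g) (vec h)) (vec k) = (binom h (star g) k)%:R * (lcard k)%:R.
  by rewrite ip_conj ip_vec_rho rmorphM /= !conjc_nat.
suff -> : (binom k g h)%:R * (lcard h)%:R =
    (chi R g)%:C%C * ((binom h (star g) k)%:R * (lcard k)%:R) :> R[i] by ring.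
apply: (@mulIf _ (rcard g)%:R); first by rewrite pnatr_eq0 -lt0n; exact: (rcard_gt0 hfin).
rewrite -!natrM (binom_adjoint hT hfin) mulrAC.
have -> : (chi R g)%:C%C * (rcard g)%:R = (lcard g)%:R :> R[i].
  by rewrite -(rmorph_nat (real_complex R)) -rmorphM chi_star_rcard rmorph_nat.
by rewrite -natrM mulnC.
Qed.
End Weight.

(** * The weight *)

Section PositiveElements.
Variables (R : realType) (C : site) (B : sheaf C).
Hypotheses (hT : atomic_topos C) (hfin : locally_finite B).
Variables (H : hilbert R) (L : l2_rep B H).
Implicit Types (g h e : arrow B) (A : seq (arrow B)) (a b : arrow B -> R[i]).

Lemma conjc_realM (r : R) (z : R[i]) : conjc (r%:C%C * z) = r%:C%C * conjc z.
Proof. by rewrite rmorphM /= oppr0. Qed.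

Definition lin_elt (s : seq (R[i] * arrow B)) : arrow B -> R[i] :=
  fun h => \sum_(p <- s) p.1 * bvec R[i] p.2 h.

Lemma lin_elt_cons p s : lin_elt (p :: s) = fun h => p.1 * bvec R[i] p.2 h + lin_elt s h.
Proof. by apply/funext => h; rewrite /lin_elt big_cons. Qed.

Lemma lin_elt_nil : supported [::] (lin_elt [::]).
Proof. by split=> // h _; rewrite /lin_elt big_nil. Qed.

Lemma fin_supported_lin_elt s : fin_supported (lin_elt s).
Proof.
elim: s => [|p s IH]; first by apply/fin_supportedP; exists [::]; exact: lin_elt_nil.
by rewrite lin_elt_cons; apply: fin_supported_lin => //; exact: fin_supported_bvec.
Qed.

Lemma alg_act_lin_elt s (x : H) :
  alg_act (rho L) (lin_elt s) x = \sum_(p <- s) p.1 *: rho L p.2 x.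
Proof.
elim: s => [|p s IH]; first by rewrite (alg_act_seq L x lin_elt_nil) !big_nil.
rewrite lin_elt_cons alg_act_lin; last exact: fin_supported_lin_elt.
  by rewrite IH alg_act_bvec big_cons.
exact: fin_supported_bvec.
Qed.

(** A unit acts as an orthogonal projection: idempotent by [rho_src], self-adjoint because [chi] is
    1 on units. *)
Lemma ip_rho_unit e (x : H) : units e -> ip x (rho L e x) = (hnorm (rho L e x) ^+ 2)%:C%C.
Proof.
move=> ue; rewrite hnorm_sqr.
have E : rho L e (rho L e x) = rho L e x.
  by have := rho_src hT hfin L e x; rewrite src_unitE.
rewrite -[in LHS]E (rho_adjoint hT hfin) (unit_star ue) /chi -(lcard_star hfin).
by rewrite (unit_star ue) (lcard_unit hfin ue) divr1 mul1r.
Qed.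

(* Writing [P e] for the projection [rho e], the operator
   [M (P (tgt g) + P (src g)) + u [g] + conj u [g]^*] is positive as soon as [M]
   bounds [[g]], since [[g]] factors through both projections. *)
Definition pos_elt (M : R) (u : R[i]) g :=
  lin_elt [:: (M%:C%C, tgt g); (M%:C%C, src g); (u, g); (conjc u * (chi R g)%:C%C, star g)].

Lemma pos_eltE M u g (x : H) : alg_act (rho L) (pos_elt M u g) x =
  M%:C%C *: rho L (tgt g) x + M%:C%C *: rho L (src g) x + u *: rho L g x +
  (conjc u * (chi R g)%:C%C) *: rho L (star g) x.
Proof. by rewrite alg_act_lin_elt !big_cons big_nil addr0 /= !addrA. Qed.

(** With [p], [q] the norms of the two projections of [x] and [w = ip x (rho L g x)], the form
    equals [M (p^2 + q^2) + 2 Re (u w)]. As [|u w| <= M p q], it is at least [M (p - q)^2]. *)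
Lemma pos_elt_positive (M : R) (u : R[i]) g : 0 <= M -> `|u| <= 1 ->
  (forall x, hnorm (rho L g x) <= M * hnorm x) ->
  positive_op (alg_act (rho L) (pos_elt M u g)).
Proof.
move=> M0 u1 gM x; rewrite pos_eltE !ipDr !ipZr.
rewrite (ip_rho_unit _ (tgt_unit g)) (ip_rho_unit _ (src_unit g)).
set p := hnorm (rho L (tgt g) x); set q := hnorm (rho L (src g) x).
set w := ip x (rho L g x).
have -> : conjc u * (chi R g)%:C%C * ip x (rho L (star g) x) = conjc (u * w).
  rewrite [conjc (u * w)]rmorphM /= /w (rho_adjoint hT hfin L g) conjc_realM -ip_conj.
  by ring.
have wle : `|w| <= (M * p * q)%:C%C.
  have -> : w = ip (rho L (src g) x) (rho L g (rho L (tgt g) x)).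
    rewrite (rho_tgt hT hfin) /w -[in LHS](rho_src hT hfin) (rho_adjoint hT hfin).
    rewrite (unit_star (src_unit g)) /chi -(lcard_star hfin) (unit_star (src_unit g)).
    by rewrite (lcard_unit hfin (src_unit g)) divr1 mul1r.
  apply: (le_trans (cauchy_schwarz _ _)); rewrite lecR mulrC.
  by rewrite ler_wpM2r ?hnorm_ge0 //; exact: gM.
have uwle : `|- (u * w)| <= (M * p * q)%:C%C.
  rewrite normrN normrM; apply: le_trans wle.
  by rewrite ler_piMl.
have := Re_le_norm uwle; have p0 : 0 <= p := hnorm_ge0 _; have q0 : 0 <= q := hnorm_ge0 _.
case: (u * w) => r s /= rle.
rewrite lecE /=; apply/andP; split; first by apply/eqP; ring.
have : 0 <= M * (p - q) ^+ 2 by rewrite mulr_ge0 ?sqr_ge0.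
nra.
Qed.

(** Keeps the four coefficients visible, so that an identity in [H] splits into four identities of
    complex numbers. *)
Definition comb4 (P Q S T : H) (a b c d : R[i]) : H := a *: P + b *: Q + c *: S + d *: T.

Lemma comb4D P Q S T (a b c d a' b' c' d' : R[i]) :
  comb4 P Q S T a b c d + comb4 P Q S T a' b' c' d' =
  comb4 P Q S T (a + a') (b + b') (c + c') (d + d').
Proof.
rewrite /comb4 addrACA -scalerDl; congr (_ + _).
by rewrite addrACA -scalerDl; congr (_ + _); rewrite addrACA -!scalerDl.
Qed.

Lemma comb4Z P Q S T (k a b c d : R[i]) :
  k *: comb4 P Q S T a b c d = comb4 P Q S T (k * a) (k * b) (k * c) (k * d).
Proof. by rewrite /comb4 !scalerDr !scalerA. Qed.

(** Polarisation: with weights [1/2] at [u = 1] and [-i/2] at [u = i], the coefficients of [[g]] add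
    up to 1 and those of [star g] cancel. What is left is [(1 - i)/2] times the element with
    [u = 0], which the third term removes. *)
Lemma rho_pos_elt (M : R) g (x : H) :
  rho L g x = 2^-1 *: alg_act (rho L) (pos_elt M 1 g) x +
    (- ('i%C / 2)) *: alg_act (rho L) (pos_elt M ('i)%C g) x +
    (- ((1 - 'i%C) / 2)) *: alg_act (rho L) (pos_elt M 0 g) x.
Proof.
rewrite !pos_eltE -!/(comb4 _ _ _ _ _ _ _ _) !comb4Z !comb4D.
have ii : 'i%C * 'i%C = -1 :> R[i] by rewrite -expr2 sqr_i.
have ci : conjc 'i%C = - 'i%C :> R[i] by apply/eqP; rewrite eq_complex /= oppr0 !eqxx.
rewrite conjc1 conjc0 ci; move: (chi R g)%:C%C => X.
have two : 2^-1 + 2^-1 = 1 :> R[i] by rewrite -[2^-1]mul1r -splitr.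
have hi : - ('i%C / 2) * 'i%C = 2^-1 :> R[i] by rewrite mulNr mulrAC ii mulN1r opprK.
set k := comb4 _ _ _ _ _ _ _ _.
have -> : k = comb4 (rho L (tgt g) x) (rho L (src g) x) (rho L g x) (rho L (star g) x) 0 0 1 0.
  rewrite /k; congr comb4.
  - by ring.
  - by ring.
  - by rewrite hi mulr0 addr0 mulr1.
  - rewrite mul0r mulr0 addr0 mul1r.
    have -> : - ('i%C / 2) * (- 'i%C * X) = - (- ('i%C / 2) * 'i%C * X) :> R[i] by ring.
    by rewrite hi subrr.
by rewrite /comb4 !scale0r scale1r !add0r addr0.
Qed.

End PositiveElements.

(** One inequality, used for [k] and for its inverse, gives both; [k = 0] is treated apart. *)
Lemma esumZl (R : realType) (T : choiceType) (D : set T) (k : R) (f : T -> R) : 0 <= k ->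
  (forall i, D i -> 0 <= f i) ->
  (\esum_(i in D) (k * f i)%:E = k%:E * \esum_(i in D) (f i)%:E)%E.
Proof.
move=> k0 f0.
have half (c : R) (u : T -> R) : 0 < c ->
    (\esum_(i in D) (c * u i)%:E <= c%:E * \esum_(i in D) (u i)%:E)%E.
  move=> c0; apply: ge_ereal_sup => _ [X [finX XD] <-].
  have -> : (\sum_(i \in X) (c * u i)%:E = c%:E * \sum_(i \in X) (u i)%:E)%E.
    by rewrite !fsumEFin // -EFinM !fsbig_finite //= mulr_sumr.
  by apply: lee_wpmul2l; [rewrite lee_fin ltW|apply: ereal_sup_ubound; exists X].
move: k0; rewrite le_eqVlt => /orP[/eqP <-|k0].
  by rewrite mul0e esum1 // => i _; rewrite mul0r.
apply/eqP; rewrite eq_le half //=.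
have -> : (\esum_(i in D) (f i)%:E = \esum_(i in D) (k^-1 * (k * f i))%:E)%E.
  by apply: eq_esum => i _; rewrite mulKf // gt_eqF.
have kV : 0 < k^-1 by rewrite invr_gt0.
have := half k^-1 (fun i => k * f i) kV.
move=> /(lee_wpmul2l (x := k%:E)) H; apply: le_trans (H _) _; first by rewrite lee_fin ltW.
by rewrite muleA -EFinM mulfV ?mul1e // gt_eqF.
Qed.

Section EtaWeight.
Variables (R : realType) (C : site) (B : sheaf C).
Hypotheses (hT : atomic_topos C) (hfin : locally_finite B).
Variables (H : hilbert R) (L : l2_rep B H).
Implicit Types (g h e : arrow B) (A : seq (arrow B)) (a b : arrow B -> R[i]).

Lemma Re_vstate_ge0 e (T : H -> H) : positive_op T -> 0 <= complex.Re (vstate L e T).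
Proof. by move=> pT; apply: Re_ge0; exact: pT. Qed.

Lemma eta_is_weight : is_weight L (eta_weight L).
Proof.
split=> [T [_ pT]|S T [_ pS] [_ pT]|k T k0 [_ pT]].
- by apply: esum_ge0 => e _; rewrite lee_fin Re_vstate_ge0.
- rewrite /eta_weight -esumD; try by move=> e _; rewrite lee_fin Re_vstate_ge0.
  by apply: eq_esum => e _; rewrite /vstate ipDr complexReD.
- rewrite /eta_weight -esumZl //; last by move=> e _; exact: Re_vstate_ge0.
  by apply: eq_esum => e _; rewrite /vstate ipZr complexReM /= mul0r subr0.
Qed.

Lemma eta_finite : finite_on_algebra L.
Proof.
move=> a fa; have /fin_supportedP[A aA] := fa; split.
  apply: (@sub_finite_set _ _ [set` A]); last exact: finite_seq.
  move=> e /= [ue]; rewrite (vstate_alg_act hT hfin L ue fa).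
  by apply: contraNT => /aA.2 ->.
move=> pa; rewrite (eta_formE hT hfin L aA) /eta_weight.
have aE e : units e -> complex.Re (vstate L e (alg_act (rho L) a)) = complex.Re (a e).
  by move=> ue; rewrite (vstate_alg_act hT hfin L ue fa).
have a0 e : units e -> 0 <= complex.Re (a e) by move=> ue; rewrite -aE // Re_vstate_ge0.
have -> : (\esum_(e in @units C B) (complex.Re (vstate L e (alg_act (rho L) a)))%:E =
   \esum_(e in @units C B) (complex.Re (a e))%:E)%E.
  by apply: eq_esum => e ue; rewrite aE.
(* Split the units into those in [A], where the sum is finite, and the others, where the
   coefficients vanish. *)
rewrite (esumID [set` A]); last by move=> e ue; rewrite lee_fin a0.
rewrite [X in (_ + X)%E]esum1 ?adde0; last first.
  by move=> e [_ /= /negP eA]; rewrite aA.2.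
have finA : finite_set (@units C B `&` [set` A]) by apply: finite_setIr; exact: finite_seq.
rewrite esum_fset //; last by move=> e; rewrite inE => -[ue _]; rewrite lee_fin a0.
rewrite fsumEFin //; congr _%:E.
rewrite (fsum_seq_in aA.1); last by move=> e [_ /= eA] /negP.
have -> : complex.Re (\sum_(e <- A | e \in @units C B) a e) =
    \sum_(e <- A | e \in @units C B) complex.Re (a e).
  by apply: (big_morph _ (@complexReD R)).
rewrite [LHS]big_seq_cond [RHS]big_seq_cond; apply: eq_bigl => e.
have [eA|//] := boolP (e \in A); rewrite in_setI.
have -> : e \in [set` A] by rewrite inE.
by rewrite andbT.
Qed.

Lemma eta_semifinite : semifinite L (eta_weight L).
Proof.
move=> T [_ TC] eps e0; have [a [fa Ta]] := TC eps e0.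
have /fin_supportedP[A aA] := fa.
have /choice[M MP] : forall g, exists M : R, 0 <= M /\ forall x, hnorm (rho L g x) <= M * hnorm x.
  by move=> g; have [M M0 gM] := bounded_nonneg (rho_bounded L g); exists M.
(* The index [j] runs over the three positive elements attached to each [g] by [rho_pos_elt]; [k]
   holds their coefficients. *)
pose u (j : option bool) : R[i] := match j with Some true => 1 | Some false => 'i%C | None => 0 end.
pose k (j : option bool) : R[i] := match j with
  | Some true => 2^-1 | Some false => - ('i%C / 2) | None => - ((1 - 'i%C) / 2) end.
pose J := [:: Some true; Some false; None].
pose I := [seq (g, j) | g <- A, j <- J].
pose S (p : arrow B * option bool) := alg_act (rho L) (pos_elt (M p.1) (u p.2) p.1).
exists (size I), (fun i => a (tnth (in_tuple I) i).1 * k (tnth (in_tuple I) i).2).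
exists (fun i => S (tnth (in_tuple I) i)); split=> [i|x].
  move: (tnth _ i) => [g j]; have [M0 gM] := MP g.
  have fs : fin_supported (pos_elt (M g) (u j) g) by exact: fin_supported_lin_elt.
  have u1 : `|u j| <= 1.
    case: j {fs} => [[]|] /=; rewrite ?normr1 ?normr0 ?ler01 //.
    by rewrite normc_def /= expr0n /= add0r expr1n sqrtr1.
  have pS : positive_op (S (g, j)) by exact: (@pos_elt_positive R C B hT hfin H L (M g) (u j) g M0 u1 gM).
  split; first by split=> //; exact: alg_act_Cred.
  by rewrite (eta_finite fs).2 // ltry.
have -> : \sum_(i < size I) (a (tnth (in_tuple I) i).1 * k (tnth (in_tuple I) i).2) *:
    S (tnth (in_tuple I) i) x = alg_act (rho L) a x; last exact: Ta.
rewrite -(big_tnth _ _ I xpredT (fun p => (a p.1 * k p.2) *: S p x)).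
rewrite big_allpairs (alg_act_seq L x aA); apply: eq_bigr => g _.
rewrite !big_cons big_nil /= addr0 [in RHS](rho_pos_elt L (M g) g x) /=.
by rewrite !scalerDr !scalerA !addrA.
Qed.

End EtaWeight.

Unset Implicit Arguments.

Theorem proposition4p6p4 (R : realType) (C : site) (B : sheaf C)
    (hT : atomic_topos C) (hdec : decidable_hypergroupoid B)
    (hfin : locally_finite B) (H : hilbert R) (L : l2_rep B H) :
  [/\ forall e q : arrow B, units e ->
        vstate L e (alg_act (rho L) (bvec R[i] q)) = (q == e)%:R,
      is_weight L (eta_weight L) /\ semifinite L (eta_weight L) /\
        finite_on_algebra L,
      forall (K : hilbert R) (Lam : (arrow B -> R[i]) -> K),
        gns_completion (eta_form L) Lam ->
        exists rmul : arrow B -> K -> K, gns_action Lam rmul /\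
        exists Q : K -> H, unitary Q /\
          forall g x, Q (rmul g x) = rho L g (Q x) &
      kms (eta_form L)].
Proof.
split.
- move=> e q ue; rewrite (vstate_alg_act hT hfin L ue (fin_supported_bvec R[i] q)).
  by rewrite /bvec eq_sym.
- split; first exact: eta_is_weight.
  by split; [exact: eta_semifinite|exact: eta_finite].
- move=> K Lam [_ Lip Ldense].
  have Lemb a b : fin_supported a -> fin_supported b ->
      ip (Lam a) (Lam b) = ip (emb hT L a) (emb hT L b).
    by move=> fa fb; rewrite Lip // (eta_gns hT hfin).
  (* [Lam] and [emb] both have dense range and induce the same scalar product on the algebra, so
     matching them extends to a unitary; right multiplication on [K] is then [rho] conjugated by
     it. *)
  have [Q [uQ QL]] := dense_isometry Lemb Ldense (emb_dense hT hfin L).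
  have [rmul rP] := choice (fun g => unitary_transport uQ (rho_bounded L g)).
  exists rmul; split; last by exists Q; split=> // g x; case: (rP g).
  move=> g; have [bg Qg] := rP g; split=> // a fa.
  have [_ Qip _] := uQ; apply: (isometry_inj Qip).
  rewrite Qg !QL //; first exact: rho_emb.
  by apply: (amul_supported hT hfin) => //; exact: fin_supported_bvec.
- exact: (eta_kms hT hfin).
Qed.
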